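(* Let $(X_t\colon t\in\mathbb{Z})$ be a weakly stationary zero-mean process with values in $H=L^2([0,1])$ with $\sum_{h\in\mathbb{Z}}\|C_h\|_{\mathcal{S}}<\infty$, let $Y_{mt}=\sum_{\ell\in\mathbb{Z}}\langle X_{t-\ell},\phi_{m\ell}\rangle$ be its dynamic functional principal component scores, and let $X_{mt}:=\sum_{\ell\in\mathbb{Z}}Y_{m,t+\ell}\,\phi_{m\ell}$. For $m\ge1$ let $(\psi_{mk}\colon k\in\mathbb{Z})$ and $(\upsilon_{mk}\colon k\in\mathbb{Z})$ be sequences in $H$ belonging to the class $\mathcal{C}$, and put $\tilde Y_{mt}=\sum_{\ell\in\mathbb{Z}}\langle X_{t-\ell},\psi_{m\ell}\rangle$ and $\tilde X_{mt}=\sum_{\ell\in\mathbb{Z}}\tilde Y_{m,t+\ell}\,\upsilon_{m\ell}$. Then, for every $p\ge1$ (and every $t\in\mathbb{Z}$), $$E\Big\|X_t-\sum_{m=1}^pX_{mt}\Big\|^2=\sum_{m>p}\int_{-\pi}^{\pi}\lambda_m(\theta)\,d\theta\;\le\;E\Big\|X_t-\sum_{m=1}^p\tilde X_{mt}\Big\|^2 .$$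
   Context: $H=L^2([0,1])$ is the Hilbert space of complex-valued square-integrable functions on $[0,1]$, with $\langle x,y\rangle=\int_0^1x(u)\overline{y(u)}\,du$ and $\|x\|=\langle x,x\rangle^{1/2}$. A zero-mean $H$-valued process $(X_t\colon t\in\mathbb{Z})$ is weakly stationary if $E\|X_t\|^2<\infty$, $EX_t=0$ and $c_h(u,v):=E[X_{t+h}(u)\overline{X_t(v)}]$ does not depend on $t$. $C_h$ is the operator with kernel $c_h$, i.e. $C_h(x)(u)=\int_0^1c_h(u,v)x(v)\,dv$, and $\|\cdot\|_{\mathcal{S}}$ is the Hilbert--Schmidt norm. Spectral density operator: $\mathcal{F}^X_\theta:=\frac{1}{2\pi}\sum_{h\in\mathbb{Z}}C_he^{-\mathrm{i}h\theta}$, $\theta\in[-\pi,\pi]$. Under $\sum_h\|C_h\|_{\mathcal{S}}<\infty$ it is, for each $\theta$, a non-negative self-adjoint Hilbert--Schmidt operator, with spectral representation $\mathcal{F}^X_\theta(x)=\sum_{m\ge1}\lambda_m(\theta)\langle x,\varphi_m(\theta)\rangle\varphi_m(\theta)$, where $\lambda_1(\theta)\ge\lambda_2(\theta)\ge\cdots\ge0$ and the eigenfunctions $\varphi_m(\theta)=\varphi_m(\cdot|\theta)$ are orthonormal. A version of the eigenfunctions is fixed such that $(u,\theta)\mapsto\varphi_m(u|\theta)$ is jointly measurable. Dynamic FPC filter coefficients: $\phi_{m\ell}(u):=\frac{1}{2\pi}\int_{-\pi}^{\pi}\varphi_m(u|s)e^{-\mathrm{i}\ell s}\,ds$ for (almost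 every) $u$ such that $\varphi_m(u|\cdot)\in L^2([-\pi,\pi])$, and $\phi_{m\ell}(u):=0$ otherwise. The $m$-th dynamic functional principal component score is $Y_{mt}:=\sum_{\ell\in\mathbb{Z}}\langle X_{t-\ell},\phi_{m\ell}\rangle$. Class $\mathcal{C}$: a sequence $(\psi_\ell\colon\ell\in\mathbb{Z})$ in $H$ belongs to $\mathcal{C}$ if there is a square-integrable function $\psi^\star(u|\theta)$ on $[0,1]\times[-\pi,\pi]$ such that $\lim_{N\to\infty}\int_{-\pi}^{\pi}\int_0^1\big|\sum_{\ell=-N}^N\psi_\ell(u)e^{\mathrm{i}\ell\theta}-\psi^\star(u|\theta)\big|^2du\,d\theta=0$ and $\sup_{\theta\in[-\pi,\pi]}\int_0^1|\psi^\star(u|\theta)|^2du<\infty$. All infinite series of random elements converge in mean square, as limits of partial sums over $|\ell|\le N$, $N\to\infty$. *)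

(* Defs.v *)
From HB Require Import structures.
From mathcomp Require Import all_boot all_order all_algebra.
From mathcomp Require Import all_classical all_reals all_analysis.
From mathcomp Require Import complex.
Set Implicit Arguments.
Unset Strict Implicit.
Unset Printing Implicit Defensive.
Import Order.TTheory GRing.Theory Num.Theory.
Import numFieldNormedType.Exports.
Local Open Scope classical_set_scope.
Local Open Scope ring_scope.
Local Open Scope complex_scope.

Section complex_integration.
Context {R : realType} {d : measure_display} {T : measurableType d}.
Variables (mu : {measure set T -> \bar R}) (D : set T).
Implicit Types f : T -> R[i].

Definition sqmod (z : R[i]) : R := complex.Re z ^+ 2 + complex.Im z ^+ 2.

Definition cmeasurable f : Prop :=
  measurable_fun D (fun x => complex.Re (f x)) /\
  measurable_fun D (fun x => complex.Im (f x)).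

Definition cintegral f : R[i] :=
  (\int[mu]_(x in D) complex.Re (f x)) +i*
  (\int[mu]_(x in D) complex.Im (f x)).

Definition sqnorm f : \bar R := (\int[mu]_(x in D) (sqmod (f x))%:E)%E.

Definition inL2 f : Prop := cmeasurable f /\ (sqnorm f < +oo)%E.

Definition L2_cvg (s : nat -> T -> R[i]) (l : T -> R[i]) : Prop :=
  inL2 l /\ sqnorm (fun x => s n x - l x) @[n --> \oo] --> 0%E.

(* Elements of L^2 are represented by functions, so the limit is determined
   only almost everywhere; the value is the zero function when s diverges. *)
Definition L2_lim (s : nat -> T -> R[i]) : T -> R[i] :=
  xget (fun=> 0) [set l | L2_cvg s l].

End complex_integration.

Section dynamic_fpca.
Context {R : realType}.
Implicit Types (x y : R -> R[i]) (theta : R).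

Local Notation leb := (@lebesgue_measure R).

Definition unitI : set (measurableTypeR R) := `[0, 1].
Definition freqI : set (measurableTypeR R) := `[- pi, pi].

Definition expi (a : R) : R[i] := cos a +i* sin a.

(* The sum of f l over the integers l with |l| <= N. *)
Definition symsum (f : int -> R[i]) (N : nat) : R[i] :=
  \sum_(k < (2 * N).+1) f (k%:Z - N%:Z).

Definition inH x : Prop := inL2 leb unitI x.
Definition normH2 x : \bar R := sqnorm leb unitI x.
Definition inner x y : R[i] := cintegral leb unitI (fun u => x u * conjc (y u)).

Definition orthonormal (e : nat -> R -> R[i]) : Prop :=
  (forall j, inH (e j)) /\ forall j k, inner (e j) (e k) = (j == k)%:R.

Definition orthonormal_basis (e : nat -> R -> R[i]) : Prop :=
  orthonormal e /\
  forall x, inH x ->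
    L2_cvg leb unitI (fun n u => \sum_(j < n) inner x (e j) * e j u) x.

(* For an orthonormal basis e, the value does not depend on e. *)
Definition HSnorm (e : nat -> R -> R[i]) (A : (R -> R[i]) -> R -> R[i]) :
    \bar R :=
  sqrte (\sum_(0 <= j <oo) normH2 (A (e j)))%E.

Section process.
Context {d : measure_display} {Om : measurableType d} (P : probability Om R).
Implicit Types (X : int -> Om -> R -> R[i]) (Z : Om -> R -> R[i]).

(* A square-integrable random element of H is represented by a jointly
   measurable version (w, u) |-> Z w u. *)
Definition E_normH2 Z : \bar R := (\int[P]_w normH2 (Z w))%E.

Definition L2_random_element Z : Prop :=
  cmeasurable ([set: Om] `*` unitI) (fun z => Z z.1 z.2) /\
  (E_normH2 Z < +oo)%E.

Definition ms_cvgH (s : nat -> Om -> R -> R[i]) Z : Prop :=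
  L2_random_element Z /\
  E_normH2 (fun w u => s n w u - Z w u) @[n --> \oo] --> 0%E.

Definition ms_limH (s : nat -> Om -> R -> R[i]) : Om -> R -> R[i] :=
  xget (fun _ _ => 0) [set Z | ms_cvgH s Z].

Definition expect (Y : Om -> R[i]) : R[i] := cintegral P setT Y.

Definition crosscov X (s t : int) (u v : R) : R[i] :=
  expect (fun w => X s w u * conjc (X t w v)).

(* Means and covariance kernels are elements of L^2 of the unit interval and
   square, so the identities between them hold almost everywhere. *)
Definition weakly_stationary X : Prop :=
  [/\ forall t, L2_random_element (X t),
      forall t, {ae leb, forall u, unitI u -> expect (fun w => X t w u) = 0}
    & forall h t, {ae (leb \x leb)%E, forall z, unitI z.1 -> unitI z.2 ->
        crosscov X (t + h) t z.1 z.2 = crosscov X h 0 z.1 z.2}].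

Definition autocov_op X (h : int) x : R -> R[i] :=
  fun u => cintegral leb unitI (fun v => crosscov X h 0 u v * x v).

Definition spectral_density_op X theta x : R -> R[i] :=
  L2_lim leb unitI (fun N u =>
    ((2 * pi)^-1)%:C *
    symsum (fun h => autocov_op X h x u * expi (- (h%:~R * theta))) N).

(* The indices m start from 0: lam m and phi m theta are the (m + 1)-st
   eigenvalue and eigenfunction at the frequency theta. *)
Definition spectral_representation X
    (lam : nat -> R -> R) (phi : nat -> R -> R -> R[i]) : Prop :=
  forall theta, freqI theta ->
  [/\ forall m, 0 <= lam m theta,
      forall m, lam m.+1 theta <= lam m theta,
      orthonormal (fun m => phi m theta)
    & forall x, inH x ->
        L2_cvg leb unitI
          (fun n u => \sum_(m < n)
             (lam m theta)%:C * inner x (phi m theta) * phi m theta u)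
          (spectral_density_op X theta x)].

Definition jointly_measurable (f : R -> R -> R[i]) : Prop :=
  cmeasurable (unitI `*` freqI) (fun z => f z.2 z.1).

Definition fourier_coef (f : R -> R -> R[i]) (l : int) : R -> R[i] :=
  fun u => if `[< inL2 leb freqI (f ^~ u) >] then
    ((2 * pi)^-1)%:C *
    cintegral leb freqI (fun s => f s u * expi (- (l%:~R * s)))
  else 0.

Definition score X (psi : int -> R -> R[i]) (t : int) : Om -> R[i] :=
  L2_lim P setT (fun N w => symsum (fun l => inner (X (t - l) w) (psi l)) N).

Definition reconstruction X (psi ups : int -> R -> R[i]) (t : int) :
    Om -> R -> R[i] :=
  ms_limH (fun N w u => symsum (fun l => score X psi (t + l) w * ups l u) N).

End process.

Definition fourier_sum (psi : int -> R -> R[i]) (N : nat) theta : R -> R[i] :=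
  fun u => symsum (fun l => psi l u * expi (l%:~R * theta)) N.

Definition classC (psi : int -> R -> R[i]) : Prop :=
  (forall l, inH (psi l)) /\
  exists psistar : R -> R -> R[i],
  [/\ inL2 (leb \x leb)%E (unitI `*` freqI) (fun z => psistar z.2 z.1),
      (fun N => \int[leb]_(theta in freqI)
         normH2 (fun u => (fourier_sum psi N theta u - psistar theta u)%R))%E
        @ \oo --> 0%E
    & (ereal_sup [set normH2 (psistar theta) | theta in freqI] < +oo)%E].

End dynamic_fpca.

(* Main.v *)
Require Import Defs.
From HB Require Import structures.
From mathcomp Require Import all_boot all_order all_algebra.
From mathcomp Require Import all_classical all_reals all_analysis.
From mathcomp Require Import complex measurable_realfun.
From mathcomp Require Import ring lra zify.
Set Implicit Arguments.
Unset Strict Implicit.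
Unset Printing Implicit Defensive.
Import Order.TTheory GRing.Theory Num.Theory.
Import numFieldNormedType.Exports.
Local Open Scope classical_set_scope.
Local Open Scope ring_scope.
Local Open Scope complex_scope.

(** At every frequency the theorem is the statement that the first [p]
    eigenvectors give the best approximation of rank [p]; the work consists in
    moving the problem to the frequency domain and in controlling the limits.

    For finite filters the mean square error is an integral over frequencies.
    Expanding the error in an orthonormal basis of [H] and applying Kolmogorov's
    isometry to each coordinate ([spectral_isometry], [filter_error],
    [two_step_error]) gives
      E |X_t - sum_m sum_l Y_(m,t+l) ups_(m,l)|^2
        = int sum_n lam_n(th) |phi_n(th) - A(th) phi_n(th)|^2 dth,
    where A(th) x = sum_(m < p) <x, Psi_m(th)> Ups_m(th) is built from the
    frequency responses Psi_m and Ups_m of the two filters. The isometry needs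
    only second moments: stationarity makes the covariances depend on the lag,
    the Hilbert-Schmidt bound makes the spectral series converge, and the
    exponentials are orthogonal over a period.

    Lower bound. The operator A(th) has rank at most [p], the phi_n(th) are
    orthonormal and the lam_n(th) are nonincreasing, so that the integrand is at
    least the sum of the lam_n(th) with n >= p ([low_rank_bound]). This holds
    for all truncations and passes to the mean square limits that define the
    scores and the reconstructions ([reconstruction_lower_bound]). These limits
    exist in class C: the partial sums of the inner filter converge by the
    isometry, those of the outer filter because the frequency response of the
    inner one is bounded uniformly in the frequency ([half_step_bound],
    [filter_limit]).

    Equality. The Fourier coefficients of phi_m have frequency response phi_m,
    which by Tonelli is the convergence in mean of the Fourier series of almost
    every section th |-> phi_m(u|th), that is, completeness of the exponentials
    ([fourier_partial_cvg], [fourier_coef_cvg]). Completeness is obtained from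
    multipliers: the functions whose products with functions of vanishing
    Fourier coefficients again have vanishing Fourier coefficients form an
    algebra that contains the exponentials and is closed under bounded pointwise
    limits; through polynomial approximations of the sign it contains the
    indicators of rays, hence those of all Borel sets
    ([multiplier_measurable]). So the dynamic principal components fall under
    the lower bound, while A(th) is close to the projection on the first [p]
    eigenvectors when the truncations are long, which bounds the error from
    above ([near_projection], [dfpc_upper_bound]). *)

(** * Complex numbers, integrals and square integrable functions *)

Arguments cintegral : simpl never.
Arguments sqnorm : simpl never.
Arguments inner : simpl never.

Section complex_algebra.
Context {R : realType}.
Implicit Types (x y z : R[i]) (a b : R).

Lemma ReD x y : complex.Re (x + y) = complex.Re x + complex.Re y.
Proof. by case: x; case: y. Qed.
Lemma ImD x y : complex.Im (x + y) = complex.Im x + complex.Im y.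
Proof. by case: x; case: y. Qed.
Lemma ReN x : complex.Re (- x) = - complex.Re x.
Proof. by case: x. Qed.
Lemma ImN x : complex.Im (- x) = - complex.Im x.
Proof. by case: x. Qed.
Lemma ReMc x y : complex.Re (x * y) =
  complex.Re x * complex.Re y - complex.Im x * complex.Im y.
Proof. by case: x; case: y. Qed.
Lemma ImMc x y : complex.Im (x * y) =
  complex.Re x * complex.Im y + complex.Im x * complex.Re y.
Proof. by case: x; case: y. Qed.
Lemma ReJ x : complex.Re (conjc x) = complex.Re x.
Proof. by case: x. Qed.
Lemma ImJ x : complex.Im (conjc x) = - complex.Im x.
Proof. by case: x. Qed.
Lemma ReC a : complex.Re a%:C = a. Proof. by []. Qed.
Lemma ImC a : complex.Im a%:C = 0. Proof. by []. Qed.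
Lemma Re0 : complex.Re (0 : R[i]) = 0. Proof. by []. Qed.
Lemma Im0 : complex.Im (0 : R[i]) = 0. Proof. by []. Qed.
Lemma Re1 : complex.Re (1 : R[i]) = 1. Proof. by []. Qed.
Lemma Im1 : complex.Im (1 : R[i]) = 0. Proof. by []. Qed.

Definition cE := (ReD, ImD, ReN, ImN, ReMc, ImMc, ReJ, ImJ, ReC, ImC,
  Re0, Im0, Re1, Im1).

Lemma eq_ReIm x y : complex.Re x = complex.Re y ->
  complex.Im x = complex.Im y -> x = y.
Proof. by case: x y => [a b] [c d] /= -> ->. Qed.

Lemma Re_sum I (r : seq I) (P : pred I) (F : I -> R[i]) :
  complex.Re (\sum_(i <- r | P i) F i) = \sum_(i <- r | P i) complex.Re (F i).
Proof. exact: (big_morph (@complex.Re R) ReD Re0). Qed.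

Lemma conjcD x y : conjc (x + y) = conjc x + conjc y.
Proof. by apply: eq_ReIm; rewrite !cE// opprD. Qed.
Lemma conjcN x : conjc (- x) = - conjc x.
Proof. by apply: eq_ReIm; rewrite !cE. Qed.
Lemma conjcM x y : conjc (x * y) = conjc x * conjc y.
Proof. by apply: eq_ReIm; rewrite !cE; ring. Qed.
Lemma conjc0 : conjc (0 : R[i]) = 0.
Proof. by apply: eq_ReIm; rewrite !cE ?oppr0. Qed.
Lemma conjc1 : conjc (1 : R[i]) = 1.
Proof. by apply: eq_ReIm; rewrite !cE ?oppr0. Qed.
Lemma conjc_sum I (r : seq I) (P : pred I) (F : I -> R[i]) :
  conjc (\sum_(i <- r | P i) F i) = \sum_(i <- r | P i) conjc (F i).
Proof. exact: (big_morph (@conjc R) conjcD conjc0). Qed.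

Lemma sqmod_ge0 x : 0 <= sqmod x.
Proof. by rewrite /sqmod addr_ge0 ?sqr_ge0. Qed.
Lemma sqmodM x y : sqmod (x * y) = sqmod x * sqmod y.
Proof. by rewrite /sqmod !cE; ring. Qed.
Lemma sqmodN x : sqmod (- x) = sqmod x.
Proof. by rewrite /sqmod !cE; ring. Qed.
Lemma sqmodJ x : sqmod (conjc x) = sqmod x.
Proof. by rewrite /sqmod !cE; ring. Qed.
Lemma sqmodC a : sqmod (a%:C) = a ^+ 2.
Proof. by rewrite /sqmod !cE; ring. Qed.
Lemma sqmod0 : sqmod (0 : R[i]) = 0.
Proof. by rewrite /sqmod !cE; ring. Qed.
Lemma sqmod1 : sqmod (1 : R[i]) = 1.
Proof. by rewrite /sqmod !cE; ring. Qed.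
Lemma sqmodBC x y : sqmod (x - y) = sqmod (y - x).
Proof. by rewrite -sqmodN opprB. Qed.
Lemma mulc_conjc x : x * conjc x = (sqmod x)%:C.
Proof. by apply: eq_ReIm; rewrite !cE /sqmod /=; ring. Qed.
Lemma sqmod_eq0 x : sqmod x = 0 -> x = 0.
Proof.
rewrite /sqmod => /eqP; rewrite paddr_eq0 ?sqr_ge0// !sqrf_eq0 => /andP[/eqP r /eqP i].
exact: eq_ReIm.
Qed.

(** The weighted form of the square of the triangle inequality: with the
    weight [e] close to zero it lets lower and upper bounds on squared norms
    pass to limits, with no square roots. *)
Lemma sqmodD_le e x y : 0 < e ->
  sqmod (x + y) <= (1 + e) * sqmod x + (1 + e^-1) * sqmod y.
Proof.
move=> e0; rewrite -subr_ge0.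
have -> : (1 + e) * sqmod x + (1 + e^-1) * sqmod y - sqmod (x + y) =
   e * sqmod (x - (e^-1)%:C * y).
  rewrite /sqmod !cE; field; exact: lt0r_neq0.
by rewrite mulr_ge0 ?sqmod_ge0 1?ltW.
Qed.

Lemma Re_le_sqmod x y : `|complex.Re (x * conjc y)| <= sqmod x + sqmod y.
Proof.
rewrite ler_norml /sqmod !cE; set a := complex.Re x; set b := complex.Im x.
set c := complex.Re y; set d := complex.Im y.
have := sqr_ge0 (a - c); have := sqr_ge0 (b - d).
have := sqr_ge0 (a + c); have := sqr_ge0 (b + d).
by nra.
Qed.
Lemma Im_le_sqmod x y : `|complex.Im (x * conjc y)| <= sqmod x + sqmod y.
Proof.
rewrite ler_norml /sqmod !cE; set a := complex.Re x; set b := complex.Im x.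
set c := complex.Re y; set d := complex.Im y.
have := sqr_ge0 (a - d); have := sqr_ge0 (b - c).
have := sqr_ge0 (a + d); have := sqr_ge0 (b + c).
by nra.
Qed.

Lemma Re_sqr_le x : (complex.Re x) ^+ 2 <= sqmod x.
Proof. by rewrite /sqmod lerDl sqr_ge0. Qed.
Lemma Im_sqr_le x : (complex.Im x) ^+ 2 <= sqmod x.
Proof. by rewrite /sqmod lerDr sqr_ge0. Qed.

End complex_algebra.

Section complex_integral.
Context {R : realType} {d : measure_display} {T : measurableType d}.
Variables (mu : {measure set T -> \bar R}) (D : set T).
Hypothesis mD : measurable D.
Implicit Types f g h : T -> R[i].

Lemma cmeasurable_cst (c : R[i]) : cmeasurable D (fun=> c).
Proof. by split; exact: measurable_cst. Qed.
Lemma cmeasurableD f g : cmeasurable D f -> cmeasurable D g ->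
  cmeasurable D (fun x => f x + g x).
Proof.
move=> [f1 f2] [g1 g2]; split.
  under eq_fun do rewrite ReD; exact: measurable_funD.
under eq_fun do rewrite ImD; exact: measurable_funD.
Qed.
Lemma cmeasurableM f g : cmeasurable D f -> cmeasurable D g ->
  cmeasurable D (fun x => f x * g x).
Proof.
move=> [f1 f2] [g1 g2]; split.
  under eq_fun do rewrite ReMc; apply: measurable_funB; exact: measurable_funM.
under eq_fun do rewrite ImMc; apply: measurable_funD; exact: measurable_funM.
Qed.
Lemma cmeasurableN f : cmeasurable D f -> cmeasurable D (fun x => - f x).
Proof.
move=> mf; under eq_fun do rewrite -mulN1r.
by apply: cmeasurableM => //; exact: cmeasurable_cst.
Qed.
Lemma cmeasurableB f g : cmeasurable D f -> cmeasurable D g ->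
  cmeasurable D (fun x => f x - g x).
Proof. by move=> mf mg; apply: cmeasurableD => //; exact: cmeasurableN. Qed.
Lemma cmeasurableJ f : cmeasurable D f -> cmeasurable D (fun x => conjc (f x)).
Proof.
move=> [f1 f2]; split; first by under eq_fun do rewrite ReJ.
under eq_fun do rewrite ImJ -mulN1r; exact: measurable_funM.
Qed.
Lemma cmeasurableZ c f : cmeasurable D f -> cmeasurable D (fun x => c * f x).
Proof. by move=> mf; apply: cmeasurableM => //; exact: cmeasurable_cst. Qed.
Lemma cmeasurable_sum I (r : seq I) (F : I -> T -> R[i]) :
  (forall i, cmeasurable D (F i)) ->
  cmeasurable D (fun x => \sum_(i <- r) F i x).
Proof.
move=> mF; elim: r => [|i r IH].
  by under eq_fun do rewrite big_nil; exact: cmeasurable_cst.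
by under eq_fun do rewrite big_cons; exact: cmeasurableD.
Qed.
Lemma cmeasurableC (f : T -> R) : measurable_fun D f ->
  cmeasurable D (fun x => (f x)%:C).
Proof. by move=> mf; split => //=; exact: measurable_cst. Qed.

Lemma measurable_sqmod f : cmeasurable D f ->
  measurable_fun D (fun x => sqmod (f x)).
Proof.
by move=> [f1 f2]; apply: measurable_funD; apply: measurable_funX.
Qed.
Lemma measurable_sqmodE f : cmeasurable D f ->
  measurable_fun D (fun x => (sqmod (f x))%:E).
Proof. by move=> mf; apply/measurable_EFinP; exact: measurable_sqmod. Qed.

Lemma eq_integrable_in (f g : T -> \bar R) : (forall x, D x -> f x = g x) ->
  mu.-integrable D f -> mu.-integrable D g.
Proof. by move=> fg; apply: eq_integrable => // x; rewrite inE => /fg. Qed.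

Definition cintegrable f : Prop :=
  mu.-integrable D (EFin \o (fun x => complex.Re (f x))) /\
  mu.-integrable D (EFin \o (fun x => complex.Im (f x))).

Lemma cintegrable_measurable f : cintegrable f -> cmeasurable D f.
Proof.
by move=> [/integrableP[/measurable_EFinP ? _] /integrableP[/measurable_EFinP ? _]].
Qed.

Lemma cintegrable_le f (g : T -> R) : cmeasurable D f ->
  mu.-integrable D (EFin \o g) ->
  (forall x, D x -> `|complex.Re (f x)| <= g x) ->
  (forall x, D x -> `|complex.Im (f x)| <= g x) -> cintegrable f.
Proof.
move=> [f1 f2] ig fg1 fg2; split; (apply: (le_integrable mD _ _ ig);
  [exact/measurable_EFinP| move=> x Dx; rewrite /= lee_fin]).
- by apply: le_trans (fg1 _ Dx) _; exact: ler_norm.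
- by apply: le_trans (fg2 _ Dx) _; exact: ler_norm.
Qed.

Lemma cintegrableD f g : cintegrable f -> cintegrable g ->
  cintegrable (fun x => f x + g x).
Proof.
move=> [f1 f2] [g1 g2]; split.
  apply: eq_integrable_in (integrableD mD f1 g1) => // x _ /=.
  by rewrite ReD EFinD.
apply: eq_integrable_in (integrableD mD f2 g2) => // x _ /=.
by rewrite ImD EFinD.
Qed.
Lemma cintegrableZ c f : cintegrable f -> cintegrable (fun x => c * f x).
Proof.
move=> [f1 f2]; split.
  apply: eq_integrable_in (integrableB mD (integrableZl mD (complex.Re c) f1)
    (integrableZl mD (complex.Im c) f2)) => // x _ /=.
  by rewrite ReMc EFinB !EFinM.
apply: eq_integrable_in (integrableD mD (integrableZl mD (complex.Re c) f2)
    (integrableZl mD (complex.Im c) f1)) => // x _ /=.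
by rewrite ImMc EFinD !EFinM.
Qed.
Lemma cintegrableJ f : cintegrable f -> cintegrable (fun x => conjc (f x)).
Proof.
move=> [f1 f2]; split; first by under eq_fun do rewrite ReJ.
apply: eq_integrable_in (integrableN f2) => // x _ /=.
by rewrite ImJ EFinN.
Qed.
Lemma cintegrable0 : cintegrable (fun=> 0).
Proof. by split; exact: integrable0. Qed.
Lemma cintegrable_sum I (r : seq I) (F : I -> T -> R[i]) :
  (forall i, cintegrable (F i)) -> cintegrable (fun x => \sum_(i <- r) F i x).
Proof.
move=> mF; elim: r => [|i r IH].
  by under eq_fun do rewrite big_nil; exact: cintegrable0.
by under eq_fun do rewrite big_cons; exact: cintegrableD.
Qed.

Lemma Re_cintegral f :
  complex.Re (cintegral mu D f) = \int[mu]_(x in D) complex.Re (f x).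
Proof. by []. Qed.
Lemma Im_cintegral f :
  complex.Im (cintegral mu D f) = \int[mu]_(x in D) complex.Im (f x).
Proof. by []. Qed.

Lemma eq_cintegral f g : (forall x, D x -> f x = g x) ->
  cintegral mu D f = cintegral mu D g.
Proof.
move=> fg; rewrite /cintegral; congr (_ +i* _); apply: eq_Rintegral => x;
by rewrite inE => Dx; rewrite fg.
Qed.
Lemma cintegralD f g : cintegrable f -> cintegrable g ->
  cintegral mu D (fun x => f x + g x) = cintegral mu D f + cintegral mu D g.
Proof.
move=> [f1 f2] [g1 g2]; apply: eq_ReIm; rewrite ?(ReD, ImD, ReMc, ImMc, ReJ, ImJ) ?(Re_cintegral, Im_cintegral).
  by under eq_fun do rewrite ReD; exact: RintegralD.
by under eq_fun do rewrite ImD; exact: RintegralD.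
Qed.
Lemma cintegralZ c f : cintegrable f ->
  cintegral mu D (fun x => c * f x) = c * cintegral mu D f.
Proof.
move=> [f1 f2].
have Z (k : R) (h : T -> R) : mu.-integrable D (EFin \o h) ->
    mu.-integrable D (EFin \o (fun x => k * h x)).
  move=> ih; exact: eq_integrable_in (integrableZl mD k ih).
apply: eq_ReIm; rewrite ?(ReD, ImD, ReMc, ImMc, ReJ, ImJ) ?(Re_cintegral, Im_cintegral).
  under eq_fun do rewrite ReMc.
  by rewrite RintegralB// ?RintegralZl//; exact: Z.
under eq_fun do rewrite ImMc.
by rewrite RintegralD// ?RintegralZl//; exact: Z.
Qed.
Lemma cintegralJ f : cintegrable f ->
  cintegral mu D (fun x => conjc (f x)) = conjc (cintegral mu D f).
Proof.
move=> [f1 f2]; apply: eq_ReIm; rewrite ?(ReD, ImD, ReMc, ImMc, ReJ, ImJ) ?(Re_cintegral, Im_cintegral).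
  by under eq_fun do rewrite ReJ.
under eq_fun do rewrite ImJ -mulN1r.
by rewrite RintegralZl// mulN1r.
Qed.
Lemma cintegral0 : cintegral mu D (fun=> 0) = 0.
Proof.
rewrite -[RHS](mul0r (cintegral mu D (fun=> 0))) -cintegralZ; last exact: cintegrable0.
by apply: eq_cintegral => x _; rewrite mul0r.
Qed.
Lemma cintegral_sum I (r : seq I) (F : I -> T -> R[i]) :
  (forall i, cintegrable (F i)) ->
  cintegral mu D (fun x => \sum_(i <- r) F i x) =
  \sum_(i <- r) cintegral mu D (F i).
Proof.
move=> iF; elim: r => [|i r IH].
  by rewrite big_nil; under eq_fun do rewrite big_nil; exact: cintegral0.
rewrite big_cons -IH -cintegralD//; last exact: cintegrable_sum.
by apply: eq_cintegral => x _; rewrite big_cons.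
Qed.

Lemma ae_eq_cintegral f g : cmeasurable D f -> cmeasurable D g ->
  {ae mu, forall x, D x -> f x = g x} -> cintegral mu D f = cintegral mu D g.
Proof.
move=> [f1 f2] [g1 g2] fg; apply: eq_ReIm; rewrite ?(Re_cintegral, Im_cintegral) /Rintegral; congr fine;
  apply: ae_eq_integral => //; do ?exact/measurable_EFinP;
  by apply: filterS fg => x /= + Dx => ->.
Qed.

End complex_integral.

Section square_integrable.
Context {R : realType} {d : measure_display} {T : measurableType d}.
Variables (mu : {measure set T -> \bar R}) (D : set T).
Hypothesis mD : measurable D.
Implicit Types f g h : T -> R[i].

Local Notation inL2 := (inL2 mu D).
Local Notation sqnorm := (sqnorm mu D).
Local Notation cintegrable := (cintegrable mu D).

Lemma sqnorm_ge0 f : (0 <= sqnorm f)%E.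
Proof. by apply: integral_ge0 => x _; rewrite lee_fin sqmod_ge0. Qed.

Lemma eq_sqnorm f g : (forall x, D x -> f x = g x) -> sqnorm f = sqnorm g.
Proof. by move=> fg; apply: eq_integral => x; rewrite inE => /fg ->. Qed.

Lemma ae_eq_sqnorm f g : cmeasurable D f -> cmeasurable D g ->
  {ae mu, forall x, D x -> f x = g x} -> sqnorm f = sqnorm g.
Proof.
move=> mf mg fg; apply: ae_eq_integral => //; do ?exact: measurable_sqmodE.
by apply: filterS fg => x /= + Dx => ->.
Qed.

Lemma sqnormZ c f : cmeasurable D f ->
  sqnorm (fun x => c * f x) = ((sqmod c)%:E * sqnorm f)%E.
Proof.
move=> mf; rewrite -ge0_integralZl//; last by rewrite lee_fin sqmod_ge0.
- by apply: eq_integral => x _; rewrite sqmodM EFinM.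
- exact: measurable_sqmodE.
- by move=> x _; rewrite lee_fin sqmod_ge0.
Qed.

Lemma sqnormN f : sqnorm (fun x => - f x) = sqnorm f.
Proof. by apply: eq_integral => x _; rewrite sqmodN. Qed.

Lemma sqnormBC f g : sqnorm (fun x => f x - g x) = sqnorm (fun x => g x - f x).
Proof. by apply: eq_integral => x _; rewrite sqmodBC. Qed.

Lemma sqnorm0 : sqnorm (fun=> 0) = 0%E.
Proof. by apply: integral0_eq => x _; rewrite sqmod0. Qed.

Lemma sqnormD_le e f g : 0 < e -> cmeasurable D f -> cmeasurable D g ->
  (sqnorm (fun x => f x + g x)%R <=
   (1 + e)%:E * sqnorm f + (1 + e^-1)%:E * sqnorm g)%E.
Proof.
move=> e0 mf mg.
have e1 : 0 <= 1 + e by rewrite addr_ge0// ltW.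
have e2 : 0 <= 1 + e^-1 by rewrite addr_ge0// invr_ge0 ltW.
have mf' := measurable_sqmodE mf; have mg' := measurable_sqmodE mg.
rewrite -!ge0_integralZl//; do ?by move=> x _; rewrite lee_fin sqmod_ge0.
have M1 := measurable_funeM (1 + e)%:E mf'.
have M2 := measurable_funeM (1 + e^-1)%:E mg'.
have N1 x : (0 <= (1 + e)%:E * (sqmod (f x))%:E)%E.
  by rewrite mule_ge0// lee_fin sqmod_ge0.
have N2 x : (0 <= (1 + e^-1)%:E * (sqmod (g x))%:E)%E.
  by rewrite mule_ge0// lee_fin sqmod_ge0.
rewrite -ge0_integralD//; apply: ge0_le_integral => //.
- by move=> x _; rewrite lee_fin sqmod_ge0.
- by apply: measurable_sqmodE; exact: cmeasurableD.
- exact: emeasurable_funD.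
- by move=> x _; rewrite -!EFinM -EFinD lee_fin sqmodD_le.
Qed.

Lemma sqnormD_le2 f g : cmeasurable D f -> cmeasurable D g ->
  (sqnorm (fun x => f x + g x)%R <= 2%:E * sqnorm f + 2%:E * sqnorm g)%E.
Proof.
by move=> mf mg; have := sqnormD_le ltr01 mf mg; rewrite invr1.
Qed.

Lemma inL2_meas f : inL2 f -> cmeasurable D f. Proof. by case. Qed.

Lemma inL2D f g : inL2 f -> inL2 g -> inL2 (fun x => f x + g x).
Proof.
move=> [mf nf] [mg ng]; split; first exact: cmeasurableD.
apply: le_lt_trans (sqnormD_le2 mf mg) _.
by rewrite lte_add_pinfty// lte_mul_pinfty.
Qed.
Lemma inL2Z c f : inL2 f -> inL2 (fun x => c * f x).
Proof.
move=> [mf nf]; split; first exact: cmeasurableZ.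
by rewrite sqnormZ// lte_mul_pinfty// lee_fin sqmod_ge0.
Qed.
Lemma inL2N f : inL2 f -> inL2 (fun x => - f x).
Proof. by move=> [mf nf]; split; [exact: cmeasurableN|rewrite sqnormN]. Qed.
Lemma inL2B f g : inL2 f -> inL2 g -> inL2 (fun x => f x - g x).
Proof. by move=> Hf Hg; apply: inL2D => //; exact: inL2N. Qed.
Lemma inL2_0 : inL2 (fun=> 0).
Proof. by split; [exact: cmeasurable_cst|rewrite sqnorm0]. Qed.
Lemma inL2_sum I (r : seq I) (F : I -> T -> R[i]) :
  (forall i, inL2 (F i)) -> inL2 (fun x => \sum_(i <- r) F i x).
Proof.
move=> mF; elim: r => [|i r IH].
  by under eq_fun do rewrite big_nil; exact: inL2_0.
by under eq_fun do rewrite big_cons; exact: inL2D.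
Qed.

Lemma inL2_integrable f : inL2 f ->
  mu.-integrable D (EFin \o (fun x => sqmod (f x))).
Proof.
move=> [mf nf]; apply/integrableP; split; first exact: measurable_sqmodE.
apply: le_lt_trans nf; rewrite le_eqVlt; apply/orP; left; apply/eqP.
by apply: eq_integral => x _; rewrite /= ger0_norm ?sqmod_ge0.
Qed.

Lemma inL2_cintegrable f g : inL2 f -> inL2 g ->
  cintegrable (fun x => f x * conjc (g x)).
Proof.
move=> Hf Hg.
apply: (@cintegrable_le _ _ _ _ _ mD _ (fun x => sqmod (f x) + sqmod (g x))).
- by apply: cmeasurableM; [exact: inL2_meas|apply: cmeasurableJ; exact: inL2_meas].
- apply: eq_integrable_in (integrableD mD (inL2_integrable Hf) (inL2_integrable Hg)) => //.
- by move=> x _; exact: Re_le_sqmod.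
- by move=> x _; exact: Im_le_sqmod.
Qed.

(** The inner product of which [inner] is the instance on the unit interval. *)
Definition ip f g : R[i] := cintegral mu D (fun x => f x * conjc (g x)).
Definition nrm2 f : R := fine (sqnorm f).

Lemma nrm2_ge0 f : 0 <= nrm2 f.
Proof. by rewrite fine_ge0// sqnorm_ge0. Qed.
Lemma nrm2E f : inL2 f -> (nrm2 f)%:E = sqnorm f.
Proof.
by move=> [_ nf]; rewrite /nrm2 fineK// ge0_fin_numE// sqnorm_ge0.
Qed.

Lemma ipC f g : inL2 f -> inL2 g -> ip g f = conjc (ip f g).
Proof.
move=> Hf Hg; rewrite /ip -cintegralJ//; last exact: inL2_cintegrable.
by apply: eq_cintegral => x _; rewrite conjcM conjcK mulrC.
Qed.
Lemma ipDl f g h : inL2 f -> inL2 g -> inL2 h ->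
  ip (fun x => f x + g x) h = ip f h + ip g h.
Proof.
move=> Hf Hg Hh; rewrite /ip -cintegralD//; [|exact: inL2_cintegrable..].
by apply: eq_cintegral => x _; rewrite mulrDl.
Qed.
Lemma ipZl c f h : inL2 f -> inL2 h -> ip (fun x => c * f x) h = c * ip f h.
Proof.
move=> Hf Hh; rewrite /ip -cintegralZ//; last exact: inL2_cintegrable.
by apply: eq_cintegral => x _; rewrite mulrA.
Qed.
Lemma ipDr f g h : inL2 f -> inL2 g -> inL2 h ->
  ip h (fun x => f x + g x) = ip h f + ip h g.
Proof.
move=> Hf Hg Hh; rewrite [LHS]ipC//; last exact: inL2D.
by rewrite ipDl// conjcD -!ipC.
Qed.
Lemma ipZr c f h : inL2 f -> inL2 h ->
  ip h (fun x => c * f x) = conjc c * ip h f.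
Proof.
move=> Hf Hh; rewrite [LHS]ipC//; last exact: inL2Z.
by rewrite ipZl// conjcM -ipC.
Qed.
Lemma ipNl f h : inL2 f -> inL2 h -> ip (fun x => - f x) h = - ip f h.
Proof.
move=> Hf Hh; rewrite -[RHS]mulN1r -ipZl//.
by congr ip; apply/funext => x; rewrite mulN1r.
Qed.
Lemma ipBl f g h : inL2 f -> inL2 g -> inL2 h ->
  ip (fun x => f x - g x) h = ip f h - ip g h.
Proof. by move=> Hf Hg Hh; rewrite ipDl ?ipNl//; exact: inL2N. Qed.
Lemma ipBr f g h : inL2 f -> inL2 g -> inL2 h ->
  ip h (fun x => f x - g x) = ip h f - ip h g.
Proof.
move=> Hf Hg Hh; rewrite [LHS]ipC//; last exact: inL2B.
by rewrite ipBl// conjcD conjcN -!ipC.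
Qed.
Lemma ip_suml I (r : seq I) (F : I -> T -> R[i]) h :
  (forall i, inL2 (F i)) -> inL2 h ->
  ip (fun x => \sum_(i <- r) F i x) h = \sum_(i <- r) ip (F i) h.
Proof.
move=> HF Hh; rewrite /ip -cintegral_sum//; last first.
  by move=> i; exact: inL2_cintegrable.
by apply: eq_cintegral => x _; rewrite mulr_suml.
Qed.
Lemma ip_sumr I (r : seq I) (F : I -> T -> R[i]) h :
  (forall i, inL2 (F i)) -> inL2 h ->
  ip h (fun x => \sum_(i <- r) F i x) = \sum_(i <- r) ip h (F i).
Proof.
move=> HF Hh; rewrite ipC//; last exact: inL2_sum.
by rewrite ip_suml// conjc_sum; apply: eq_bigr => i _; rewrite -ipC.
Qed.
Lemma eq_ip f g f' g' : (forall x, D x -> f x = f' x) ->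
  (forall x, D x -> g x = g' x) -> ip f g = ip f' g'.
Proof. by move=> ff gg; apply: eq_cintegral => x Dx; rewrite ff// gg. Qed.
Lemma ae_eq_ip f g f' g' : inL2 f -> inL2 g -> inL2 f' -> inL2 g' ->
  {ae mu, forall x, D x -> f x = f' x} ->
  {ae mu, forall x, D x -> g x = g' x} -> ip f g = ip f' g'.
Proof.
move=> Hf Hg Hf' Hg' ff gg; apply: ae_eq_cintegral => //.
- exact: cintegrable_measurable (inL2_cintegrable _ _).
- exact: cintegrable_measurable (inL2_cintegrable _ _).
- by apply: filterS2 ff gg => x fx gx Dx; rewrite fx// gx.
Qed.

Lemma ipxx f : inL2 f -> ip f f = (nrm2 f)%:C.
Proof.
move=> Hf; apply: eq_ReIm; rewrite /ip /cintegral /=.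
  rewrite /nrm2 /sqnorm /Rintegral; congr fine; apply: eq_integral => x _.
  by rewrite mulc_conjc.
rewrite (_ : (fun x => _) = (fun=> 0)); first by rewrite /Rintegral integral0_eq.
by apply/funext => x; rewrite mulc_conjc.
Qed.

Lemma nrm2D f g : inL2 f -> inL2 g ->
  nrm2 (fun x => f x + g x) = nrm2 f + nrm2 g + 2 * complex.Re (ip f g).
Proof.
move=> Hf Hg; have Hfg := inL2D Hf Hg.
have E h : inL2 h -> nrm2 h = complex.Re (ip h h) by move=> /ipxx ->.
rewrite !E// ipDl// !ipDr// (@ipC f g)// !(ReD, ReJ); ring.
Qed.
Lemma nrm2Z c f : inL2 f -> nrm2 (fun x => c * f x) = sqmod c * nrm2 f.
Proof.
move=> Hf; apply: EFin_inj; rewrite EFinM !nrm2E//; last exact: inL2Z.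
by rewrite sqnormZ//; exact: inL2_meas.
Qed.
Lemma nrm2N f : nrm2 (fun x => - f x) = nrm2 f.
Proof. by rewrite /nrm2 sqnormN. Qed.
Lemma nrm2BC f g : nrm2 (fun x => f x - g x) = nrm2 (fun x => g x - f x).
Proof. by rewrite /nrm2 sqnormBC. Qed.
Lemma nrm2_0 : nrm2 (fun=> 0) = 0.
Proof. by rewrite /nrm2 sqnorm0. Qed.
Lemma nrm2B f g : inL2 f -> inL2 g ->
  nrm2 (fun x => f x - g x) = nrm2 f + nrm2 g - 2 * complex.Re (ip f g).
Proof.
move=> Hf Hg; rewrite nrm2D//; last exact: inL2N.
rewrite nrm2N (_ : ip _ _ = - ip f g) ?cE ?mulrN//.
rewrite [LHS]ipC//; last exact: inL2N.
by rewrite ipNl// conjcN -ipC.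
Qed.

Lemma nrm2D_le e f g : 0 < e -> inL2 f -> inL2 g ->
  nrm2 (fun x => f x + g x) <= (1 + e) * nrm2 f + (1 + e^-1) * nrm2 g.
Proof.
move=> e0 Hf Hg; rewrite -lee_fin EFinD !EFinM !nrm2E//; last exact: inL2D.
by apply: sqnormD_le => //; exact: inL2_meas.
Qed.
Lemma nrm2D_le2 f g : inL2 f -> inL2 g ->
  nrm2 (fun x => f x + g x) <= 2 * nrm2 f + 2 * nrm2 g.
Proof. by move=> Hf Hg; have := nrm2D_le ltr01 Hf Hg; rewrite invr1. Qed.
Lemma nrm2_sum_le I (r : seq I) (F : I -> T -> R[i]) :
  (forall i, inL2 (F i)) ->
  nrm2 (fun x => \sum_(i <- r) F i x) <= (size r)%:R * \sum_(i <- r) nrm2 (F i).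
Proof.
move=> HF; elim: r => [|i r IH].
  by under eq_fun do rewrite big_nil; rewrite nrm2_0 big_nil mulr0.
under eq_fun do rewrite big_cons; rewrite big_cons /=.
have Hr := inL2_sum r HF.
case: (posnP (size r)) => [/size0nil ->|r0].
  rewrite !big_nil /= !addr0 mul1r.
  by under eq_fun do rewrite big_nil addr0.
have r0' : (0 : R) < (size r)%:R by rewrite ltr0n.
apply: le_trans (nrm2D_le r0' (HF i) Hr) _.
have := @ler_wpM2l R (1 + (size r)%:R^-1) _ _ _ IH.
rewrite addr_ge0 ?invr_ge0 ?ler0n// => /(_ isT) H.
apply: le_trans (lerD (lexx _) H) _.
rewrite -natr1 le_eqVlt; apply/orP; left; apply/eqP.
by field; rewrite lt0r_neq0.
Qed.

Lemma cauchy_schwarz f g : inL2 f -> inL2 g ->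
  sqmod (ip f g) <= nrm2 f * nrm2 g.
Proof.
move=> Hf Hg; set c := ip f g.
have key (a : R) : 0 <= nrm2 f - 2 * a * sqmod c + a ^+ 2 * sqmod c * nrm2 g.
  have := nrm2_ge0 (fun x => f x - (a%:C * c) * g x).
  rewrite nrm2B//; last exact: inL2Z.
  rewrite nrm2Z// ipZr// -/c sqmodM sqmodC.
  suff -> : complex.Re (conjc (a%:C * c) * c) = a * sqmod c.
    by rewrite mulrA => /le_trans; apply; lra.
  by rewrite /sqmod !cE; ring.
have c0 := sqmod_ge0 c; have g0 := nrm2_ge0 g; have f0 := nrm2_ge0 f.
have [gz|gp] := eqVneq (nrm2 g) 0.
  rewrite gz mulr0; rewrite leNgt; apply/negP => cp.
  have := key (nrm2 f / sqmod c); rewrite gz mulr0 addr0.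
  have -> : nrm2 f - 2 * (nrm2 f / sqmod c) * sqmod c = - nrm2 f.
    by field; rewrite gt_eqF.
  move=> f0'; have fz : nrm2 f = 0 by lra.
  by have := key 1; rewrite fz gz mulr0; lra.
have gpos : 0 < nrm2 g by rewrite lt_neqAle eq_sym gp.
have := key (nrm2 g)^-1.
have -> : nrm2 f - 2 * (nrm2 g)^-1 * sqmod c + (nrm2 g)^-1 ^+ 2 * sqmod c * nrm2 g
  = nrm2 f - sqmod c / nrm2 g by field.
by rewrite subr_ge0 ler_pdivrMr.
Qed.

Lemma sqmod_ipB_le f g h : inL2 f -> inL2 g -> inL2 h ->
  sqmod (ip f h - ip g h) <= nrm2 (fun x => f x - g x) * nrm2 h.
Proof.
move=> Hf Hg Hh; rewrite -ipBl//; apply: cauchy_schwarz => //; exact: inL2B.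
Qed.

Lemma ip_nrm2_0 f g : inL2 f -> inL2 g -> nrm2 f = 0 -> ip f g = 0.
Proof.
move=> Hf Hg f0; apply: sqmod_eq0; apply/eqP; rewrite eq_le sqmod_ge0 andbT.
by apply: le_trans (cauchy_schwarz Hf Hg) _; rewrite f0 mul0r.
Qed.

End square_integrable.

Lemma innerE {R : realType} (x y : R -> R[i]) :
  inner x y = ip lebesgue_measure unitI x y.
Proof. by []. Qed.

Lemma ipE {R : realType} {d : measure_display} {T : measurableType d}
    (mu : {measure set T -> \bar R}) (D : set T) (f g : T -> R[i]) :
  ip mu D f g = cintegral mu D (fun x => f x * conjc (g x)).
Proof. by []. Qed.

(* Unification would otherwise unfold inner products down to integrals. *)
#[global] Opaque ip nrm2.

(** * Mean square convergence and completeness *)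

Section real_limits.
Context {R : realType}.
Implicit Types (u v : nat -> R).

Lemma cvg0_squeeze u v : (forall n, `|u n| <= v n) -> v n @[n --> \oo] --> (0 : R) ->
  u n @[n --> \oo] --> (0 : R).
Proof.
move=> uv v0; apply: norm_cvg0; apply: (@squeeze_cvgr _ _ _ _ (fun=> 0) v).
- by apply: nearW => n; rewrite normr_ge0 uv.
- exact: cvg_cst.
- exact: v0.
Qed.

Lemma cvg0_sqr_le u v : (forall n, u n ^+ 2 <= v n) ->
  v n @[n --> \oo] --> (0 : R) -> u n @[n --> \oo] --> (0 : R).
Proof.
move=> uv v0; apply/cvgr0Pnorm_lt => e e0.
have /cvgr0Pnorm_lt /(_ _ (exprn_gt0 2 e0)) := v0.
apply: filterS => n /(le_lt_trans (ler_norm _)) /(le_lt_trans (uv n)) H.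
by rewrite -(@ltr_pXn2r _ 2) ?nnegrE// ?ltW// real_normK// num_real.
Qed.

End real_limits.

Definition ccvg {R : realType} (u : nat -> R[i]) (l : R[i]) : Prop :=
  complex.Re (u n) @[n --> \oo] --> complex.Re l /\
  complex.Im (u n) @[n --> \oo] --> complex.Im l.

Section complex_limits.
Context {R : realType}.
Implicit Types (u v : nat -> R[i]) (k l : R[i]).

Lemma ccvg_sqmod u l : ccvg u l <-> sqmod (u n - l) @[n --> \oo] --> (0 : R).
Proof.
split=> [[ur ui]|ul].
  rewrite (_ : 0 = (complex.Re l - complex.Re l) ^+ 2 + (complex.Im l - complex.Im l) ^+ 2);
    last by rewrite !subrr expr0n addr0.
  rewrite (_ : (fun n => _) = (fun n => (complex.Re (u n) - complex.Re l) ^+ 2 +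
     (complex.Im (u n) - complex.Im l) ^+ 2)); last first.
    by apply/funext => n; rewrite /sqmod !cE.
  by apply: cvgD; apply: cvgM; apply: cvgB => //; exact: cvg_cst.
split; apply/subr_cvg0.
- apply: cvg0_sqr_le ul => n /=.
  by have := Re_sqr_le (u n - l); rewrite !cE.
- apply: cvg0_sqr_le ul => n /=.
  by have := Im_sqr_le (u n - l); rewrite !cE.
Qed.

Lemma ccvg_le u l (v : nat -> R) : (forall n, sqmod (u n - l) <= v n) ->
  v n @[n --> \oo] --> (0 : R) -> ccvg u l.
Proof.
move=> ul v0; apply/ccvg_sqmod; apply: cvg0_squeeze v0 => n.
by rewrite ger0_norm ?sqmod_ge0.
Qed.

Lemma ccvg_cst l : ccvg (fun=> l) l.
Proof. by split; exact: cvg_cst. Qed.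
Lemma ccvgD u v k l : ccvg u k -> ccvg v l -> ccvg (fun n => u n + v n) (k + l).
Proof.
move=> [ur ui] [vr vi]; split.
  by under eq_fun do rewrite ReD; rewrite ReD; exact: cvgD.
by under eq_fun do rewrite ImD; rewrite ImD; exact: cvgD.
Qed.
Lemma ccvgM u v k l : ccvg u k -> ccvg v l -> ccvg (fun n => u n * v n) (k * l).
Proof.
move=> [ur ui] [vr vi]; split.
  rewrite [complex.Re (k * l)]ReMc; under eq_fun do rewrite ReMc.
  by apply: cvgB; apply: cvgM.
rewrite [complex.Im (k * l)]ImMc; under eq_fun do rewrite ImMc.
by apply: cvgD; apply: cvgM.
Qed.
Lemma ccvgZ c u k : ccvg u k -> ccvg (fun n => c * u n) (c * k).
Proof. by apply: ccvgM; exact: ccvg_cst. Qed.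
Lemma ccvgN u k : ccvg u k -> ccvg (fun n => - u n) (- k).
Proof.
move=> /(ccvgZ (-1)); rewrite mulN1r; congr ccvg.
by apply/funext => n; rewrite mulN1r.
Qed.
Lemma ccvgB u v k l : ccvg u k -> ccvg v l -> ccvg (fun n => u n - v n) (k - l).
Proof. by move=> uk vl; apply: ccvgD => //; exact: ccvgN. Qed.
Lemma ccvg_sum I (r : seq I) (F : I -> nat -> R[i]) (L : I -> R[i]) :
  (forall i, ccvg (F i) (L i)) ->
  ccvg (fun n => \sum_(i <- r) F i n) (\sum_(i <- r) L i).
Proof.
move=> FL; elim: r => [|i r IH].
  by under eq_fun do rewrite big_nil; rewrite big_nil; exact: ccvg_cst.
by under eq_fun do rewrite big_cons; rewrite big_cons; exact: ccvgD.
Qed.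
Lemma ccvg_unique u k l : ccvg u k -> ccvg u l -> k = l.
Proof.
move=> [ur ui] [vr vi]; apply: eq_ReIm.
  exact: (@cvg_unique _ (@Rhausdorff R) _ _ _ _ ur vr).
exact: (@cvg_unique _ (@Rhausdorff R) _ _ _ _ ui vi).
Qed.
Lemma sqmod_ccvg u k : ccvg u k -> sqmod (u n) @[n --> \oo] --> sqmod k.
Proof.
by move=> [ur ui]; rewrite /sqmod; apply: cvgD; apply: cvgM.
Qed.

End complex_limits.

Lemma cmeasurable_ccvg {R : realType} {d : measure_display} {T : measurableType d}
    (D : set T) (F : nat -> T -> R[i]) (f : T -> R[i]) :
  (forall n, cmeasurable D (F n)) -> (forall x, D x -> ccvg (fun n => F n x) (f x)) ->
  cmeasurable D f.
Proof.
move=> mF Ff; split.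
- by apply: (measurable_fun_cvg (fun n => (mF n).1)) => x /Ff[].
- by apply: (measurable_fun_cvg (fun n => (mF n).2)) => x /Ff[].
Qed.

Section mean_square.
Context {R : realType} {d : measure_display} {T : measurableType d}.
Variables (mu : {measure set T -> \bar R}) (D : set T).
Hypothesis mD : measurable D.
Implicit Types (f g h l : T -> R[i]) (s : nat -> T -> R[i]).

Local Notation inL2 := (inL2 mu D).
Local Notation sqnorm := (sqnorm mu D).
Local Notation nrm2 := (nrm2 mu D).
Local Notation ip := (ip mu D).
Local Notation L2_cvg := (L2_cvg mu D).

Lemma L2_cvgP s l : (forall n, inL2 (s n)) -> inL2 l ->
  L2_cvg s l <-> nrm2 (fun x => s n x - l x) @[n --> \oo] --> (0 : R).
Proof.
move=> Hs Hl; have E n : sqnorm (fun x => s n x - l x) =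
    (nrm2 (fun x => s n x - l x))%:E by rewrite nrm2E//; exact: inL2B.
split=> [[_]|H].
  by under eq_fun do rewrite E; move/fine_cvgP => [_].
by split => //; under eq_fun do rewrite E; apply: cvg_EFin => //; exact: nearW.
Qed.

Lemma L2_cvg_ip s l h : (forall n, inL2 (s n)) -> L2_cvg s l -> inL2 h ->
  ccvg (fun n => ip (s n) h) (ip l h).
Proof.
move=> Hs sl Hh; have [Hl _] := sl; move/(L2_cvgP Hs Hl) : sl => sl.
apply: (@ccvg_le _ _ _ (fun n => nrm2 (fun x => s n x - l x) * nrm2 h)).
  by move=> n; exact: sqmod_ipB_le.
by have := cvgM sl (cvg_cst (nrm2 h)); rewrite mul0r; apply.
Qed.

Lemma L2_cvg_nrm2 s l : (forall n, inL2 (s n)) -> L2_cvg s l ->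
  nrm2 (s n) @[n --> \oo] --> nrm2 l.
Proof.
move=> Hs sl; have [Hl _] := sl; have [c _] := L2_cvg_ip Hs sl Hl.
move/(L2_cvgP Hs Hl) : sl => sl.
have E n : nrm2 (s n) = nrm2 (fun x => s n x - l x) - nrm2 l + 2 * complex.Re (ip (s n) l).
  by rewrite nrm2B//; lra.
under eq_fun do rewrite E.
have := cvgD (cvgB sl (cvg_cst (nrm2 l))) (cvgM (cvg_cst (2 : R)) c).
have E2 (a : R) : 0 - a + 2 * a = a by lra.
by rewrite ipxx// ReC E2; apply.
Qed.

Lemma L2_cvg_sqnorm s l : (forall n, inL2 (s n)) -> L2_cvg s l ->
  sqnorm (s n) @[n --> \oo] --> sqnorm l.
Proof.
move=> Hs sl; have [Hl _] := sl; rewrite -nrm2E//.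
under eq_fun do rewrite -nrm2E//.
by apply: cvg_EFin; [exact: nearW|exact: L2_cvg_nrm2].
Qed.

Lemma L2_cvgD s s' l l' : (forall n, inL2 (s n)) -> (forall n, inL2 (s' n)) ->
  L2_cvg s l -> L2_cvg s' l' ->
  L2_cvg (fun n x => s n x + s' n x) (fun x => l x + l' x).
Proof.
move=> Hs Hs' sl sl'; have [Hl _] := sl; have [Hl' _] := sl'.
apply/L2_cvgP => [n||]; [exact: inL2D|exact: inL2D|].
move/(L2_cvgP Hs Hl) : sl => sl; move/(L2_cvgP Hs' Hl') : sl' => sl'.
apply: (@cvg0_squeeze _ _ (fun n => 2 * nrm2 (fun x => s n x - l x) +
   2 * nrm2 (fun x => s' n x - l' x))) => [n|].
  rewrite ger0_norm ?nrm2_ge0//.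
  rewrite (_ : (fun x => _) = (fun x => (s n x - l x) + (s' n x - l' x))).
    by apply: nrm2D_le2 => //; exact: inL2B.
  by apply/funext => x; ring.
have := cvgD (cvgM (cvg_cst (2 : R)) sl) (cvgM (cvg_cst (2 : R)) sl').
by rewrite !mulr0 addr0; apply.
Qed.

Lemma L2_cvgN s l : (forall n, inL2 (s n)) -> L2_cvg s l ->
  L2_cvg (fun n x => - s n x) (fun x => - l x).
Proof.
move=> Hs sl; have [Hl _] := sl; apply/L2_cvgP => [n||]; [exact: inL2N|exact: inL2N|].
move/(L2_cvgP Hs Hl) : sl => sl.
rewrite (_ : (fun n => _) = (fun n => nrm2 (fun x => s n x - l x)))//.
by apply/funext => n; rewrite [RHS]nrm2BC; congr nrm2; apply/funext => x; ring.
Qed.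

Lemma L2_cvg_cst l : inL2 l -> L2_cvg (fun=> l) l.
Proof.
move=> Hl; split => //; under eq_fun do under eq_sqnorm do rewrite subrr.
by rewrite sqnorm0; exact: cvg_cst.
Qed.

Lemma L2_cvg_sum I (r : seq I) (S : I -> nat -> T -> R[i]) (L : I -> T -> R[i]) :
  (forall i n, inL2 (S i n)) -> (forall i, L2_cvg (S i) (L i)) ->
  L2_cvg (fun n x => \sum_(i <- r) S i n x) (fun x => \sum_(i <- r) L i x).
Proof.
move=> HS SL; elim: r => [|i r IH].
  rewrite (_ : (fun n x => _) = (fun=> fun=> 0)); last first.
    by apply/funext => n; apply/funext => x; rewrite big_nil.
  under [X in L2_cvg _ X]eq_fun do rewrite big_nil.
  exact/L2_cvg_cst/inL2_0.
rewrite (_ : (fun n x => _) = (fun n x => S i n x + \sum_(j <- r) S j n x)); last first.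
  by apply/funext => n; apply/funext => x; rewrite big_cons.
under [X in L2_cvg _ X]eq_fun do rewrite big_cons.
apply: L2_cvgD => // n; exact: inL2_sum.
Qed.

(** Along a fast subsequence [t] the series of the [4^k |t_(k+1) - t_k|^2] has
    a finite integral, so that almost everywhere the increments are dominated
    by a geometric sequence; Fatou's lemma identifies the pointwise limit as
    the mean square limit of the whole sequence. *)
Theorem L2_complete s : (forall n, inL2 (s n)) ->
  (forall e, 0 < e -> exists N, forall m n, (N <= m)%N -> (N <= n)%N ->
     nrm2 (fun x => s m x - s n x) <= e) ->
  exists l, L2_cvg s l.
Proof.
move=> Hs cs.
(* Squared increments of size 16^-k remain summable with the weights 4^k. *)
have p16 k : 0 < 16^-1 ^+ k :> R by rewrite exprn_gt0.
have [N NP] := choice (fun k => cs _ (p16 k)).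
pose n_ k := (\sum_(j < k.+1) N j + k)%N.
have nN k : (N k <= n_ k)%N by rewrite /n_ big_ord_recr /= ; lia.
have nS k : (n_ k <= n_ k.+1)%N by rewrite /n_ [in leqRHS]big_ord_recr /=; lia.
pose t k := s (n_ k).
have Ht k : inL2 (t k) by exact: Hs.
have tS k : nrm2 (fun x => t k.+1 x - t k x) <= 16^-1 ^+ k.
  by apply: NP; [exact: leq_trans (nN k) (nS k)|exact: nN].
pose w k x := ((4 ^+ k)%:E * (sqmod (t k.+1 x - t k x))%:E)%E.
have w0 k x : (0 <= w k x)%E by rewrite mule_ge0// lee_fin ?sqmod_ge0 ?exprn_ge0.
have mdt k : cmeasurable D (fun x => t k.+1 x - t k x).
  by apply: cmeasurableB => //; exact: inL2_meas.
have mw k : measurable_fun D (w k).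
  by apply: measurable_funeM; exact: measurable_sqmodE.
pose h x := (\sum_(0 <= k <oo) w k x)%E.
have mh : measurable_fun D h by apply: ge0_emeasurable_sum.
have h0 x : (0 <= h x)%E by apply: nneseries_ge0.
have ih : (\int[mu]_(x in D) h x < +oo)%E.
  rewrite integral_nneseries//.
  apply: (@le_lt_trans _ _ (\sum_(0 <= k <oo) (4^-1 ^+ k)%:E)%E).
    apply: lee_nneseries => [k _ _|k _]; first by apply: integral_ge0.
    rewrite ge0_integralZl//; [|exact: measurable_sqmodE|
      by move=> x _; rewrite lee_fin sqmod_ge0].
    rewrite -/(sqnorm (fun x => t k.+1 x - t k x)) -nrm2E; last exact: inL2B.
    rewrite -EFinM lee_fin.
    apply: le_trans (ler_wpM2l _ (tS k)) _; first by rewrite exprn_ge0.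
    by rewrite -exprMn le_eqVlt; apply/orP; left; apply/eqP; congr (_ ^+ _); lra.
  have c4 : series (geometric 1 (4^-1 : R)) x @[x --> \oo] --> 1 / (1 - 4^-1 : R).
    by apply: cvg_geometric_series; rewrite ger0_norm//; lra.
  have -> : (\sum_(0 <= k <oo) (4^-1 ^+ k)%:E)%E = (1 / (1 - 4^-1 : R))%:E.
    apply/cvg_lim => //.
    rewrite (_ : (fun n => _) = (fun n => (series (geometric 1 (4^-1 : R)) n)%:E)).
      by apply: cvg_EFin => //; exact: nearW.
    apply/funext => n; rewrite /series /= -sumEFin.
    by apply: eq_bigr => k _; rewrite mul1r.
  exact: ltry.
pose G := D `&` [set x | h x \is a fin_num].
have mG : measurable G by exact: emeasurable_fin_num.
have aeG : {ae mu, forall x, D x -> G x}.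
  have : mu.-integrable D h.
    apply/integrableP; split => //; under eq_integral do rewrite gee0_abs//.
    exact: ih.
  by move/(integrable_ae mD); apply: filterS => x hx Dx; split => //; exact: hx.
(* On G the increments are dominated by a geometric sequence. *)
have geo (q : nat -> R) M : (forall k, (q k) ^+ 2 * 4 ^+ k <= M) -> cvgn (series q).
  move=> qM; apply: normed_cvg.
  have M0 : 0 <= M.
    by apply: le_trans (qM 0%N); rewrite mulr_ge0 ?sqr_ge0 ?exprn_ge0.
  apply: (@series_le_cvg _ _ (geometric (Num.sqrt M) 2^-1)) => [n|n|n|].
  - exact: normr_ge0.
  - by rewrite /geometric /= mulr_ge0 ?sqrtr_ge0 ?exprn_ge0.
  - have b0 : 0 <= geometric (Num.sqrt M) 2^-1 n.
      by rewrite /geometric /= mulr_ge0 ?sqrtr_ge0 ?exprn_ge0.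
    rewrite -ler_sqr ?nnegrE//= real_normK ?num_real// exprMn sqr_sqrtr//.
    rewrite -exprM mulnC exprM (_ : 2^-1 ^+ 2 = 4^-1); last by lra.
    by rewrite exprVn ler_pdivlMr// exprn_gt0.
  - by apply: is_cvg_geometric_series; rewrite ger0_norm//; lra.
have Gw x k : G x -> sqmod (t k.+1 x - t k x) * 4 ^+ k <= fine (h x).
  move=> [Dx hx]; rewrite -lee_fin fineK// mulrC EFinM -/(w k x).
  apply: le_trans (nneseries_lim_ge k.+1 _) => //=.
  rewrite big_nat_recr//= leeDr//; exact: sume_ge0.
have cvgt (q : nat -> R) : cvgn (series (fun k => q k.+1 - q k)) -> cvgn q.
  have E : q = series (fun k => q k.+1 - q k) + cst (q 0%N).
    rewrite (telescopeK q); apply/funext => n /=.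
    by rewrite -[RHS]/(q n - q 0%N + q 0%N) subrK.
  by move=> c; rewrite E; apply: is_cvgD => //; exact: is_cvg_cst.
have cRe x : G x -> cvgn (fun k => complex.Re (t k x)).
  move=> Gx; apply: cvgt; apply: (geo _ (fine (h x))) => k.
  apply: le_trans (Gw x k Gx); rewrite ler_wpM2r ?exprn_ge0//.
  by have := Re_sqr_le (t k.+1 x - t k x); rewrite !cE.
have cIm x : G x -> cvgn (fun k => complex.Im (t k x)).
  move=> Gx; apply: cvgt; apply: (geo _ (fine (h x))) => k.
  apply: le_trans (Gw x k Gx); rewrite ler_wpM2r ?exprn_ge0//.
  by have := Im_sqr_le (t k.+1 x - t k x); rewrite !cE.
pose one x : R := \1_G x.
pose l x : R[i] := if x \in G then
  limn (fun k => complex.Re (t k x)) +i* limn (fun k => complex.Im (t k x)) else 0.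
have tl x : G x -> ccvg (fun k => t k x) (l x).
  by move=> Gx; rewrite /l mem_set//; split; [exact: cRe|exact: cIm].
have ml : cmeasurable D l.
  have mone : cmeasurable D (fun x => (one x)%:C).
    by apply: cmeasurableC; exact: measurable_indic.
  apply: (@cmeasurable_ccvg _ _ _ _ (fun k x => t k x * (one x)%:C)) => [k|x Dx].
    by apply: cmeasurableM => //; exact: inL2_meas.
  have -> : l x = l x * (one x)%:C.
    by rewrite /one indicE /l; case: (x \in G); rewrite ?mulr1 ?mul0r.
  have [Gx|nGx] := pselect (G x); first by apply: ccvgM; [exact: tl|exact: ccvg_cst].
  by rewrite /one indicE memNset//; under eq_fun do rewrite mulr0; rewrite mulr0; exact: ccvg_cst.
have mone : measurable_fun D one by exact: measurable_indic.
have key e : 0 < e -> exists n0, forall n, (n0 <= n)%N ->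
    (sqnorm (fun x => s n x - l x)%R <= e%:E)%E.
  move=> e0; have [n0 n0P] := cs _ e0; exists n0 => n n0n.
  pose f k x := (sqmod (s n x - t (k + n0)%N x) * one x)%:E.
  have mf k : measurable_fun D (f k).
    apply/measurable_EFinP; apply: measurable_funM => //.
    by apply: measurable_sqmod; apply: cmeasurableB => //; exact: inL2_meas.
  have one0 x : 0 <= one x <= 1 by rewrite /one indicE; case: (_ \in _); rewrite ?lexx ?ler01.
  have f0 : forall j x, D x -> (0 <= f j x)%E.
    by move=> j x Dx; rewrite lee_fin mulr_ge0 ?sqmod_ge0//; have /andP[] := one0 x.
  apply: (@le_trans _ _ (\int[mu]_(x in D) limn_einf (f^~ x))%E).
    rewrite le_eqVlt; apply/orP; left; apply/eqP.
    transitivity (\int[mu]_(x in D) (sqmod (s n x - l x) * one x)%:E)%E.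
      have msl : cmeasurable D (fun x => s n x - l x).
        by apply: cmeasurableB => //; exact: inL2_meas.
      apply: ae_eq_integral => //.
      - exact: measurable_sqmodE.
      - by apply/measurable_EFinP; apply: measurable_funM => //; exact: measurable_sqmod.
      - by apply: filterS aeG => x Gx Dx; rewrite /one indicE mem_set ?mulr1//; exact: Gx.
    apply: eq_integral => x _; symmetry; apply: (cvg_limn_einf_sup _).1.
    apply: cvg_EFin; first exact: nearW.
    have [Gx|nGx] := pselect (G x); last first.
      rewrite /f /one indicE memNset//=; under eq_fun do rewrite mulr0.
      by rewrite mulr0; exact: cvg_cst.
    apply: cvgM; last exact: cvg_cst.
    apply: sqmod_ccvg; apply: ccvgB; first exact: ccvg_cst.
    have [tr ti] := tl x Gx.
    by split; [move: tr|move: ti]; rewrite -(cvg_shiftn n0).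
  apply: le_trans (fatou mu mD mf f0) _.
  rewrite limn_einf_lim; apply: lime_le; first exact: is_cvg_einfs.
  apply: nearW => k; apply: le_trans (ereal_inf_lbound _) _.
    by exists k => //=.
  apply: (@le_trans _ _ (sqnorm (fun x => s n x - t (k + n0)%N x))).
    apply: ge0_le_integral => //.
    + exact: f0.
    + by apply: measurable_sqmodE; apply: cmeasurableB => //; exact: inL2_meas.
    + move=> x Dx; rewrite lee_fin ler_piMr ?sqmod_ge0//.
      by have /andP[] := one0 x.
  rewrite -nrm2E; last exact: inL2B.
  by rewrite lee_fin n0P// /n_; lia.
exists l.
have Hl : inL2 l.
  have [n0 /(_ n0 (leqnn _)) H] := key 1 ltr01.
  rewrite (_ : l = (fun x => s n0 x - (s n0 x - l x))); last first.
    by apply/funext => x; ring.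
  apply: inL2B => //; split; last exact: le_lt_trans H (ltry _).
  by apply: cmeasurableB => //; exact: inL2_meas.
apply/L2_cvgP => //; apply/cvgr0Pnorm_le => e e0.
have [n0 H] := key e e0; exists n0 => // n /= n0n.
rewrite ger0_norm ?nrm2_ge0// -lee_fin nrm2E; first exact: H.
exact: inL2B.
Qed.

End mean_square.

(** * Iterated integrals over rectangles *)

Section rectangles.
Context {R : realType} {d1 d2 : measure_display}
  {T1 : measurableType d1} {T2 : measurableType d2}.
Variables (m1 : {sigma_finite_measure set T1 -> \bar R})
  (m2 : {sigma_finite_measure set T2 -> \bar R}).
Variables (D1 : set T1) (D2 : set T2).
Hypotheses (mD1 : measurable D1) (mD2 : measurable D2).

Let mD : measurable (D1 `*` D2). Proof. exact: measurableX. Qed.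

Let patch_section (f : T1 * T2 -> \bar R) x y :
  (f \_ (D1 `*` D2)) (x, y) = (if x \in D1 then ((fun y => f (x, y)) \_ D2) y else 0)%E.
Proof.
rewrite /patch in_setX /=; by case: (x \in D1); case: (y \in D2).
Qed.

Let integral_section (f : T1 * T2 -> \bar R) x :
  (\int[m2]_y (f \_ (D1 `*` D2)) (x, y) =
   ((fun x => \int[m2]_(y in D2) f (x, y)) \_ D1) x)%E.
Proof.
under eq_integral do rewrite patch_section.
rewrite {2}/patch; case: (x \in D1).
  by rewrite [RHS]integral_mkcond.
by rewrite integral0_eq.
Qed.

Let integral_section2 (f : T1 * T2 -> \bar R) y :
  (\int[m1]_x (f \_ (D1 `*` D2)) (x, y) =
   ((fun y => \int[m1]_(x in D1) f (x, y)) \_ D2) y)%E.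
Proof.
rewrite {2}/patch; case: ifP => yD.
  rewrite [RHS]integral_mkcond; apply: eq_integral => x _.
  by rewrite /patch in_setX /= yD andbT.
by rewrite integral0_eq// => x _; rewrite /patch in_setX /= yD andbF.
Qed.

Section nonnegative.
Variable f : T1 * T2 -> \bar R.
Hypothesis mf : measurable_fun (D1 `*` D2) f.
Hypothesis f0 : forall z, (D1 `*` D2) z -> (0 <= f z)%E.

Let mF : measurable_fun setT (f \_ (D1 `*` D2)).
Proof. by apply/(measurable_restrictT _ mD). Qed.
Let F0 z : (0 <= (f \_ (D1 `*` D2)) z)%E.
Proof. by rewrite /patch; case: ifPn => //; rewrite inE => /f0. Qed.

Lemma measurable_tonelli : measurable_fun D1 (fun x => \int[m2]_(y in D2) f (x, y))%E.
Proof.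
apply/(measurable_restrictT _ mD1).
rewrite (_ : _ \_ _ = (fun x => \int[m2]_y (f \_ (D1 `*` D2)) (x, y))%E).
  exact: (measurable_fun_fubini_tonelli_F (m2 := m2) _ mF F0).
by apply/funext => x; rewrite integral_section.
Qed.

Lemma measurable_tonelli2 : measurable_fun D2 (fun y => \int[m1]_(x in D1) f (x, y))%E.
Proof.
apply/(measurable_restrictT _ mD2).
rewrite (_ : _ \_ _ = (fun y => \int[m1]_x (f \_ (D1 `*` D2)) (x, y))%E).
  exact: (measurable_fun_fubini_tonelli_G (m1 := m1) _ mF F0).
by apply/funext => y; rewrite integral_section2.
Qed.

Lemma tonelli : (\int[m1 \x m2]_(z in D1 `*` D2) f z =
  \int[m1]_(x in D1) \int[m2]_(y in D2) f (x, y))%E.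
Proof.
rewrite [LHS]integral_mkcond fubini_tonelli1// [RHS]integral_mkcond.
by apply: eq_integral => x _; rewrite /fubini_F integral_section.
Qed.

Lemma tonelli_swap : (\int[m1]_(x in D1) \int[m2]_(y in D2) f (x, y) =
  \int[m2]_(y in D2) \int[m1]_(x in D1) f (x, y))%E.
Proof.
transitivity (\int[m1]_x \int[m2]_y (f \_ (D1 `*` D2)) (x, y))%E.
  rewrite [LHS]integral_mkcond.
  by apply: eq_integral => x _; rewrite integral_section.
rewrite (fubini_tonelli _ mF F0) [RHS]integral_mkcond.
by apply: eq_integral => y _; rewrite /fubini_G integral_section2.
Qed.
End nonnegative.

Section real.
Variable r : T1 * T2 -> R.

Lemma measurable_Rintegral : measurable_fun (D1 `*` D2) r ->
  measurable_fun D1 (fun x => \int[m2]_(y in D2) r (x, y)).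
Proof.
move=> mr; rewrite /Rintegral.
have mE : measurable_fun (D1 `*` D2) (EFin \o r) by exact/measurable_EFinP.
have mp := measurable_funepos mE; have mn := measurable_funeneg mE.
apply: (@measurableT_comp _ _ _ _ _ _ fine); first exact: fine_measurable.
rewrite (_ : (fun x => _) = (fun x => (\int[m2]_(y in D2) (EFin \o r)^\+ (x, y)) -
   (\int[m2]_(y in D2) (EFin \o r)^\- (x, y)))%E).
  by apply: emeasurable_funB; apply: measurable_tonelli.
by apply/funext => x; rewrite [LHS]integralE; congr (_ - _)%E;
  apply: eq_integral => y _; rewrite ?funeposE ?funenegE.
Qed.

Lemma measurable_Rintegral2 : measurable_fun (D1 `*` D2) r ->
  measurable_fun D2 (fun y => \int[m1]_(x in D1) r (x, y)).
Proof.
move=> mr; rewrite /Rintegral.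
have mE : measurable_fun (D1 `*` D2) (EFin \o r) by exact/measurable_EFinP.
have mp := measurable_funepos mE; have mn := measurable_funeneg mE.
apply: (@measurableT_comp _ _ _ _ _ _ fine); first exact: fine_measurable.
rewrite (_ : (fun y => _) = (fun y => (\int[m1]_(x in D1) (EFin \o r)^\+ (x, y)) -
   (\int[m1]_(x in D1) (EFin \o r)^\- (x, y)))%E).
  by apply: emeasurable_funB; apply: measurable_tonelli2.
by apply/funext => y; rewrite [LHS]integralE; congr (_ - _)%E;
  apply: eq_integral => x _; rewrite ?funeposE ?funenegE.
Qed.

Hypothesis ir : (m1 \x m2)%E.-integrable (D1 `*` D2) (EFin \o r).

Lemma Rfubini : \int[m1]_(x in D1) \int[m2]_(y in D2) r (x, y) =
  \int[m2]_(y in D2) \int[m1]_(x in D1) r (x, y).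
Proof.
have mr : measurable_fun (D1 `*` D2) (EFin \o r) by case/integrableP : ir.
have mr' : measurable_fun (D1 `*` D2) r by apply/measurable_EFinP.
have ir' : (m1 \x m2)%E.-integrable setT ((EFin \o r) \_ (D1 `*` D2)).
  exact/(integrable_mkcond _ mD).1.
transitivity (fine (\int[m1]_x \int[m2]_y ((EFin \o r) \_ (D1 `*` D2)) (x, y)))%E.
  rewrite /Rintegral; congr fine; rewrite [LHS]integral_mkcond.
  have mg := measurable_fubini_F ir'.
  apply: ae_eq_integral => //.
    apply/(measurable_restrictT _ mD1); apply/measurable_EFinP.
    exact: measurable_Rintegral.
  have := ae_integrable1 ir'; apply: filterS => x /= + _.
  rewrite integral_section /patch; case: ifPn => // xD ix.
  rewrite fineK//; apply: integrable_fin_num => //.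
  apply/(integrable_mkcond _ mD2); apply: eq_integrable_in ix => // y _.
  by rewrite /patch in_setX /= xD.
rewrite (Fubini ir') /Rintegral; congr fine; rewrite [RHS]integral_mkcond.
have mg := measurable_fubini_G ir'.
symmetry; apply: ae_eq_integral => //.
  apply/(measurable_restrictT _ mD2); apply/measurable_EFinP.
  exact: measurable_Rintegral2.
have := ae_integrable2 ir'; apply: filterS => y /= + _.
rewrite integral_section2 /patch; case: ifPn => // yD ix.
rewrite fineK//; apply: integrable_fin_num => //.
apply/(integrable_mkcond _ mD1); apply: eq_integrable_in ix => // x _.
by rewrite /patch in_setX /= yD andbT.
Qed.
End real.

Section complex.
Variable f : T1 -> T2 -> R[i].

Lemma cmeasurable_section x : D1 x ->
  cmeasurable (D1 `*` D2) (fun z => f z.1 z.2) -> cmeasurable D2 (f x).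
Proof.
move=> Dx [mr mi]; have sub : (fun y => (x, y)) @` D2 `<=` D1 `*` D2.
  by move=> _ [y Dy <-].
have mp : measurable_fun D2 (fun y : T2 => (x, y)).
  by apply: measurable_funTS; exact: pair1_measurable.
by split; [exact: (measurable_comp mD sub mr mp)|exact: (measurable_comp mD sub mi mp)].
Qed.

Lemma cmeasurable_section2 y : D2 y ->
  cmeasurable (D1 `*` D2) (fun z => f z.1 z.2) -> cmeasurable D1 (f ^~ y).
Proof.
move=> Dy [mr mi]; have sub : (fun x => (x, y)) @` D1 `<=` D1 `*` D2.
  by move=> _ [x Dx <-].
have mp : measurable_fun D1 (fun x : T1 => (x, y)).
  by apply: measurable_funTS; exact: pair2_measurable.
by split; [exact: (measurable_comp mD sub mr mp)|exact: (measurable_comp mD sub mi mp)].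
Qed.

Lemma cmeasurable_cintegral : cmeasurable (D1 `*` D2) (fun z => f z.1 z.2) ->
  cmeasurable D1 (fun x => cintegral m2 D2 (f x)).
Proof.
move=> [mr mi]; split; first exact: (measurable_Rintegral mr).
exact: (measurable_Rintegral mi).
Qed.

Lemma cmeasurable_cintegral2 : cmeasurable (D1 `*` D2) (fun z => f z.1 z.2) ->
  cmeasurable D2 (fun y => cintegral m1 D1 (f ^~ y)).
Proof.
move=> [mr mi]; split; first exact: (measurable_Rintegral2 mr).
exact: (measurable_Rintegral2 mi).
Qed.

Lemma cfubini : cintegrable (m1 \x m2)%E (D1 `*` D2) (fun z => f z.1 z.2) ->
  cintegral m1 D1 (fun x => cintegral m2 D2 (f x)) =
  cintegral m2 D2 (fun y => cintegral m1 D1 (f ^~ y)).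
Proof.
move=> [ir ii]; apply: eq_ReIm; first exact: (Rfubini ir).
exact: (Rfubini ii).
Qed.

Lemma sqnorm_prod : cmeasurable (D1 `*` D2) (fun z => f z.1 z.2) ->
  sqnorm (m1 \x m2)%E (D1 `*` D2) (fun z => f z.1 z.2) =
  (\int[m1]_(x in D1) sqnorm m2 D2 (f x))%E.
Proof.
move=> mf; rewrite /sqnorm tonelli//; first exact: measurable_sqmodE.
by move=> z _; rewrite lee_fin sqmod_ge0.
Qed.

Lemma measurable_sqnorm : cmeasurable (D1 `*` D2) (fun z => f z.1 z.2) ->
  measurable_fun D1 (fun x => sqnorm m2 D2 (f x)).
Proof.
move=> mf; apply: (@measurable_tonelli (fun z => (sqmod (f z.1 z.2))%:E)).
  exact: measurable_sqmodE.
by move=> z _; rewrite lee_fin sqmod_ge0.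
Qed.

End complex.

Lemma cmeasurable_fst (g : T1 -> R[i]) : cmeasurable D1 g ->
  cmeasurable (D1 `*` D2) (fun z => g z.1).
Proof.
have sub : fst @` (D1 `*` D2) `<=` D1 by move=> _ [[x y] [/= Dx _] <-].
have mp : measurable_fun (D1 `*` D2) (@fst T1 T2).
  by apply: measurable_funTS; exact: measurable_fst.
by move=> [mr mi]; split; [exact: (measurable_comp mD1 sub mr mp)|
  exact: (measurable_comp mD1 sub mi mp)].
Qed.

Lemma cmeasurable_snd (g : T2 -> R[i]) : cmeasurable D2 g ->
  cmeasurable (D1 `*` D2) (fun z => g z.2).
Proof.
have sub : snd @` (D1 `*` D2) `<=` D2 by move=> _ [[x y] [_ /= Dy] <-].
have mp : measurable_fun (D1 `*` D2) (@snd T1 T2).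
  by apply: measurable_funTS; exact: measurable_snd.
by move=> [mr mi]; split; [exact: (measurable_comp mD2 sub mr mp)|
  exact: (measurable_comp mD2 sub mi mp)].
Qed.

(** The measures of the sections of a null set integrate to zero. *)
Lemma ae_section (Q : T1 -> T2 -> Prop) :
  {ae (m1 \x m2)%E, forall z, Q z.1 z.2} ->
  {ae m1, forall x, {ae m2, forall y, Q x y}}.
Proof.
move=> [A [mA A0 QA]].
have : (\int[m1]_x `|(m2 \o xsection A) x| = 0)%E.
  rewrite -[RHS]A0 /= /product_measure1; apply: eq_integral => x _.
  by rewrite gee0_abs.
move/(ae_eq_integral_abs _ measurableT) => /(_ _)/wrap[].
  exact: measurable_fun_xsection.
apply: filterS => x /(_ I) /= xA0; exists (xsection A x); split => //.
  exact: measurable_xsection.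
by move=> y nQ; rewrite /xsection /= inE; apply: QA.
Qed.

End rectangles.

(** * Orthonormal families *)

Section orthonormal_families.
Context {R : realType} {d : measure_display} {T : measurableType d}.
Variables (mu : {measure set T -> \bar R}) (D : set T).
Hypothesis mD : measurable D.
Local Notation inL2 := (inL2 mu D).
Local Notation nrm2 := (nrm2 mu D).
Local Notation ip := (ip mu D).

Variables (I : eqType) (e : I -> T -> R[i]) (r : seq I).
Hypotheses (He : forall j, inL2 (e j))
  (ee : forall j k, ip (e j) (e k) = (j == k)%:R) (ur : uniq r).

Let sumH (c : I -> R[i]) : inL2 (fun x => \sum_(j <- r) c j * e j x).
Proof. by apply: inL2_sum => // j; exact: inL2Z. Qed.

Lemma ip_orthonormal_sum (c : I -> R[i]) k : k \in r ->
  ip (fun x => \sum_(j <- r) c j * e j x) (e k) = c k.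
Proof.
move=> kr; rewrite ip_suml//; last by move=> j; exact: inL2Z.
rewrite (bigD1_seq k)//= ipZl// ee eqxx mulr1 big1 ?addr0// => j jk.
by rewrite ipZl// ee (negbTE jk) mulr0.
Qed.

Lemma nrm2_orthonormal_sum (c : I -> R[i]) :
  nrm2 (fun x => \sum_(j <- r) c j * e j x) = \sum_(j <- r) sqmod (c j).
Proof.
have E h : inL2 h -> nrm2 h = complex.Re (ip h h) by move=> /ipxx ->.
rewrite E// ip_sumr//; last by move=> j; exact: inL2Z.
rewrite Re_sum big_seq [RHS]big_seq; apply: eq_bigr => j jr.
by rewrite ipZr// ip_orthonormal_sum// mulrC mulc_conjc.
Qed.

Lemma nrm2_projection x : inL2 x ->
  nrm2 (fun u => x u - \sum_(j <- r) ip x (e j) * e j u) =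
  nrm2 x - \sum_(j <- r) sqmod (ip x (e j)).
Proof.
move=> Hx; rewrite nrm2B// nrm2_orthonormal_sum.
rewrite ip_sumr//; last by move=> j; exact: inL2Z.
rewrite Re_sum [X in 2 * X](eq_bigr (fun j => sqmod (ip x (e j)))).
  have H (a b : R) : a + b - 2 * b = a - b by lra.
  exact: H.
by move=> j _; rewrite ipZr// mulrC mulc_conjc.
Qed.

Lemma bessel x : inL2 x -> \sum_(j <- r) sqmod (ip x (e j)) <= nrm2 x.
Proof. by move=> Hx; rewrite -subr_ge0 -nrm2_projection// nrm2_ge0. Qed.

End orthonormal_families.

Section square_integrable_on_unit_interval.
Context {R : realType}.
Local Notation leb := (@lebesgue_measure R).
Implicit Types (x y : R -> R[i]).

Local Notation ipH := (ip leb unitI).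
Local Notation nrmH := (nrm2 leb unitI).

Lemma measurable_unitI : measurable (@unitI R). Proof. exact: measurable_itv. Qed.
Lemma measurable_freqI : measurable (@freqI R). Proof. exact: measurable_itv. Qed.

Section basis.
Variable e : nat -> R -> R[i].
Hypothesis eB : orthonormal_basis e.

Let He j : inH (e j). Proof. by case: eB => -[]. Qed.
Let ee j k : ipH (e j) (e k) = (j == k)%:R. Proof. by case: eB => -[_ /(_ j k)]. Qed.

Lemma basis_sum_ord n (c : nat -> R[i]) :
  nrmH (fun u => \sum_(j < n) c j * e j u) = \sum_(j < n) sqmod (c j).
Proof.
have ee' (j k : 'I_n) : ipH (e j) (e k) = (j == k)%:R by rewrite ee.
exact: (nrm2_orthonormal_sum measurable_unitI (fun j : 'I_n => He j) ee'
  (index_enum_uniq _)).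
Qed.

Lemma parseval_cvg x : inH x ->
  \sum_(j < n) sqmod (ipH x (e j)) @[n --> \oo] --> nrmH x.
Proof.
move=> Hx; have mI := measurable_unitI.
have Hs n : inH (fun u => \sum_(j < n) inner x (e j) * e j u).
  by apply: inL2_sum => // j; apply: inL2Z => //; exact: He.
have [_ /(_ x Hx) /(L2_cvg_nrm2 mI Hs)] := eB.
rewrite (_ : (fun n => _) = (fun n => \sum_(j < n) sqmod (ipH x (e j))))//.
by apply/funext => n; rewrite (basis_sum_ord n (fun j => ipH x (e j))).
Qed.

Lemma parseval x : inH x ->
  sqnorm leb unitI x = (\sum_(0 <= j <oo) (sqmod (ipH x (e j)))%:E)%E.
Proof.
move=> Hx; rewrite -nrm2E//; symmetry; apply/cvg_lim => //.
rewrite (_ : (fun n => _) = (fun n => (\sum_(j < n) sqmod (ipH x (e j)))%:E)).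
  by apply: cvg_EFin; [exact: nearW|exact: parseval_cvg].
by apply/funext => n; rewrite sumEFin big_mkord.
Qed.

Lemma parseval_ip x y : inH x -> inH y ->
  ccvg (fun n => \sum_(j < n) ipH x (e j) * ipH (e j) y) (ipH x y).
Proof.
move=> Hx Hy; have mI := measurable_unitI.
have Hs n : inH (fun u => \sum_(j < n) inner x (e j) * e j u).
  by apply: inL2_sum => // j; apply: inL2Z => //; exact: He.
case: eB => _ /(_ x Hx) /(L2_cvg_ip mI Hs) /(_ Hy).
rewrite (_ : (fun n => _) = (fun n => \sum_(j < n) ipH x (e j) * ipH (e j) y))//.
apply/funext => n; rewrite ip_suml//; last by move=> j; apply: inL2Z => //; exact: He.
by apply: eq_bigr => j _; rewrite ipZl//; exact: He.
Qed.

End basis.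
End square_integrable_on_unit_interval.

(** * The autocovariance form of the process *)

Section process_covariance.
Context {R : realType} {d : measure_display} {Om : measurableType d}
  (P : probability Om R).
Local Notation leb := (@lebesgue_measure R).
Local Notation ipH := (ip leb unitI).
Local Notation nrmH := (nrm2 leb unitI).
Local Notation ipP := (ip P setT).
Local Notation nrmP := (nrm2 P setT).
Local Notation mI := (@measurable_unitI R).
Implicit Types (x y : R -> R[i]) (Z : Om -> R -> R[i]).

Local Notation mT := (@measurableT d Om).

Lemma E_normH2E Z : cmeasurable ([set: Om] `*` unitI) (fun z => Z z.1 z.2) ->
  E_normH2 P Z = sqnorm (P \x leb)%E (setT `*` unitI) (fun z => Z z.1 z.2).
Proof. by move=> mZ; rewrite (sqnorm_prod P leb mT mI). Qed.

Lemma L2_random_elementE Z :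
  L2_random_element P Z <-> inL2 (P \x leb)%E (setT `*` unitI) (fun z => Z z.1 z.2).
Proof. by split=> -[mZ nZ]; split => //; move: nZ; rewrite E_normH2E. Qed.

Lemma cmeasurable_prod_snd x : inH x ->
  cmeasurable ([set: Om] `*` unitI) (fun z => x z.2).
Proof. by move=> [mx _]; exact: (cmeasurable_snd setT mI mx). Qed.

Lemma sqnorm_tensor (a : Om -> R[i]) x : inL2 P setT a -> inH x ->
  sqnorm (P \x leb)%E (setT `*` unitI) (fun z => a z.1 * x z.2) =
  (nrm2 P setT a * nrm2 leb unitI x)%:E.
Proof.
move=> Ha Hx; have mm : cmeasurable ([set: Om] `*` unitI) (fun z => a z.1 * x z.2).
  apply: cmeasurableM; last exact: cmeasurable_prod_snd.
  by apply: (cmeasurable_fst unitI mT); case: Ha.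
rewrite (sqnorm_prod P leb mT mI (f := fun w u => a w * x u))//.
under eq_integral do rewrite (sqnormZ leb mI _ (inL2_meas Hx)) -nrm2E// muleC.
rewrite ge0_integralZl//.
- by rewrite -/(sqnorm P setT a) -nrm2E// -EFinM mulrC.
- by apply: measurable_sqmodE; case: Ha.
- by move=> w _; rewrite lee_fin sqmod_ge0.
- by rewrite lee_fin nrm2_ge0.
Qed.

Lemma inL2_tensor (a : Om -> R[i]) x : inL2 P setT a -> inH x ->
  inL2 (P \x leb)%E (setT `*` unitI) (fun z => a z.1 * x z.2).
Proof.
move=> Ha Hx; split; last by rewrite sqnorm_tensor// ltry.
apply: cmeasurableM; last exact: cmeasurable_prod_snd.
by apply: (cmeasurable_fst unitI mT); case: Ha.
Qed.

Variable X : int -> Om -> R -> R[i].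
Hypothesis X2 : forall t, L2_random_element P (X t).

Let mX t : cmeasurable ([set: Om] `*` unitI) (fun z => X t z.1 z.2).
Proof. by case: (X2 t). Qed.
Let X2' t := (L2_random_elementE (X t)).1 (X2 t).

Let mnX t : measurable_fun setT (fun w => normH2 (X t w)).
Proof. exact: (measurable_sqnorm leb mT mI (mX t)). Qed.

Let good t : set Om := [set w | (normH2 (X t w) \is a fin_num)].
Let mgood t : measurable (good t).
Proof. by rewrite -[good t]setTI; apply: emeasurable_fin_num. Qed.

(** A random element has square integrable values only almost surely; with the
    other values replaced by zero, inner products obey the algebraic rules
    everywhere on the probability space. *)
Definition tame t w : R -> R[i] := fun u => (\1_(good t) w)%:C * X t w u.

Lemma tame_good t w : good t w -> tame t w = X t w.
Proof.
by move=> gw; apply/funext => u; rewrite /tame indicE mem_set//= mul1r.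
Qed.

Lemma ae_tame t : {ae P, forall w, tame t w = X t w}.
Proof.
have : P.-integrable setT (fun w => normH2 (X t w)).
  apply/integrableP; split => //; under eq_integral do rewrite gee0_abs ?sqnorm_ge0//.
  by case: (X2 t).
by move/(integrable_ae mT); apply: filterS => w /(_ I) gw; exact: tame_good.
Qed.

Lemma cmeasurable_tame t :
  cmeasurable ([set: Om] `*` unitI) (fun z => tame t z.1 z.2).
Proof.
apply: cmeasurableM => //.
apply: (@cmeasurable_fst _ _ _ _ _ setT unitI mT (fun w => (\1_(good t) w)%:C)).
have H : measurable_fun setT (\1_(good t) : Om -> R) by exact: measurable_indic.
exact: (cmeasurableC H).
Qed.

Lemma tame_inH t w : inH (tame t w).
Proof.
split.
  exact: (cmeasurable_section mT mI (x := w) (f := tame t)) I (cmeasurable_tame t).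
have [gw|ngw] := pselect (good t w).
  rewrite tame_good//; move: gw; rewrite /good /= ge0_fin_numE//.
  exact: sqnorm_ge0.
rewrite (_ : tame t w = fun=> 0) ?sqnorm0//.
by apply/funext => u; rewrite /tame indicE memNset//= mul0r.
Qed.

Lemma tame_nrm2E t w : (nrmH (tame t w))%:E = sqnorm leb unitI (tame t w).
Proof. by rewrite nrm2E//; exact: tame_inH. Qed.

Lemma measurable_tame_nrm2 t : measurable_fun setT (fun w => (nrmH (tame t w))%:E).
Proof.
under eq_fun do rewrite tame_nrm2E.
exact: (measurable_sqnorm leb mT mI (cmeasurable_tame t)).
Qed.

Lemma tame_inL2 t : inL2 (P \x leb)%E (setT `*` unitI) (fun z => tame t z.1 z.2).
Proof.
split; first exact: cmeasurable_tame.
rewrite (sqnorm_prod P leb mT mI (cmeasurable_tame t)).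
case: (X2 t) => _; apply: le_lt_trans; rewrite le_eqVlt; apply/orP; left; apply/eqP.
apply: ae_eq_integral => //.
  exact: (measurable_sqnorm leb mT mI (cmeasurable_tame t)).
by apply: filterS (ae_tame t) => w /= -> _.
Qed.

(** The scalar random variable [<X_t, x>]. *)
Definition sc t x w : R[i] := ipH (tame t w) x.

Lemma scE t x w : sc t x w = ipH (tame t w) x. Proof. by []. Qed.

Lemma cmeasurable_sc t x : inH x -> cmeasurable setT (sc t x).
Proof.
move=> Hx; rewrite (_ : sc t x = fun w => cintegral leb unitI (fun u => tame t w u * conjc (x u))).
  2: by apply/funext => w; rewrite /sc ipE.
apply: (@cmeasurable_cintegral _ _ _ _ _ leb setT unitI mT mI
  (fun w u => tame t w u * conjc (x u))).
apply: cmeasurableM => //; first exact: cmeasurable_tame.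
by apply: cmeasurableJ => //; exact: cmeasurable_prod_snd.
Qed.

Lemma sqmod_sc_le t x w : inH x -> sqmod (sc t x w) <= nrmH (tame t w) * nrmH x.
Proof.
by move=> Hx; apply: cauchy_schwarz => //; [exact: mI|exact: tame_inH].
Qed.

Definition moment2 t : R := fine (E_normH2 P (X t)).

Lemma moment2E t : (\int[P]_w (nrmH (tame t w))%:E)%E = (moment2 t)%:E.
Proof.
rewrite /moment2 fineK; last first.
  rewrite ge0_fin_numE; first by case: (X2 t).
  by apply: integral_ge0 => w _; exact: sqnorm_ge0.
under eq_integral do rewrite tame_nrm2E.
apply: ae_eq_integral => //.
  exact: (measurable_sqnorm leb mT mI (cmeasurable_tame t)).
by apply: filterS (ae_tame t) => w /= -> _.
Qed.

Let sqnorm_sc_le t x : inH x -> (sqnorm P setT (sc t x) <= (moment2 t * nrmH x)%:E)%E.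
Proof.
move=> Hx; rewrite mulrC EFinM -moment2E -ge0_integralZl//; first last.
- by rewrite lee_fin nrm2_ge0.
- by move=> w _; rewrite lee_fin nrm2_ge0.
- exact: measurable_tame_nrm2.
apply: ge0_le_integral => //.
- by move=> w _; rewrite lee_fin sqmod_ge0.
- by apply: measurable_sqmodE => //; exact: cmeasurable_sc.
- by apply: measurable_funeM; exact: measurable_tame_nrm2.
- by move=> w _; rewrite -EFinM lee_fin mulrC sqmod_sc_le.
Qed.

Lemma inL2_sc t x : inH x -> inL2 P setT (sc t x).
Proof.
move=> Hx; split; first exact: cmeasurable_sc.
exact: le_lt_trans (sqnorm_sc_le t Hx) (ltry _).
Qed.

Lemma nrm2_sc_le t x : inH x -> nrmP (sc t x) <= moment2 t * nrmH x.
Proof.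
by move=> Hx; rewrite -lee_fin nrm2E; [exact: sqnorm_sc_le|exact: inL2_sc].
Qed.

Lemma scD t x y w : inH x -> inH y -> sc t (fun u => x u + y u) w = sc t x w + sc t y w.
Proof. by move=> Hx Hy; apply: ipDr => //; [exact: mI|exact: tame_inH]. Qed.
Lemma scZ t c x w : inH x -> sc t (fun u => c * x u) w = conjc c * sc t x w.
Proof. by move=> Hx; apply: ipZr => //; [exact: mI|exact: tame_inH]. Qed.

Definition cov s t x y : R[i] := ipP (sc s y) (sc t x).

Lemma covDl s t x x' y : inH x -> inH x' -> inH y ->
  cov s t (fun u => x u + x' u) y = cov s t x y + cov s t x' y.
Proof.
move=> Hx Hx' Hy; rewrite /cov -ipDr//; [|exact: inL2_sc..].
by apply: eq_ip => w _ //; rewrite scD.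
Qed.
Lemma covDr s t x y y' : inH x -> inH y -> inH y' ->
  cov s t x (fun u => y u + y' u) = cov s t x y + cov s t x y'.
Proof.
move=> Hx Hx' Hy; rewrite /cov -ipDl//; [|exact: inL2_sc..].
by apply: eq_ip => w _ //; rewrite scD.
Qed.
Lemma covZl s t c x y : inH x -> inH y ->
  cov s t (fun u => c * x u) y = c * cov s t x y.
Proof.
move=> Hx Hy; rewrite /cov -[c in RHS]conjcK -ipZr//; [|exact: inL2_sc..].
by apply: eq_ip => w _ //; rewrite scZ.
Qed.
Lemma covZr s t c x y : inH x -> inH y ->
  cov s t x (fun u => c * y u) = conjc c * cov s t x y.
Proof.
move=> Hx Hy; rewrite /cov -ipZl//; [|exact: inL2_sc..].
by apply: eq_ip => w _ //; rewrite scZ.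
Qed.
Lemma covBl s t x x' y : inH x -> inH x' -> inH y ->
  cov s t (fun u => x u - x' u) y = cov s t x y - cov s t x' y.
Proof.
move=> Hx Hx' Hy; have -> : (fun u => x u - x' u) = (fun u => x u + -1 * x' u).
  by apply/funext => u; rewrite mulN1r.
rewrite covDl//; last by apply: inL2Z => //; exact: mI.
by rewrite covZl// mulN1r.
Qed.
Lemma cov_suml s t I (r : seq I) (F : I -> R -> R[i]) y :
  (forall i, inH (F i)) -> inH y ->
  cov s t (fun u => \sum_(i <- r) F i u) y = \sum_(i <- r) cov s t (F i) y.
Proof.
move=> HF Hy; elim: r => [|i r IH].
  have -> : (fun u => \sum_(i <- [::]) F i u) = (fun u => 0 * (0 : R[i])).
    by apply/funext => u; rewrite big_nil mul0r.
  rewrite (covZl _ _ 0 (inL2_0 leb unitI) Hy) mul0r big_nil//.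
have -> : (fun u => \sum_(i <- i :: r) F i u) = (fun u => F i u + \sum_(i <- r) F i u).
  by apply/funext => u; rewrite big_cons.
rewrite covDl//; last exact: (inL2_sum mI).
by rewrite IH big_cons.
Qed.
Lemma cov_sumr s t I (r : seq I) (F : I -> R -> R[i]) x :
  (forall i, inH (F i)) -> inH x ->
  cov s t x (fun u => \sum_(i <- r) F i u) = \sum_(i <- r) cov s t x (F i).
Proof.
move=> HF Hx; elim: r => [|i r IH].
  have -> : (fun u => \sum_(i <- [::]) F i u) = (fun u => 0 * (0 : R[i])).
    by apply/funext => u; rewrite big_nil mul0r.
  rewrite (covZr _ _ 0 Hx (inL2_0 leb unitI)) conjc0 mul0r big_nil//.
have -> : (fun u => \sum_(i <- i :: r) F i u) = (fun u => F i u + \sum_(i <- r) F i u).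
  by apply/funext => u; rewrite big_cons.
rewrite covDr//; last exact: (inL2_sum mI).
by rewrite IH big_cons.
Qed.

End process_covariance.

(** * The autocovariance operators *)

Section autocovariance_operators.
Context {R : realType} {d : measure_display} {Om : measurableType d}
  (P : probability Om R).
Local Notation leb := (@lebesgue_measure R).
Local Notation ipH := (ip leb unitI).
Local Notation nrmH := (nrm2 leb unitI).
Local Notation ipP := (ip P setT).
Local Notation nrmP := (nrm2 P setT).
Local Notation mI := (@measurable_unitI R).
Local Notation mT := (@measurableT d Om).
Implicit Types (x y : R -> R[i]) (Z : Om -> R -> R[i]).

Variable X : int -> Om -> R -> R[i].
Hypothesis X2 : forall t, L2_random_element P (X t).

Local Notation sc := (sc X).
Local Notation cov := (cov P X).

Let mX t : cmeasurable ([set: Om] `*` unitI) (fun z => X t z.1 z.2).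
Proof. by case: (X2 t). Qed.
Let X2' t := (L2_random_elementE P (X t)).1 (X2 t).

Definition kernel_op s t x (u : R) : R[i] :=
  cintegral leb unitI (fun v => crosscov P X s t u v * x v).

Let mXP t u : unitI u -> cmeasurable [set: Om] (fun w => X t w u).
Proof. by move=> Iu; exact: (cmeasurable_section2 mT mI Iu (mX t)). Qed.

(** By Tonelli: the integral over [u] of the second moments of the [X_t(u)] is
    finite. *)
Lemma ae_coordinate t :
  {ae leb, forall u, unitI u -> inL2 P setT (fun w => X t w u)}.
Proof.
have [mZ nZ] := X2' t.
pose f (z : Om * measurableTypeR R) := (sqmod (X t z.1 z.2))%:E.
have mf : measurable_fun (setT `*` unitI) f by exact: measurable_sqmodE.
have f0 z : (setT `*` unitI) z -> (0 <= f z)%E by move=> _; rewrite lee_fin sqmod_ge0.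
have ms : measurable_fun unitI (fun u => sqnorm P setT (fun w => X t w u)).
  exact: (measurable_tonelli2 P mT mI mf f0).
have : leb.-integrable unitI (fun u => sqnorm P setT (fun w => X t w u)).
  apply/integrableP; split => //.
  under eq_integral do rewrite gee0_abs ?sqnorm_ge0//.
  by rewrite -(tonelli_swap P leb mT mI mf f0) -(tonelli P leb mT mI mf f0).
move/(integrable_ae mI); apply: filterS => u /= H Iu; split; first exact: mXP.
by rewrite -ge0_fin_numE ?H// sqnorm_ge0.
Qed.

Let mm : measurable ([set: Om] `*` @unitI R : set (Om * measurableTypeR R)).
Proof. exact: (measurableX mT mI). Qed.

(** Fubini at fixed [u], for almost every [u]: the covariance kernel applied to
    [x] is the covariance of [X_s(u)] with the scalar [<X_t, x>]. *)
Lemma kernel_op_ae s t x : inH x ->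
  {ae leb, forall u, unitI u ->
    kernel_op s t x u = ipP (fun w => X s w u) (sc t x)}.
Proof.
move=> Hx; apply: filterS (ae_coordinate s) => u /= Xsu Iu.
have {}Xsu := Xsu Iu; set a := fun w => X s w u.
transitivity (cintegral leb unitI (fun v =>
    cintegral P setT (fun w => (a w * x v) * conjc (X t w v)))).
  apply: ae_eq_cintegral => //.
  - exact: mI.
  - apply: cmeasurableM; last by case: Hx.
    apply: (cmeasurable_cintegral2 P mT mI (f := fun w v => a w * conjc (X t w v))).
    apply: cmeasurableM; first by apply: (cmeasurable_fst unitI mT); case: Xsu.
    by apply: cmeasurableJ.
  - apply: (cmeasurable_cintegral2 P mT mI (f := fun w v => (a w * x v) * conjc (X t w v))).
    apply: cmeasurableM; first by case: (inL2_tensor Xsu Hx).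
    by apply: cmeasurableJ.
  - apply: filterS (ae_coordinate t) => v /= Xtv Iv.
    have {}Xtv := Xtv Iv.
    rewrite /crosscov /expect mulrC -cintegralZ//; last exact: inL2_cintegrable.
    by apply: eq_cintegral => w _; rewrite mulrCA mulrA.
rewrite -(cfubini mT mI (f := fun w v => (a w * x v) * conjc (X t w v))); last first.
  exact: (inL2_cintegrable mm (inL2_tensor Xsu Hx) (X2' t)).
apply: ae_eq_cintegral => //.
- apply: (cmeasurable_cintegral leb mT mI (f := fun w v => (a w * x v) * conjc (X t w v))).
  apply: cmeasurableM; first by case: (inL2_tensor Xsu Hx).
  by apply: cmeasurableJ.
- apply: cmeasurableM; first by case: Xsu.
  by apply: cmeasurableJ; exact: cmeasurable_sc.
- apply: filterS (ae_tame X2 t) => w /= tw _.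
  rewrite scE ipE -cintegralJ; [|exact: mI|]; last first.
    by apply: inL2_cintegrable => //; [exact: mI|exact: tame_inH].
  rewrite -cintegralZ; [|exact: mI|]; last first.
    apply: cintegrableJ; first exact: mI.
    by apply: inL2_cintegrable => //; [exact: mI|exact: tame_inH].
  apply: eq_cintegral => v _; rewrite tw conjcM conjcK; ring.
Qed.

Lemma cmeasurable_kernel_op s t x : inH x -> cmeasurable unitI (kernel_op s t x).
Proof.
move=> Hx.
apply: (cmeasurable_cintegral leb mI mI (f := fun u v => crosscov P X s t u v * x v)).
apply: cmeasurableM; last by apply: (cmeasurable_snd unitI mI); case: Hx.
have mII := measurableX mI mI.
apply: (cmeasurable_cintegral P mII mT
  (f := fun z w => X s w z.1 * conjc (X t w z.2))).
have K (k : int) (pr : measurableTypeR R * measurableTypeR R -> measurableTypeR R) :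
    measurable_fun setT pr -> (forall z, (unitI `*` unitI) z -> unitI (pr z)) ->
    cmeasurable ((unitI `*` unitI) `*` [set: Om]) (fun z => X k z.2 (pr z.1)).
  move=> mpr Ipr; have [mr mi] := mX k.
  have mq : measurable_fun ((unitI `*` unitI) `*` [set: Om])
      (fun z : (measurableTypeR R * measurableTypeR R) * Om => (z.2, pr z.1)).
    apply: measurable_funTS.
    exact: (measurable_fun_pair measurable_snd (measurableT_comp mpr measurable_fst)).
  have sub : (fun z : (measurableTypeR R * measurableTypeR R) * Om => (z.2, pr z.1))
      @` ((unitI `*` unitI) `*` [set: Om]) `<=` [set: Om] `*` unitI.
    by move=> _ [[z w] [/= Iz _] <-]; split => //=; exact: Ipr.
  by split; [exact: (measurable_comp mm sub mr mq)|exact: (measurable_comp mm sub mi mq)].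
apply: cmeasurableM.
  by apply: (K s fst) => // -[u v] [].
apply: cmeasurableJ.
by apply: (K t snd) => // -[u v] [].
Qed.

Lemma kernel_op_inH s t x : inH x -> inH (kernel_op s t x).
Proof.
move=> Hx; split; first exact: cmeasurable_kernel_op.
have [mZ nZ] := X2' s.
pose f (z : Om * measurableTypeR R) := (sqmod (X s z.1 z.2))%:E.
have mf : measurable_fun (setT `*` unitI) f by exact: measurable_sqmodE.
have f0 z : (setT `*` unitI) z -> (0 <= f z)%E by move=> _; rewrite lee_fin sqmod_ge0.
have ms : measurable_fun unitI (fun u => sqnorm P setT (fun w => X s w u)).
  exact: (measurable_tonelli2 P mT mI mf f0).
have nz0 := nrm2_ge0 P setT (sc t x).
apply: (@le_lt_trans _ _ (\int[leb]_(u in unitI)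
    ((nrmP (sc t x))%:E * sqnorm P setT (fun w => X s w u)))%E).
  apply: ae_ge0_le_integral.
  - exact: mI.
  - by move=> u _; rewrite lee_fin sqmod_ge0.
  - by apply: measurable_sqmodE; exact: cmeasurable_kernel_op.
  - by move=> u _; rewrite mule_ge0// sqnorm_ge0.
  - exact: measurable_funeM.
  - apply: filterS2 (ae_coordinate s) (kernel_op_ae s t Hx) => u /= Xu Ku Iu.
    rewrite Ku// -nrm2E; last exact: Xu.
    rewrite -EFinM lee_fin mulrC; apply: cauchy_schwarz => //; first exact: Xu.
    exact: inL2_sc.
rewrite ge0_integralZl//; last 2 first.
- exact: mI.
- by move=> u _; exact: sqnorm_ge0.
rewrite -(tonelli_swap P leb mT mI mf f0) -(tonelli P leb mT mI mf f0).
by rewrite lte_mul_pinfty.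
Qed.

Lemma kernel_op_cov s t x y : inH x -> inH y ->
  ipH (kernel_op s t x) y = cov s t x y.
Proof.
move=> Hx Hy; have Hxi := inL2_sc X2 t Hx.
have Hten : inL2 (P \x leb)%E (setT `*` unitI) (fun z => sc t x z.1 * y z.2).
  exact: inL2_tensor.
have mten : cmeasurable (setT `*` unitI)
    (fun z => X s z.1 z.2 * conjc (sc t x z.1 * y z.2)).
  by apply: cmeasurableM => //; apply: cmeasurableJ; case: Hten.
transitivity (cintegral leb unitI (fun u =>
    cintegral P setT (fun w => X s w u * conjc (sc t x w * y u)))).
  apply: ae_eq_cintegral => //.
  - exact: mI.
  - apply: cmeasurableM; first exact: cmeasurable_kernel_op.
    by apply: cmeasurableJ; case: Hy.
  - exact: (cmeasurable_cintegral2 P mT mI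
      (f := fun w u => X s w u * conjc (sc t x w * y u))).
  - apply: filterS2 (ae_coordinate s) (kernel_op_ae s t Hx) => u /= Xu Ku Iu.
    rewrite Ku// mulrC ipE -cintegralZ//; last exact: (inL2_cintegrable mT (Xu Iu) Hxi).
    by apply: eq_cintegral => w _; rewrite conjcM; ring.
rewrite -(cfubini mT mI (f := fun w u => X s w u * conjc (sc t x w * y u))); last first.
  exact: (inL2_cintegrable mm (X2' s) Hten).
apply: ae_eq_cintegral => //.
- exact: (cmeasurable_cintegral leb mT mI (f := fun w u => X s w u * conjc (sc t x w * y u))).
- by apply: cmeasurableM; [|apply: cmeasurableJ]; exact: cmeasurable_sc.
- apply: filterS (ae_tame X2 s) => w /= tw _.
  rewrite scE mulrC ipE -cintegralZ; [|exact: mI|]; last first.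
    by apply: inL2_cintegrable => //; [exact: mI|exact: tame_inH].
  apply: eq_cintegral => v _; rewrite tw conjcM; ring.
Qed.

End autocovariance_operators.

(** * Symmetric sums, stationarity and the Hilbert-Schmidt bound *)

Section modulus.
Context {R : realType}.
Implicit Types (z : R[i]).

Definition cabs z : R := Num.sqrt (sqmod z).

Lemma cabs_ge0 z : 0 <= cabs z. Proof. exact: sqrtr_ge0. Qed.
Lemma cabsE z : (cabs z)%:C = `|z|. Proof. by rewrite normc_def. Qed.
Lemma cabsM z z' : cabs (z * z') = cabs z * cabs z'.
Proof. by rewrite /cabs sqmodM sqrtrM// sqmod_ge0. Qed.
Lemma cabsD z z' : cabs (z + z') <= cabs z + cabs z'.
Proof. by rewrite -lecR rmorphD /= !cabsE ler_normD. Qed.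
Lemma cabs_sqr z : cabs z ^+ 2 = sqmod z.
Proof. by rewrite sqr_sqrtr// sqmod_ge0. Qed.
Lemma cabs0 : cabs 0 = 0. Proof. by rewrite /cabs sqmod0 sqrtr0. Qed.
Lemma cabs_sum I (r : seq I) (F : I -> R[i]) :
  cabs (\sum_(i <- r) F i) <= \sum_(i <- r) cabs (F i).
Proof.
elim: r => [|i r IH]; first by rewrite !big_nil cabs0.
by rewrite !big_cons; apply: le_trans (cabsD _ _) _; rewrite lerD2l.
Qed.
Lemma Re_le_cabs z : `|complex.Re z| <= cabs z.
Proof. by rewrite -sqrtr_sqr; apply: ler_wsqrtr; exact: Re_sqr_le. Qed.
Lemma Im_le_cabs z : `|complex.Im z| <= cabs z.
Proof. by rewrite -sqrtr_sqr; apply: ler_wsqrtr; exact: Im_sqr_le. Qed.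

End modulus.

Section exponentials.
Context {R : realType}.
Implicit Types (a b : R).

Lemma expiD a b : expi (a + b) = expi a * expi b.
Proof. by apply: eq_ReIm; rewrite !cE /= ?cosD ?sinD//; ring. Qed.
Lemma expi0 : expi (0 : R) = 1.
Proof. by apply: eq_ReIm; rewrite /= ?cos0 ?sin0. Qed.
Lemma conjc_expi a : conjc (expi a) = expi (- a).
Proof. by apply: eq_ReIm; rewrite !cE /= ?cosN ?sinN. Qed.
Lemma sqmod_expi a : sqmod (expi a) = 1.
Proof. by rewrite /sqmod /= cos2Dsin2. Qed.
Lemma cabs_expi a : cabs (expi a) = 1.
Proof. by rewrite /cabs sqmod_expi sqrtr1. Qed.

Lemma cmeasurable_expi (D : set (measurableTypeR R)) (c : R) :
  cmeasurable D (fun th => expi (c * th)).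
Proof.
have mc : measurable_fun D (fun th : measurableTypeR R => c * th).
  by apply: measurable_funM => //; exact: measurable_cst.
split => /=.
- have /continuous_measurable_fun H := @continuous_cos R.
  exact: (measurableT_comp H mc).
- have /continuous_measurable_fun H := @continuous_sin R.
  exact: (measurableT_comp H mc).
Qed.

End exponentials.

Section symmetric_ranges.

Definition irange (N : nat) : seq int := [seq k%:Z - N%:Z | k <- iota 0 (2 * N).+1].

Lemma mem_irange N h : (h \in irange N) = (absz h <= N)%N.
Proof.
apply/mapP/idP => [[k]|hN].
  by rewrite mem_iota => /andP[_ k2] ->; lia.
by exists (absz (h + N%:Z)); [rewrite mem_iota; lia|lia].
Qed.

Lemma irange_uniq N : uniq (irange N).
Proof. by rewrite map_inj_uniq ?iota_uniq// => a b /addIr []. Qed.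

Lemma symsumE {R : realType} (f : int -> R[i]) N :
  symsum f N = \sum_(h <- irange N) f h.
Proof. by rewrite /symsum /irange big_map -(big_mkord xpredT (fun k => f (k%:Z - N%:Z))) /index_iota subn0. Qed.

Lemma irange_split (V : zmodType) (f : int -> V) N M : (N <= M)%N ->
  \sum_(h <- irange M) f h - \sum_(h <- irange N) f h =
  \sum_(h <- [seq h <- irange M | (N < absz h)%N]) f h.
Proof.
move=> NM; have -> : \sum_(h <- irange N) f h =
    \sum_(h <- [seq h <- irange M | (absz h <= N)%N]) f h.
  apply: perm_big; apply: uniq_perm; rewrite ?filter_uniq ?irange_uniq// => h.
  by rewrite mem_filter !mem_irange; lia.
rewrite !big_filter (bigID (fun h : int => (absz h <= N)%N)) /= addrAC subrr add0r.
by apply: eq_bigl => h; rewrite ltnNge.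
Qed.

End symmetric_ranges.

Section stationarity.
Context {R : realType} {d : measure_display} {Om : measurableType d}
  (P : probability Om R).
Local Notation leb := (@lebesgue_measure R).
Local Notation ipH := (ip leb unitI).
Local Notation nrmH := (nrm2 leb unitI).
Local Notation nrmP := (nrm2 P setT).
Local Notation mI := (@measurable_unitI R).
Local Notation mT := (@measurableT d Om).
Implicit Types (x y : R -> R[i]).

Variable X : int -> Om -> R -> R[i].
Hypothesis sX : weakly_stationary P X.

Let X2 t : L2_random_element P (X t). Proof. by case: sX. Qed.

(** Stationarity relates the kernels only almost everywhere on the square; the
    operators they define agree at almost every point, and these carry the
    covariances of scores. *)
Lemma cov_stationary t h x y : inH x -> inH y ->
  cov P X (t + h) t x y = cov P X h 0 x y.
Proof.
move=> Hx Hy.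
rewrite -(kernel_op_cov X2 (t + h) t Hx Hy) -(kernel_op_cov X2 h 0 Hx Hy).
have [_ _ /(_ h t) st] := sX.
have {}st := ae_section (Q := fun u v => unitI u -> unitI v ->
   crosscov P X (t + h) t u v = crosscov P X h 0 u v) st.
have mcs s t' u : unitI u -> cmeasurable unitI (fun v => crosscov P X s t' u v * x v).
  move=> Iu; apply: cmeasurableM; last by case: Hx.
  apply: (cmeasurable_cintegral2 P mT mI (f := fun w v => X s w u * conjc (X t' w v))).
  apply: cmeasurableM.
    apply: (cmeasurable_fst unitI mT (g := fun w => X s w u)).
    by apply: (cmeasurable_section2 mT mI Iu); case: (X2 s).
  by apply: cmeasurableJ; case: (X2 t').
have K : {ae leb, forall u, unitI u ->
    kernel_op P X (t + h) t x u = kernel_op P X h 0 x u}.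
  apply: filterS st => u stu Iu.
  apply: (ae_eq_cintegral mI (mcs _ _ _ Iu) (mcs _ _ _ Iu)).
  by apply: filterS stu => v stv Iv; rewrite stv.
apply: (ae_eq_ip mI _ Hy _ Hy K).
- exact: kernel_op_inH.
- exact: kernel_op_inH.
- by apply: filterE.
Qed.

(** The autocovariance form at lag [h]: [<C_h x, y>]. *)
Definition acov (h : int) x y : R[i] := cov P X h 0 x y.

Lemma acovE h x y : acov h x y = cov P X h 0 x y. Proof. by []. Qed.

Lemma autocov_opE h x y : inH x -> inH y ->
  ipH (autocov_op P X h x) y = acov h x y.
Proof. by move=> Hx Hy; rewrite -[autocov_op _ _ _ _]/(kernel_op P X h 0 x) kernel_op_cov. Qed.

Lemma autocov_op_inH h x : inH x -> inH (autocov_op P X h x).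
Proof. exact: kernel_op_inH. Qed.

Section hilbert_schmidt.
Variable e : nat -> R -> R[i].
Hypothesis eB : orthonormal_basis e.
Hypothesis eS : (\esum_(h in [set: int]) HSnorm e (autocov_op P X h) < +oo)%E.

Let He j : inH (e j). Proof. by case: eB => -[]. Qed.

Lemma HSnorm_ge0 A : (0 <= HSnorm e A)%E.
Proof. by rewrite /HSnorm; case: (\sum_(_ <= _ <oo) _)%E => //= r; rewrite lee_fin sqrtr_ge0. Qed.

Definition hs h : R := fine (HSnorm e (autocov_op P X h)).
Definition hs_total : R := fine (\esum_(h in [set: int]) HSnorm e (autocov_op P X h)).

Lemma hs_ge0 h : 0 <= hs h. Proof. by rewrite fine_ge0// HSnorm_ge0. Qed.
Lemma hs_total_ge0 : 0 <= hs_total.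
Proof. by rewrite fine_ge0// esum_ge0// => h _; exact: HSnorm_ge0. Qed.

Let sum_le (r : seq int) : uniq r ->
  (\sum_(h <- r) HSnorm e (autocov_op P X h) <=
   \esum_(h in [set: int]) HSnorm e (autocov_op P X h))%E.
Proof.
move=> ur; apply: esum_ge; exists [set` r]; first by split => //; exact: finite_seq.
by rewrite fsbig_seq.
Qed.

Lemma hsE h : (hs h)%:E = HSnorm e (autocov_op P X h).
Proof.
rewrite fineK// ge0_fin_numE ?HSnorm_ge0//.
have := @sum_le [:: h] isT; rewrite big_seq1 => H.
exact: le_lt_trans H eS.
Qed.

Lemma sum_hs_le (r : seq int) : uniq r -> \sum_(h <- r) hs h <= hs_total.
Proof.
move=> ur; rewrite -lee_fin /hs_total fineK; last first.
  by rewrite ge0_fin_numE// esum_ge0// => h _; exact: HSnorm_ge0.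
rewrite -sumEFin; under eq_bigr do rewrite hsE.
exact: sum_le.
Qed.

Lemma hs_tail ep : 0 < ep -> exists N, forall M n, (N <= n)%N -> (n <= M)%N ->
  \sum_(h <- [seq h <- irange M | (n < absz h)%N]) hs h <= ep.
Proof.
move=> e0; pose a N := \sum_(h <- irange N) hs h.
have nda : {homo a : n m / (n <= m)%N >-> n <= m}.
  move=> n m nm; rewrite -subr_ge0 irange_split//.
  by apply: sumr_ge0 => h _; exact: hs_ge0.
have : cvgn a.
  apply: nondecreasing_is_cvgn => //; exists hs_total => _ [n _ <-].
  by apply: sum_hs_le; exact: irange_uniq.
move=> /cvg_ex[l al]; have ep2 : 0 < ep / 2 by rewrite divr_gt0.
have /cvgrPdist_le /(_ _ ep2) [N _ NP] := al.
exists N => M n Nn nM; rewrite -irange_split//.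
have := NP n Nn; have := NP M (leq_trans Nn nM); rewrite -/(a M) -/(a n) /=.
by rewrite !ler_distl; lra.
Qed.

Lemma hs_basis_sum h n : \sum_(j < n) nrmH (autocov_op P X h (e j)) <= hs h ^+ 2.
Proof.
rewrite -lee_fin -sumEFin.
under eq_bigr do rewrite (nrm2E (autocov_op_inH h (He _))).
set s := (\sum_(0 <= j <oo) normH2 (autocov_op P X h (e j)))%E.
have s0 : (0 <= s)%E by apply: nneseries_ge0 => j _ _; exact: sqnorm_ge0.
apply: (@le_trans _ _ s).
  rewrite -(big_mkord xpredT (fun j => sqnorm leb unitI (autocov_op P X h (e j)))).
  by apply: nneseries_lim_ge => j _ _; exact: sqnorm_ge0.
have := hsE h; rewrite /HSnorm -/s; case: s s0 => [r|//|//] /= r0 [->].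
by rewrite lee_fin sqr_sqrtr.
Qed.

Let finite_cs n (a b : nat -> R[i]) : sqmod (\sum_(j < n) a j * b j) <=
  (\sum_(j < n) sqmod (a j)) * (\sum_(j < n) sqmod (b j)).
Proof.
have Hs (c : nat -> R[i]) : inH (fun u => \sum_(j < n) c j * e j u).
  by apply: (inL2_sum mI) => j; apply: (inL2Z mI); exact: He.
have -> : \sum_(j < n) sqmod (b j) = \sum_(j < n) sqmod (conjc (b j)).
  by apply: eq_bigr => j _; rewrite sqmodJ.
rewrite -(basis_sum_ord eB n a) -(basis_sum_ord eB n (fun j => conjc (b j))).
have -> : \sum_(j < n) a j * b j = ipH (fun u => \sum_(j < n) a j * e j u)
    (fun u => \sum_(j < n) conjc (b j) * e j u).
  rewrite (ip_sumr mI) => [|j|]; last 2 first.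
  - by apply: (inL2Z mI); exact: He.
  - exact: Hs.
  have ee' (j k : 'I_n) : ipH (e j) (e k) = (j == k)%:R.
    by have [[_ H] _] := eB; rewrite -innerE H.
  apply: eq_bigr => j _; rewrite (ipZr mI _ (He j) (Hs a)) conjcK mulrC; congr (_ * _).
  by rewrite (ip_orthonormal_sum mI (fun j : 'I_n => He j) ee' (index_enum_uniq _)
    (fun j : 'I_n => a j)) ?mem_index_enum.
exact: (cauchy_schwarz mI (Hs a) (Hs (fun j => conjc (b j)))).
Qed.

(** Expanding [x] in the basis bounds the autocovariance form by the
    Hilbert-Schmidt norm. *)
Lemma sqmod_acov_le h x y : inH x -> inH y ->
  sqmod (acov h x y) <= (hs h ^+ 2 * nrmH x) * nrmH y.
Proof.
move=> Hx Hy.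
pose s n u := \sum_(j < n) ipH x (e j) * e j u.
have Hsn n : inH (s n) by apply: (inL2_sum mI) => j; apply: (inL2Z mI); exact: He.
have sx : nrmH (fun u => s n u - x u) @[n --> \oo] --> (0 : R).
  by apply/(L2_cvgP mI) => //; case: eB => _ /(_ x Hx).
have cs : ccvg (fun n => acov h (s n) y) (acov h x y).
  apply: (@ccvg_le _ _ _ (fun n => nrmP (sc X h y) * moment2 P X 0 * nrmH (fun u => s n u - x u))).
    move=> n; rewrite /acov -covBl//.
    have Hd := inL2B mI (Hsn n) Hx.
    apply: le_trans (cauchy_schwarz mT (inL2_sc X2 h Hy) (inL2_sc X2 0 Hd)) _.
    rewrite -mulrA ler_wpM2l ?nrm2_ge0//.
    exact: nrm2_sc_le.
  by have := cvgM (cvg_cst (nrmP (sc X h y) * moment2 P X 0)) sx; rewrite mulr0; apply.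
apply: (cvgr_to_le (sqmod_ccvg cs)); apply: nearW => n.
rewrite /acov cov_suml// => [|j]; last by apply: (inL2Z mI); exact: He.
rewrite (eq_bigr (fun j : 'I_n => ipH x (e j) * acov h (e j) y)); last first.
  by move=> j _; rewrite covZl.
apply: le_trans (finite_cs n (fun j => ipH x (e j)) (fun j => acov h (e j) y)) _.
have ee' (j k : 'I_n) : ipH (e j) (e k) = (j == k)%:R.
  by have [[_ H] _] := eB; rewrite -innerE H.
have A := bessel mI (fun j : 'I_n => He j) ee' (index_enum_uniq _) Hx.
have B : \sum_(j < n) sqmod (acov h (e j) y) <= hs h ^+ 2 * nrmH y.
  apply: (@le_trans _ _ (\sum_(j < n) nrmH (autocov_op P X h (e j)) * nrmH y)).
    apply: ler_sum => j _; rewrite -autocov_opE//.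
    by apply: (cauchy_schwarz mI) => //; exact: autocov_op_inH.
  by rewrite -mulr_suml ler_wpM2r ?nrm2_ge0// hs_basis_sum.
apply: le_trans (ler_pM _ _ A B) _.
- by apply: sumr_ge0 => j _; exact: sqmod_ge0.
- by apply: sumr_ge0 => j _; exact: sqmod_ge0.
- by rewrite mulrCA mulrA.
Qed.

Lemma cabs_acov_le h x y : inH x -> inH y ->
  cabs (acov h x y) <= hs h * (Num.sqrt (nrmH x) * Num.sqrt (nrmH y)).
Proof.
move=> Hx Hy; have := ler_wsqrtr (sqmod_acov_le h Hx Hy).
by rewrite -/(cabs _) -mulrA sqrtrM ?sqr_ge0// sqrtr_sqr ger0_norm ?hs_ge0// sqrtrM ?nrm2_ge0.
Qed.

End hilbert_schmidt.
End stationarity.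

(** * The spectral density operator *)

Section spectral_density.
Context {R : realType} {d : measure_display} {Om : measurableType d}
  (P : probability Om R).
Local Notation leb := (@lebesgue_measure R).
Local Notation ipH := (ip leb unitI).
Local Notation nrmH := (nrm2 leb unitI).
Local Notation mI := (@measurable_unitI R).
Implicit Types (x y : R -> R[i]) (th : R).

Variable X : int -> Om -> R -> R[i].
Hypothesis sX : weakly_stationary P X.
Variable e : nat -> R -> R[i].
Hypothesis eB : orthonormal_basis e.
Hypothesis eS : (\esum_(h in [set: int]) HSnorm e (autocov_op P X h) < +oo)%E.
Variables (lam : nat -> R -> R) (phi : nat -> R -> R -> R[i]).
Hypothesis srep : spectral_representation P X lam phi.

Local Notation acov := (acov P X).
Local Notation hs := (hs P X e).
Local Notation hs_total := (hs_total P X e).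

Definition fsum (r : seq int) th x y : R[i] :=
  \sum_(h <- r) acov h x y * expi (- (h%:~R * th)).

Lemma fsumE r th x y :
  fsum r th x y = \sum_(h <- r) acov h x y * expi (- (h%:~R * th)).
Proof. by []. Qed.

Let opsum (r : seq int) th x u : R[i] :=
  \sum_(h <- r) autocov_op P X h x u * expi (- (h%:~R * th)).

Let opsum_inH r th x : inH x -> inH (opsum r th x).
Proof.
move=> Hx; apply: (inL2_sum mI) => h; under eq_fun do rewrite mulrC.
by apply: (inL2Z mI); exact: autocov_op_inH.
Qed.

Let ip_opsum r th x y : inH x -> inH y -> ipH (opsum r th x) y = fsum r th x y.
Proof.
move=> Hx Hy; have HA h := autocov_op_inH sX h Hx.
have -> : opsum r th x = fun u => \sum_(h <- r) expi (- (h%:~R * th)) * autocov_op P X h x u.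
  by apply/funext => u; apply: eq_bigr => h _; rewrite mulrC.
rewrite (ip_suml mI) => [|h|//]; last by apply: (inL2Z mI); exact: HA.
apply: eq_bigr => h _; rewrite (ipZl mI _ (HA h) Hy) mulrC; congr (_ * _).
exact: autocov_opE.
Qed.

Lemma cabs_fsum_le r th x y : inH x -> inH y ->
  cabs (fsum r th x y) <=
  (\sum_(h <- r) hs h) * (Num.sqrt (nrmH x) * Num.sqrt (nrmH y)).
Proof.
move=> Hx Hy; apply: le_trans (cabs_sum _ _) _; rewrite mulr_suml.
apply: ler_sum => h _; rewrite cabsM cabs_expi mulr1.
exact: (cabs_acov_le sX eB eS h Hx Hy).
Qed.

(* The form bound tested on the image of [x] itself. *)
Let nrm_opsum_le r th x : inH x ->
  nrmH (opsum r th x) <= (\sum_(h <- r) hs h) ^+ 2 * nrmH x.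
Proof.
move=> Hx; set v := opsum r th x; have Hv : inH v by exact: opsum_inH.
have A0 : 0 <= \sum_(h <- r) hs h by apply: sumr_ge0 => h _; exact: hs_ge0.
have := cabs_fsum_le r th Hx Hv; rewrite -ip_opsum// -/v.
rewrite (ipxx Hv) /cabs sqmodC sqrtr_sqr ger0_norm ?nrm2_ge0// => H.
set a := Num.sqrt (nrmH x) in H; set b := Num.sqrt (nrmH v) in H.
have b0 : 0 <= b by exact: sqrtr_ge0.
have a0 : 0 <= a by exact: sqrtr_ge0.
have bE : nrmH v = b ^+ 2 by rewrite sqr_sqrtr// nrm2_ge0.
have aE : nrmH x = a ^+ 2 by rewrite sqr_sqrtr// nrm2_ge0.
rewrite bE aE -exprMn ler_sqr ?nnegrE ?mulr_ge0//.
rewrite bE in H; have [b0'|bp] := eqVneq b 0; first by rewrite b0' mulr_ge0.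
by rewrite -(@ler_pM2r _ b) ?lt_def ?bp// -mulrA -expr2.
Qed.

Let partial N th x u : R[i] := ((2 * pi)^-1)%:C *
    symsum (fun h => autocov_op P X h x u * expi (- (h%:~R * th))) N.

Let partialE N th x : partial N th x = fun u => ((2 * pi)^-1)%:C * opsum (irange N) th x u.
Proof. by apply/funext => u; rewrite /partial symsumE. Qed.

Let partial_inH N th x : inH x -> inH (partial N th x).
Proof. by move=> Hx; rewrite partialE; apply: (inL2Z mI); exact: opsum_inH. Qed.

Let partial_diff n m th x : inH x -> (n <= m)%N ->
  nrmH (fun u => partial m th x u - partial n th x u) <=
  (2 * pi)^-1 ^+ 2 *
  ((\sum_(h <- [seq h <- irange m | (n < absz h)%N]) hs h) ^+ 2 * nrmH x).
Proof.
move=> Hx nm; rewrite !partialE.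
have -> : (fun u => (2 * pi)^-1%:C * opsum (irange m) th x u -
    (2 * pi)^-1%:C * opsum (irange n) th x u) = (fun u => (2 * pi)^-1%:C *
    opsum [seq h <- irange m | (n < absz h)%N] th x u).
  by apply/funext => u; rewrite -mulrBr /opsum irange_split.
rewrite (nrm2Z mI); last exact: opsum_inH.
by rewrite sqmodC ler_wpM2l ?sqr_ge0// nrm_opsum_le.
Qed.

(* The tails of the spectral series are bounded by the tails of the sum of the
   Hilbert-Schmidt norms. *)
Let spectral_cvg th x : inH x ->
  L2_cvg leb unitI (fun N => partial N th x) (spectral_density_op P X th x).
Proof.
move=> Hx; rewrite /spectral_density_op /L2_lim.
apply: (@xgetPex _ _ [set l | L2_cvg leb unitI (fun N => partial N th x) l]).
apply: (L2_complete mI) => [n|ep e0]; first exact: partial_inH.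
set c := (2 * pi)^-1 ^+ 2 : R; have c0 : 0 <= c by exact: sqr_ge0.
have x0 := nrm2_ge0 leb unitI x.
have q0 : 0 < c * nrmH x + 1 by rewrite ltr_wpDl// mulr_ge0.
have t0 : 0 < Num.sqrt (ep / (c * nrmH x + 1)) by rewrite sqrtr_gt0 divr_gt0.
have [N NP] := hs_tail eS t0; exists N.
have key m n : (N <= n)%N -> (n <= m)%N ->
    nrmH (fun u => partial m th x u - partial n th x u) <= ep.
  move=> Nn nm; apply: le_trans (partial_diff th Hx nm) _; rewrite -/c.
  have s0 : 0 <= \sum_(h <- [seq h <- irange m | (n < `|h|)%N]) hs h.
    by apply: sumr_ge0 => h _; exact: hs_ge0.
  have := NP m n Nn nm; rewrite -ler_sqr ?nnegrE ?sqrtr_ge0// sqr_sqrtr; last first.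
    by rewrite divr_ge0// ltW.
  move=> H; apply: (@le_trans _ _ (c * (ep / (c * nrmH x + 1) * nrmH x))).
    by rewrite ler_wpM2l// ler_wpM2r.
  have -> : c * (ep / (c * nrmH x + 1) * nrmH x) = ep * (c * nrmH x) / (c * nrmH x + 1).
    by ring.
  by rewrite ler_pdivrMr// ler_wpM2l ?lerDl// ltW.
move=> m n Nm Nn; case: (leqP n m) => [nm|/ltnW mn]; first exact: key.
by rewrite nrm2BC; exact: key.
Qed.

Lemma spectral_density_inH th x : inH x -> inH (spectral_density_op P X th x).
Proof. by move=> /(spectral_cvg th) []. Qed.

(** The form [<F x, y>] of the spectral density operator. *)
Definition sform th x y : R[i] := ipH (spectral_density_op P X th x) y.

Lemma fsum_cvg th x y : inH x -> inH y ->
  ccvg (fun N => fsum (irange N) th x y) ((2 * pi)%:C * sform th x y).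
Proof.
move=> Hx Hy.
have := ccvgZ (2 * pi)%:C (L2_cvg_ip mI (fun N => partial_inH N th Hx) (spectral_cvg th Hx) Hy).
congr ccvg; apply/funext => N; rewrite partialE (ipZl mI)//; last exact: opsum_inH.
rewrite ip_opsum// mulrA -rmorphM /= divff ?mul1r//.
by rewrite mulf_neq0// gt_eqF// pi_gt0.
Qed.

Let Hphi th m : freqI th -> inH (phi m th).
Proof. by move=> /srep[_ _ [H _] _]; exact: H. Qed.

Lemma sform_eigen th x y : freqI th -> inH x -> inH y ->
  ccvg (fun n => \sum_(m < n) (lam m th)%:C * (ipH x (phi m th) * ipH (phi m th) y))
    (sform th x y).
Proof.
move=> Fth Hx Hy; have [_ _ _ /(_ x Hx) H] := srep Fth.
have Hs n : inH (fun u => \sum_(m < n) (lam m th)%:C * inner x (phi m th) * phi m th u).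
  by apply: (inL2_sum mI) => m; apply: (inL2Z mI); exact: Hphi.
have := L2_cvg_ip mI Hs H Hy.
congr ccvg; apply/funext => n; rewrite (ip_suml mI) => [|m|//]; last first.
  by apply: (inL2Z mI); exact: Hphi.
apply: eq_bigr => m _; rewrite (ipZl mI)// ?innerE ?mulrA//; exact: Hphi.
Qed.

Lemma lam_ge0 m th : freqI th -> 0 <= lam m th.
Proof. by move=> /srep[]. Qed.

Lemma lam_anti m n th : freqI th -> (m <= n)%N -> lam n th <= lam m th.
Proof.
move=> /srep[_ H _ _]; elim: n => [|n IH]; first by rewrite leqn0 => /eqP ->.
rewrite leq_eqVlt => /predU1P[->//|]; rewrite ltnS => /IH.
exact: le_trans.
Qed.

Lemma phi_orthonormal th j k : freqI th -> ipH (phi j th) (phi k th) = (j == k)%:R.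
Proof. by move=> /srep[_ _ [_ H] _]; rewrite -innerE H. Qed.

Lemma nrm_phi th m : freqI th -> nrmH (phi m th) = 1.
Proof.
move=> Fth; have := phi_orthonormal m m Fth; rewrite eqxx ipxx; last exact: Hphi.
by move/(congr1 (@complex.Re R)).
Qed.

(** The spectral density of the scalar process [<X_t, x>]. *)
Definition sdens th x : \bar R :=
  (\sum_(0 <= m <oo) (lam m th * sqmod (ipH x (phi m th)))%:E)%E.

Lemma sdens_seriesE th x : sdens th x =
  (\sum_(0 <= m <oo) (lam m th * sqmod (ipH x (phi m th)))%:E)%E.
Proof. by []. Qed.

Lemma sdens_ge0 th x : freqI th -> (0 <= sdens th x)%E.
Proof.
by move=> Fth; apply: nneseries_ge0 => m _ _; rewrite lee_fin mulr_ge0 ?sqmod_ge0 ?lam_ge0.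
Qed.

(** The scalar spectral density is the quadratic form of the spectral density
    operator. *)
Lemma sdensE th x : freqI th -> inH x -> sdens th x = (complex.Re (sform th x x))%:E.
Proof.
move=> Fth Hx; apply/cvg_lim => //.
rewrite (_ : (fun n => _) = (fun n => (complex.Re (\sum_(m < n) (lam m th)%:C *
   (ipH x (phi m th) * ipH (phi m th) x)))%:E)).
  by apply: cvg_EFin; [exact: nearW|case: (sform_eigen Fth Hx Hx)].
apply/funext => n; rewrite sumEFin big_mkord Re_sum; congr EFin; apply: eq_bigr => m _.
rewrite (ipC mI Hx (Hphi m Fth)) mulc_conjc -rmorphM //=.
Qed.

Lemma sform_le th x : freqI th -> inH x ->
  complex.Re (sform th x x) <= (hs_total / (2 * pi)) * nrmH x.
Proof.
move=> Fth Hx; have p0 : 0 < 2 * pi :> R by rewrite mulr_gt0// pi_gt0.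
have [H _] := fsum_cvg th Hx Hx.
rewrite mulrAC ler_pdivlMr// mulrC.
have -> : 2 * pi * complex.Re (sform th x x) = complex.Re ((2 * pi)%:C * sform th x x).
  by rewrite !cE mul0r subr0.
apply: (cvgr_to_le H); apply: nearW => N.
apply: le_trans (ler_norm _) _; apply: le_trans (Re_le_cabs _) _.
apply: le_trans (cabs_fsum_le _ _ Hx Hx) _.
rewrite -expr2 sqr_sqrtr ?nrm2_ge0// ler_wpM2r ?nrm2_ge0//.
exact: sum_hs_le (irange_uniq N).
Qed.

Lemma sdens_le th x : freqI th -> inH x ->
  (sdens th x <= ((hs_total / (2 * pi)) * nrmH x)%:E)%E.
Proof. by move=> Fth Hx; rewrite sdensE// lee_fin sform_le. Qed.

Lemma lam_le m th : freqI th -> lam m th <= hs_total / (2 * pi).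
Proof.
move=> Fth; have := sdens_le Fth (Hphi m Fth); rewrite nrm_phi// mulr1.
rewrite -lee_fin; apply: le_trans; apply: le_trans (nneseries_lim_ge m.+1 _) => /=.
  rewrite big_nat_recr//= phi_orthonormal// eqxx sqmod1 mulr1 leeDr//.
  by apply: sume_ge0 => j _; rewrite lee_fin mulr_ge0 ?sqmod_ge0 ?lam_ge0.
by move=> j _ _; rewrite lee_fin mulr_ge0 ?sqmod_ge0 ?lam_ge0.
Qed.

End spectral_density.

(** * Integrals of exponentials over a period *)

Section exponential_integrals.
Context {R : realType}.
Local Notation leb := (@lebesgue_measure R).
Local Notation mF := (@measurable_freqI R).

Lemma twopi_gt0 : 0 < 2 * pi :> R. Proof. by rewrite mulr_gt0// pi_gt0. Qed.

Lemma leb_freqI : leb freqI = (2 * pi)%:E.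
Proof.
rewrite /freqI lebesgue_measure_itv /= lte_fin.
rewrite gtrN ?pi_gt0//; congr EFin; rewrite opprK; lra.
Qed.

Lemma integrable_cst_freqI (k : R) : leb.-integrable freqI (EFin \o cst k).
Proof.
apply: measurable_bounded_integrable.
- exact: mF.
- by rewrite [X in (X < _)%E]leb_freqI ltry.
- exact: measurable_cst.
- by exists `|k|; split; [exact: num_real|move=> M kM x _ /=; exact: ltW].
Qed.

Lemma bounded_inL2 (f : R -> R[i]) (M : R) : cmeasurable freqI f ->
  (forall th, freqI th -> sqmod (f th) <= M) -> inL2 leb freqI f.
Proof.
move=> mf fM; split => //.
apply: (@le_lt_trans _ _ (\int[leb]_(th in freqI) (cst M%:E th))%E).
  have N0 th : freqI th -> (0 <= (sqmod (f th))%:E)%E by rewrite lee_fin sqmod_ge0.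
  have L th : freqI th -> ((sqmod (f th))%:E <= cst M%:E th)%E.
    by move=> Fth; rewrite lee_fin fM.
  apply: ge0_le_integral.
  - exact: mF.
  - exact: N0.
  - exact: measurable_sqmodE.
  - exact: measurable_cst.
  - exact: L.
rewrite integral_cst; last exact: mF.
by rewrite [X in (_ * X)%E]leb_freqI -EFinM ltry.
Qed.

Lemma inL2_cst (c : R[i]) : inL2 leb freqI (fun=> c).
Proof. by apply: (@bounded_inL2 _ (sqmod c)) => //; exact: cmeasurable_cst. Qed.

Lemma inL2_cintegrable_freqI (f : R -> R[i]) : inL2 leb freqI f ->
  cintegrable leb freqI f.
Proof.
move=> Hf; have := inL2_cintegrable mF Hf (inL2_cst 1).
by congr cintegrable; apply/funext => th; rewrite conjc1 mulr1.
Qed.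

Lemma inL2_expi (n : int) : inL2 leb freqI (fun th => expi (n%:~R * th)).
Proof.
by apply: (@bounded_inL2 _ 1) => [|th _]; [exact: cmeasurable_expi|rewrite sqmod_expi].
Qed.

Lemma sin_int_pi (n : int) : sin (n%:~R * pi) = 0 :> R.
Proof.
have H (m : nat) : sin (m%:R * pi) = 0 :> R.
  elim: m => [|m IH]; first by rewrite mul0r sin0.
  by rewrite -natr1 mulrDl mul1r sinDpi IH oppr0.
case: n => m; first exact: H.
by rewrite NegzE mulrNz mulNr sinN H oppr0.
Qed.

Let derivM (c x : R) : is_derive x 1 (fun th => c * th) c.
Proof.
have := @is_deriveZ _ _ _ (@id R) c x 1 1 (is_derive_id _ _).
by rewrite /GRing.scale /= mulr1.
Qed.

Let integral_deriv (F f : R -> R) : (forall x : R, is_derive x 1 F (f x)) ->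
  continuous f -> \int[leb]_(th in freqI) f th = F pi - F (- pi).
Proof.
move=> dF cf; rewrite /Rintegral /freqI.
have p0 : - pi < pi :> R by rewrite gtrN ?pi_gt0.
have cF : continuous F.
  by move=> x; apply: differentiable_continuous; apply/derivable1_diffP; case: (dF x).
rewrite (@continuous_FTC2 _ f F)//.
- exact: continuous_subspaceT.
- split.
  + by move=> x _; case: (dF x).
  + by apply: cvg_at_right_filter; exact: cF.
  + by apply: cvg_at_left_filter; exact: cF.
- by move=> x _; rewrite derive1E; apply: derive_val.
Qed.

Lemma integral_expi (n : int) : cintegral leb freqI (fun th => expi (n%:~R * th)) =
  if n == 0 then (2 * pi)%:C else 0.
Proof.
case: eqVneq => [->|n0].
  rewrite (_ : (fun th => _) = (fun=> 1)); last first.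
    by apply/funext => th; rewrite mul0r expi0.
  apply: eq_ReIm; rewrite ?Re_cintegral ?Im_cintegral /=.
    rewrite (Rintegral_cst leb mF) mul1r.
    by rewrite [X in fine X]leb_freqI.
  by rewrite (Rintegral_cst leb mF) mul0r.
set c : R := n%:~R; have c0 : c != 0 by rewrite intr_eq0.
have dc (x : R) : is_derive x 1 (fun th => c^-1 * sin (c * th)) (cos (c * x)).
  have H := @is_derive1_comp _ (@sin R) (fun th => c * th) x _ _ (is_derive_sin _) (derivM c x).
  have := @is_deriveZ _ _ _ _ c^-1 x 1 _ H.
  have -> : c^-1 *: (cos (c * x) * c) = cos (c * x).
    by rewrite /GRing.scale /= [X in _ * X]mulrC mulKf.
  by apply.
have ds (x : R) : is_derive x 1 (fun th => - c^-1 * cos (c * th)) (sin (c * x)).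
  have H := @is_derive1_comp _ (@cos R) (fun th => c * th) x _ _ (is_derive_cos _) (derivM c x).
  have := @is_deriveZ _ _ _ _ (- c^-1) x 1 _ H.
  have -> : - c^-1 *: (- sin (c * x) * c) = sin (c * x).
    by rewrite /GRing.scale /= !mulNr mulrN opprK [X in _ * X]mulrC mulKf.
  by apply.
have cc : continuous (fun th : R => c * th).
  by move=> x; apply: cvgM; [exact: cvg_cst|exact: cvg_id].
apply: eq_ReIm; rewrite ?Re_cintegral ?Im_cintegral /=.
- rewrite (integral_deriv dc); first by rewrite mulrN sinN sin_int_pi oppr0 mulr0 subrr.
  by move=> x; apply: continuous_comp; [exact: cc|exact: continuous_cos].
- rewrite (integral_deriv ds); first by rewrite mulrN cosN subrr.
  by move=> x; apply: continuous_comp; [exact: cc|exact: continuous_sin].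
Qed.

Lemma ip_expi (n m : int) :
  ip leb freqI (fun th => expi (n%:~R * th)) (fun th => expi (m%:~R * th)) =
  if n == m then (2 * pi)%:C else 0.
Proof.
rewrite ipE -(subr_eq0 n m) -integral_expi; apply: eq_cintegral => th _.
by rewrite conjc_expi -expiD rmorphB /= mulrBl.
Qed.

End exponential_integrals.

(** * The spectral isometry *)

Lemma ccvg_near_eq {R : realType} (u : nat -> R[i]) (l : R[i]) N0 :
  (forall N, (N0 <= N)%N -> u N = l) -> ccvg u l.
Proof.
by move=> ul; split; apply: cvg_near_cst; exists N0 => // N /= /ul ->.
Qed.

Lemma sum_irange_pick {R : realType} (F : int -> R[i]) (c : R[i]) a N :
  (absz a <= N)%N ->
  \sum_(h <- irange N) F h * (if a - h == 0 then c else 0) = F a * c.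
Proof.
rewrite -mem_irange => aN; rewrite (bigD1_seq _ aN (irange_uniq N)) /= subrr eqxx.
rewrite big1 ?addr0// => h ha.
by rewrite subr_eq0 eq_sym (negbTE ha) mulr0.
Qed.

Section isometry.
Context {R : realType} {d : measure_display} {Om : measurableType d}
  (P : probability Om R).
Local Notation leb := (@lebesgue_measure R).
Local Notation ipH := (ip leb unitI).
Local Notation nrmH := (nrm2 leb unitI).
Local Notation mI := (@measurable_unitI R).
Local Notation mF := (@measurable_freqI R).
Local Notation mT := (@measurableT d Om).

Variable X : int -> Om -> R -> R[i].
Hypothesis sX : weakly_stationary P X.
Variable e : nat -> R -> R[i].
Hypothesis eB : orthonormal_basis e.
Hypothesis eS : (\esum_(h in [set: int]) HSnorm e (autocov_op P X h) < +oo)%E.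
Variables (lam : nat -> R -> R) (phi : nat -> R -> R -> R[i]).
Hypothesis srep : spectral_representation P X lam phi.

Local Notation acov := (acov P X).
Local Notation hs_total := (hs_total P X e).
Local Notation fsum := (fsum P X).
Local Notation sform := (sform P X).
Local Notation sdens := (sdens lam phi).

Let X2 t : L2_random_element P (X t). Proof. by case: sX. Qed.

(** A trigonometric polynomial with coefficients in [H]. *)
Definition trigpoly I (r : seq I) (k : I -> int) (x : I -> R -> R[i]) th u : R[i] :=
  \sum_(i <- r) expi ((k i)%:~R * th) * x i u.

Variables (I : Type) (r : seq I) (k : I -> int) (x : I -> R -> R[i]).
Hypothesis Hx : forall i, inH (x i).

Let b := trigpoly r k x.

Lemma trigpoly_inH th : inH (b th).
Proof. by apply: (inL2_sum mI) => i; exact: (inL2Z mI _ (Hx _)). Qed.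

Let fsum_b N th : fsum (irange N) th (b th) (b th) =
  \sum_(j <- r) \sum_(i <- r) \sum_(h <- irange N)
    acov h (x j) (x i) * expi ((k j - k i - h)%:~R * th).
Proof.
rewrite fsumE.
have Hz i : inH (fun u => expi ((k i)%:~R * th) * x i u) by exact: (inL2Z mI _ (Hx _)).
transitivity (\sum_(h <- irange N) \sum_(j <- r) \sum_(i <- r)
    acov h (x j) (x i) * expi ((k j - k i - h)%:~R * th)); last first.
  by rewrite exchange_big; apply: eq_bigr => j _; rewrite exchange_big.
apply: eq_bigr => h _.
rewrite acovE /b /trigpoly (cov_suml X2)//; last exact: trigpoly_inH.
rewrite mulr_suml; apply: eq_bigr => j _.
rewrite (cov_sumr X2)// mulr_suml; apply: eq_bigr => i _.
rewrite (covZl X2 _ _ _ (Hx j) (Hz i)) (covZr X2 _ _ _ (Hx j) (Hx i)) conjc_expi.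
rewrite [X in X * _]mulrA [X in X * _]mulrC -!mulrA -!expiD.
by congr (_ * expi _); rewrite !rmorphB /=; ring.
Qed.

Let Rint_re (f : R -> R[i]) :
  \int[leb]_(th in freqI) complex.Re (f th) = complex.Re (cintegral leb freqI f).
Proof. by []. Qed.

Let cint_term h j i :
  cintegrable leb freqI (fun th => acov h (x j) (x i) * expi ((k j - k i - h)%:~R * th)).
Proof. by apply: (cintegrableZ mF); apply: inL2_cintegrable_freqI; exact: inL2_expi. Qed.

Let cint_fsum N : cintegrable leb freqI (fun th => fsum (irange N) th (b th) (b th)).
Proof.
under eq_fun do rewrite fsum_b.
by do 3 (apply: (cintegrable_sum mF) => ?); exact: cint_term.
Qed.

Let integral_fsum N :
  cintegral leb freqI (fun th => fsum (irange N) th (b th) (b th)) =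
  \sum_(j <- r) \sum_(i <- r) \sum_(h <- irange N)
    acov h (x j) (x i) * (if k j - k i - h == 0 then (2 * pi)%:C else 0).
Proof.
under eq_fun do rewrite fsum_b.
rewrite (cintegral_sum mF) => [|j]; last first.
  by do 2 (apply: (cintegrable_sum mF) => ?); exact: cint_term.
apply: eq_bigr => j _; rewrite (cintegral_sum mF) => [|i]; last first.
  by apply: (cintegrable_sum mF) => ?; exact: cint_term.
apply: eq_bigr => i _; rewrite (cintegral_sum mF) => [|h]; last exact: cint_term.
apply: eq_bigr => h _; rewrite (cintegralZ mF) ?integral_expi//.
by apply: inL2_cintegrable_freqI; exact: inL2_expi.
Qed.

Let integral_fsum_cvg :
  ccvg (fun N => cintegral leb freqI (fun th => fsum (irange N) th (b th) (b th)))
  ((2 * pi)%:C * \sum_(j <- r) \sum_(i <- r) acov (k j - k i) (x j) (x i)).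
Proof.
under eq_fun do rewrite integral_fsum.
rewrite mulr_sumr; apply: ccvg_sum => j; rewrite mulr_sumr; apply: ccvg_sum => i.
apply: (@ccvg_near_eq _ _ _ (absz (k j - k i))) => N kN.
by rewrite (sum_irange_pick (fun h => acov h (x j) (x i)) _ kN) mulrC.
Qed.

Lemma nrm2_score_sum t :
  nrm2 P setT (fun w => \sum_(i <- r) sc X (t - k i) (x i) w) =
  complex.Re (\sum_(j <- r) \sum_(i <- r) acov (k j - k i) (x j) (x i)).
Proof.
have Hs i : inL2 P setT (sc X (t - k i) (x i)) by exact: inL2_sc.
have E h : inL2 P setT h -> nrm2 P setT h = complex.Re (ip P setT h h).
  by move=> /ipxx ->.
rewrite E; last exact: (inL2_sum mT).
congr complex.Re; rewrite (ip_sumr mT)//; last exact: (inL2_sum mT).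
apply: eq_bigr => j _; rewrite (ip_suml mT r Hs (Hs j)).
apply: eq_bigr => i _.
rewrite acovE -(cov_stationary sX (t - k j) (k j - k i) (Hx j) (Hx i)).
by rewrite (_ : t - k j + (k j - k i) = t - k i)//; ring.
Qed.

Let bound : R := hs_total * ((size r)%:R * \sum_(i <- r) nrmH (x i)).

Let fsum_bound N th : freqI th ->
  `|complex.Re (fsum (irange N) th (b th) (b th))| <= bound.
Proof.
move=> Fth; apply: le_trans (Re_le_cabs _) _.
have Hb := trigpoly_inH th.
apply: le_trans (cabs_fsum_le sX eB eS _ _ Hb Hb) _.
rewrite -expr2 sqr_sqrtr ?nrm2_ge0//.
apply: ler_pM; [|exact: nrm2_ge0| |].
- by apply: sumr_ge0 => h _; exact: hs_ge0.
- exact: (sum_hs_le eS (irange_uniq N)).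
- apply: le_trans (nrm2_sum_le mI _ _) _; first by move=> i; exact: (inL2Z mI _ (Hx _)).
  rewrite ler_wpM2l// ler_sum// => i _.
  by rewrite (nrm2Z mI _ (Hx i)) sqmod_expi mul1r.
Qed.

Lemma measurable_sform_trigpoly :
  measurable_fun freqI (fun th => complex.Re (sform th (b th) (b th))).
Proof.
apply: (@measurable_fun_cvg _ _ _ _
  (fun N th => (2 * pi)^-1 * complex.Re (fsum (irange N) th (b th) (b th)))) => [N|th Fth].
  apply: measurable_funM; first exact: measurable_cst.
  by case: (cintegrable_measurable (cint_fsum N)).
have Hb := trigpoly_inH th.
have [H _] := fsum_cvg sX eB eS th Hb Hb.
have := cvgM (cvg_cst ((2 * pi)^-1 : R)) H.
rewrite ReMc ReC ImC mul0r subr0 mulKf; first by apply.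
by rewrite gt_eqF// twopi_gt0.
Qed.

Lemma measurable_sdens_trigpoly :
  measurable_fun freqI (fun th => sdens th (b th)).
Proof.
apply: (eq_measurable_fun (fun th => (complex.Re (sform th (b th) (b th)))%:E)).
  by move=> th; rewrite inE => Fth; rewrite (sdensE srep Fth (trigpoly_inH th)).
by apply/measurable_EFinP; exact: measurable_sform_trigpoly.
Qed.

(** Kolmogorov's isometry for trigonometric polynomials: both sides are the
    double sum of autocovariances, on the left by stationarity, on the right
    because the exponentials are orthogonal over a period. *)
Lemma spectral_isometry t :
  sqnorm P setT (fun w => \sum_(i <- r) sc X (t - k i) (x i) w) =
  (\int[leb]_(th in freqI) sdens th (b th))%E.
Proof.
rewrite -nrm2E; last by apply: (inL2_sum mT) => i; exact: inL2_sc.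
rewrite nrm2_score_sum; set S := \sum_(j <- r) _.
pose f_ N th := (complex.Re (fsum (irange N) th (b th) (b th)))%:E.
pose f th := ((2 * pi) * complex.Re (sform th (b th) (b th)))%:E.
have mf_ N : measurable_fun freqI (f_ N).
  by apply/measurable_EFinP; case: (cintegrable_measurable (cint_fsum N)).
have mf : measurable_fun freqI f.
  apply/measurable_EFinP; apply: measurable_funM; first exact: measurable_cst.
  exact: measurable_sform_trigpoly.
have ff : {ae leb, forall th, freqI th -> f_ N th @[N --> \oo] --> f th}.
  apply: aeW => th Fth; apply: cvg_EFin; first exact: nearW.
  have Hb := trigpoly_inH th.
  have [H _] := fsum_cvg sX eB eS th Hb Hb.
  by move: H; rewrite ReMc ReC ImC mul0r subr0.
have fg : {ae leb, forall th N, freqI th -> (`|f_ N th| <= (EFin \o cst bound) th)%E}.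
  by apply: aeW => th N Fth; rewrite /f_ /= lee_fin fsum_bound.
have [_ _ cvI] := dominated_convergence mF mf_ mf ff (integrable_cst_freqI bound) fg.
have E : (\int[leb]_(th in freqI) f th = ((2 * pi) * complex.Re S)%:E)%E.
  apply: (cvg_unique _ cvI) => //=.
  rewrite (_ : (fun N => _) = (fun N => (complex.Re (cintegral leb freqI
     (fun th => fsum (irange N) th (b th) (b th))))%:E)).
    apply: cvg_EFin; first exact: nearW.
    have [H _] := integral_fsum_cvg.
    by move: H; rewrite ReMc ReC ImC mul0r subr0.
  apply/funext => N; rewrite -Rint_re /Rintegral fineK//.
  by apply: integrable_fin_num => //; [exact: mF|case: (cint_fsum N)].
have -> : (complex.Re S)%:E = ((2 * pi)^-1%:E * \int[leb]_(th in freqI) f th)%E.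
  by rewrite E -EFinM mulKf// gt_eqF// twopi_gt0.
have f0 th : freqI th -> (0 <= f th)%E.
  move=> Fth; rewrite /f EFinM mule_ge0//; first by rewrite lee_fin ltW// twopi_gt0.
  by rewrite -(sdensE srep Fth (trigpoly_inH th)) (sdens_ge0 srep).
rewrite -ge0_integralZl//; [|exact: mF|by rewrite lee_fin invr_ge0 ltW// twopi_gt0].
apply: eq_integral => th; rewrite inE => Fth.
rewrite (sdensE srep Fth (trigpoly_inH th)) /f -EFinM mulKf//.
by rewrite gt_eqF// twopi_gt0.
Qed.

End isometry.

(** * The error of a finite filter *)

Section finite_filters.
Context {R : realType} {d : measure_display} {Om : measurableType d}
  (P : probability Om R).
Local Notation leb := (@lebesgue_measure R).
Local Notation ipH := (ip leb unitI).
Local Notation nrmH := (nrm2 leb unitI).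
Local Notation mI := (@measurable_unitI R).
Local Notation mF := (@measurable_freqI R).
Local Notation mT := (@measurableT d Om).

Variable X : int -> Om -> R -> R[i].
Hypothesis sX : weakly_stationary P X.
Variable e : nat -> R -> R[i].
Hypothesis eB : orthonormal_basis e.
Hypothesis eS : (\esum_(h in [set: int]) HSnorm e (autocov_op P X h) < +oo)%E.
Variables (lam : nat -> R -> R) (phi : nat -> R -> R -> R[i]).
Hypothesis srep : spectral_representation P X lam phi.

Local Notation sform := (sform P X).
Local Notation sdens := (sdens lam phi).

Let X2 t : L2_random_element P (X t). Proof. by case: sX. Qed.
Let He j : inH (e j). Proof. by case: eB => -[]. Qed.
Let Hphi th m : freqI th -> inH (phi m th).
Proof. by move=> /srep[_ _ [H _] _]; exact: H. Qed.

Lemma cmeasurable_sform x y : inH x -> inH y ->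
  cmeasurable freqI (fun th => sform th x y).
Proof.
move=> Hx Hy; apply: (@cmeasurable_ccvg _ _ _ _
  (fun N th => ((2 * pi)^-1)%:C * fsum P X (irange N) th x y)) => [N|th Fth].
  apply: cmeasurableZ; apply: cmeasurable_sum => h; apply: cmeasurableZ.
  under eq_fun do rewrite -mulNr -mulrNz; exact: cmeasurable_expi.
have := ccvgZ ((2 * pi)^-1)%:C (fsum_cvg sX eB eS th Hx Hy).
rewrite mulrA -rmorphM /= mulVf ?mul1r//.
by rewrite gt_eqF// twopi_gt0.
Qed.

Lemma cmeasurable_ip_joint2 f g : jointly_measurable f -> jointly_measurable g ->
  cmeasurable freqI (fun th => ipH (f th) (g th)).
Proof.
move=> mf mg; under eq_fun do rewrite ipE.
apply: (cmeasurable_cintegral2 leb mI mF (f := fun u th => f th u * conjc (g th u))).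
by apply: cmeasurableM => //; exact: cmeasurableJ.
Qed.

Lemma cmeasurable_ip_joint f x : jointly_measurable f -> inH x ->
  cmeasurable freqI (fun th => ipH (f th) x).
Proof.
move=> mf [mx _]; apply: (cmeasurable_ip_joint2 (g := fun=> x)) => //.
exact: (cmeasurable_fst freqI mI mx).
Qed.

Hypothesis mphi : forall m, jointly_measurable (phi m).

Let sform_phi th x m : freqI th -> inH x ->
  sform th x (phi m th) = (lam m th)%:C * ipH x (phi m th).
Proof.
move=> Fth Hx; apply: (ccvg_unique (sform_eigen srep Fth Hx (Hphi m Fth))).
apply: (@ccvg_near_eq _ _ _ m.+1) => n mn.
rewrite (bigD1 (Ordinal mn))//= (phi_orthonormal srep)// eqxx mulr1.
rewrite big1 ?addr0// => j jm; rewrite (phi_orthonormal srep)//.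
rewrite (_ : (j == m :> nat) = false) ?mulr0//.
by apply: contraNF jm => /eqP jm; apply/eqP/val_inj.
Qed.

(** The eigenvalue [lam m] is recovered by a double limit over the basis from
    matrix entries of the spectral density operator and coordinates of the
    measurable eigenfunction. *)
Lemma measurable_lam m : measurable_fun freqI (lam m).
Proof.
have mpe j : cmeasurable freqI (fun th => ipH (phi m th) (e j)).
  exact: cmeasurable_ip_joint.
have m1 x : inH x -> cmeasurable freqI (fun th => sform th x (phi m th)).
  move=> Hx; apply: (@cmeasurable_ccvg _ _ _ _ (fun n th =>
     \sum_(j < n) sform th x (e j) * conjc (ipH (phi m th) (e j)))) => [n|th Fth].
    apply: cmeasurable_sum => j; apply: cmeasurableM; first exact: cmeasurable_sform.
    by apply: cmeasurableJ; exact: mpe.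
  have := parseval_ip eB (spectral_density_inH sX eB eS th Hx) (Hphi m Fth).
  congr ccvg; apply/funext => n; apply: eq_bigr => j _.
  by rewrite -(ipC mI (Hphi m Fth) (He j)).
suff [] : cmeasurable freqI (fun th => (lam m th)%:C) by [].
apply: (@cmeasurable_ccvg _ _ _ _ (fun n th =>
     \sum_(j < n) ipH (phi m th) (e j) * sform th (e j) (phi m th))) => [n|th Fth].
  by apply: cmeasurable_sum => j; exact: (cmeasurableM (mpe j) (m1 _ (He j))).
have := ccvgZ (lam m th)%:C (parseval_ip eB (Hphi m Fth) (Hphi m Fth)).
rewrite (ipxx (Hphi m Fth)) (nrm_phi srep)// mulr1; congr ccvg.
apply/funext => n; rewrite mulr_sumr; apply: eq_bigr => j _.
by rewrite sform_phi//; ring.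
Qed.

Section error.
Variables (I : Type) (r : seq I) (k : I -> int) (a b : I -> R -> R[i]) (dl : R[i]).
Hypotheses (Ha : forall i, inH (a i)) (Hb : forall i, inH (b i)).

(** The effect on [phi n] at frequency [th] of the filter with delayed scores
    [<X_(t - k i), a i>] and loadings [b i], subtracted from [dl] times the
    identity. *)
Definition residual n th u : R[i] :=
  dl * phi n th u - \sum_(i <- r) (expi (- ((k i)%:~R * th)) * ipH (phi n th) (a i)) * b i u.

Lemma residual_inH n th : freqI th -> inH (residual n th).
Proof.
move=> Fth; apply: (inL2B mI); first exact: (inL2Z mI _ (Hphi _ Fth)).
by apply: (inL2_sum mI) => i; exact: (inL2Z mI _ (Hb _)).
Qed.

Let I' := option I.
Let r' : seq I' := None :: [seq Some i | i <- r].
Let k' (i : I') : int := if i is Some j then k j else 0.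
Let x' j (i : I') : R -> R[i] :=
  if i is Some i0 then fun u => - conjc (ipH (b i0) (e j)) * a i0 u
  else fun u => conjc dl * e j u.

Let Hx' j i : inH (x' j i).
Proof. by case: i => [i|]; apply: (inL2Z mI); [exact: Ha|exact: He]. Qed.

Let error t w u : R[i] :=
  dl * tame X t w u - \sum_(i <- r) sc X (t - k i) (a i) w * b i u.

Let error_inH t w : inH (error t w).
Proof.
apply: (inL2B mI); first exact: (inL2Z mI _ (tame_inH X2 _ _)).
by apply: (inL2_sum mI) => i; exact: (inL2Z mI _ (Hb _)).
Qed.

Let ip_error t w j : ipH (error t w) (e j) = \sum_(i <- r') sc X (t - k' i) (x' j i) w.
Proof.
rewrite /r' big_cons big_map /= subr0.
have Ht : inH (fun u => dl * tame X t w u) by exact: (inL2Z mI _ (tame_inH X2 _ _)).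
have Hi i : inH (fun u => sc X (t - k i) (a i) w * b i u) by exact: (inL2Z mI _ (Hb _)).
rewrite (ipBl mI Ht (inL2_sum mI _ Hi) (He j)) (ipZl mI _ (tame_inH X2 _ _) (He j)).
rewrite (scZ X2)// conjcK; congr (_ + _).
rewrite (ip_suml mI r Hi (He j)) -sumrN; apply: eq_bigr => i _.
rewrite (ipZl mI _ (Hb i) (He j)) (scZ X2)// conjcN conjcK mulNr.
by rewrite mulrC.
Qed.

Let ip_residual n th j : freqI th ->
  sqmod (ipH (trigpoly r' k' (x' j) th) (phi n th)) = sqmod (ipH (residual n th) (e j)).
Proof.
move=> Fth; have Hp := Hphi n Fth; rewrite -sqmodJ; congr sqmod.
have Hr i : inH (fun u => (expi (- ((k i)%:~R * th)) * ipH (phi n th) (a i)) * b i u).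
  exact: (inL2Z mI _ (Hb _)).
rewrite (ipBl mI (inL2Z mI _ Hp) (inL2_sum mI _ Hr) (He j)) (ipZl mI _ Hp (He j)).
have Hs i : inH (fun u => expi ((k' i)%:~R * th) * x' j i u) by exact: (inL2Z mI _ (Hx' _ _)).
rewrite /trigpoly (ip_suml mI r' Hs Hp) /r' big_cons big_map /= conjcD; congr (_ + _).
  rewrite (_ : (fun u => _) = (fun u => conjc dl * e j u)); last first.
    by apply/funext => u; rewrite mul0r expi0 mul1r.
  by rewrite (ipZl mI _ (He j) Hp) conjcM conjcK -(ipC mI (He j) Hp).
rewrite (ip_suml mI r Hr (He j)) conjc_sum -sumrN; apply: eq_bigr => i _.
rewrite (ipZl mI _ (Hb i) (He j)).
rewrite (ipZl mI _ (Hx' j (Some i)) Hp) /= (ipZl mI _ (Ha i) Hp).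
rewrite !conjcM conjcN conjcK conjc_expi -(ipC mI (Ha i) Hp); ring.
Qed.

(** Reading the error coordinate by coordinate in the basis turns it into
    finite trigonometric sums, to which the isometry applies. *)
Lemma filter_error t : E_normH2 P (fun w u =>
    dl * tame X t w u - \sum_(i <- r) sc X (t - k i) (a i) w * b i u) =
  (\int[leb]_(th in freqI) \sum_(0 <= n <oo) (lam n th * nrmH (residual n th))%:E)%E.
Proof.
rewrite -/(error t).
transitivity (\int[P]_w \sum_(0 <= j <oo) (sqmod (ipH (error t w) (e j)))%:E)%E.
  by apply: eq_integral => w _; exact: (parseval eB (error_inH t w)).
rewrite integral_nneseries//; last 2 first.
- move=> j; apply: measurable_sqmodE; under eq_fun do rewrite ip_error.
  by apply: cmeasurable_sum => i; exact: (cmeasurable_sc X2).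
- by move=> j w _; rewrite lee_fin sqmod_ge0.
transitivity (\sum_(0 <= j <oo)
    \int[leb]_(th in freqI) sdens th (trigpoly r' k' (x' j) th))%E.
  apply: eq_eseriesr => j _.
  rewrite -(spectral_isometry sX eB eS srep r' k' (Hx' j) t).
  by apply: eq_integral => w _; rewrite ip_error.
have Ht j th : inH (trigpoly r' k' (x' j) th) := trigpoly_inH _ _ (Hx' j) th.
rewrite -integral_nneseries; last 3 first.
- exact: mF.
- by move=> j; exact: (measurable_sdens_trigpoly sX eB eS srep r' k' (Hx' j)).
- by move=> j th Fth; exact: (sdens_ge0 srep).
apply: eq_integral => th; rewrite inE => Fth.
under eq_eseriesr do rewrite sdens_seriesE.
rewrite (nneseries_interchange xpredT xpredT); last first.
  by move=> j n; rewrite lee_fin mulr_ge0 ?sqmod_ge0// (lam_ge0 srep).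
apply: eq_eseriesr => n _.
rewrite EFinM (nrm2E (residual_inH n Fth)) (parseval eB (residual_inH n Fth)).
rewrite -nneseriesZl; last by move=> j _; rewrite lee_fin sqmod_ge0.
by apply: eq_eseriesr => j _; rewrite ip_residual// EFinM.
Qed.

End error.
End finite_filters.

(** * Low rank approximation in the mean *)

Lemma sum_tailE {R : realType} (a : nat -> R) p N : (p <= N)%N ->
  \sum_(p <= n < N) a n = \sum_(0 <= n < N) a n * (p <= n)%:R.
Proof.
move=> pN; have z : \sum_(0 <= n < p) a n * (p <= n)%:R = 0.
  rewrite big_nat_cond big1// => n /andP[/andP[_ np] _].
  by rewrite leqNgt np mulr0.
rewrite [RHS](big_cat_nat (leq0n p) pN) /= z add0r.
by apply: eq_big_nat => n /andP[pn _]; rewrite pn mulr1.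
Qed.

Section low_rank.
Context {R : realType} {d : measure_display} {T : measurableType d}.
Variables (mu : {measure set T -> \bar R}) (D : set T).
Hypothesis mD : measurable D.
Local Notation inL2 := (inL2 mu D).
Local Notation nrm2 := (nrm2 mu D).
Local Notation ip := (ip mu D).

(** Orthogonal families whose members have norm zero or one: what the
    Gram-Schmidt process yields when dependent vectors are not discarded. *)
Definition ortho01 (p : nat) (g : nat -> T -> R[i]) : Prop :=
  [/\ forall i, inL2 (g i), forall i j, (i < p)%N -> (j < p)%N -> i != j -> ip (g i) (g j) = 0
    & forall i, nrm2 (g i) = 0 \/ nrm2 (g i) = 1].

Let comb (c : nat -> R[i]) (v : nat -> T -> R[i]) p x : R[i] := \sum_(m < p) c m * v m x.

Let comb_inL2 c v p : (forall m, inL2 (v m)) -> inL2 (comb c v p).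
Proof. by move=> Hv; apply: (inL2_sum mD) => m; apply: (inL2Z mD); exact: Hv. Qed.

Lemma ip_ortho01 p g (c : nat -> R[i]) i : ortho01 p g -> (i < p)%N ->
  ip (fun x => \sum_(m < p) c m * g m x) (g i) = c i * (nrm2 (g i))%:C.
Proof.
move=> [Hg og _] ip'; rewrite (ip_suml mD) => [|m|]; [|by apply: (inL2Z mD)|by []].
rewrite (bigD1 (Ordinal ip'))//= (ipZl mD)// ipxx// big1 ?addr0// => m mi.
rewrite (ipZl mD)// og ?mulr0//.
Qed.

Lemma nrm2_sub_ortho01 p g x (c : nat -> R[i]) : ortho01 p g -> inL2 x ->
  nrm2 (fun u => x u - \sum_(i < p) c i * g i u) =
  nrm2 x + \sum_(i < p) (sqmod (c i) * nrm2 (g i) -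
    2 * complex.Re (conjc (c i) * ip x (g i))).
Proof.
move=> og Hx; have [Hg _ _] := og.
have Hc : inL2 (fun u => \sum_(i < p) c i * g i u) by exact: comb_inL2.
rewrite (nrm2B mD)// sumrB addrA; congr (_ + _ - _).
  have E h : inL2 h -> nrm2 h = complex.Re (ip h h) by move=> /ipxx ->.
  rewrite E// (ip_sumr mD) => [|i|]; [|by apply: (inL2Z mD)|by []].
  rewrite Re_sum; apply: eq_bigr => i _.
  rewrite (ipZr mD)// (ip_ortho01 _ og)// mulrA mulrC -/(_ * _).
  by rewrite [conjc _ * _]mulrC mulc_conjc -rmorphM /= mulrC.
rewrite (ip_sumr mD) => [|i|]; [|by apply: (inL2Z mD)|by []].
rewrite Re_sum mulr_sumr; apply: eq_bigr => i _.
by rewrite (ipZr mD).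
Qed.

Lemma ortho01_dist_ge p g x (c : nat -> R[i]) : ortho01 p g -> inL2 x ->
  nrm2 x - \sum_(i < p) sqmod (ip x (g i)) <=
  nrm2 (fun u => x u - \sum_(i < p) c i * g i u).
Proof.
move=> og Hx; have [Hg _ g01] := og.
rewrite nrm2_sub_ortho01// lerD2l -sumrN; apply: ler_sum => i _.
case: (g01 i) => gi; rewrite gi.
  by rewrite (_ : ip x (g i) = 0) ?mulr0 ?sqmod0 ?Re0 ?mulr0 ?subrr ?oppr0//;
    rewrite (ipC mD (Hg i) Hx) (ip_nrm2_0 mD (Hg i) Hx gi) conjc0.
rewrite mulr1 -subr_ge0.
have -> : sqmod (c i) - 2 * complex.Re (conjc (c i) * ip x (g i)) - - sqmod (ip x (g i))
    = sqmod (c i - ip x (g i)) by rewrite /sqmod !cE; ring.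
exact: sqmod_ge0.
Qed.

Lemma ortho01_bessel p g x : ortho01 p g -> inL2 x ->
  \sum_(i < p) sqmod (ip x (g i)) <= nrm2 x.
Proof.
move=> og Hx; have [Hg _ g01] := og.
have := nrm2_ge0 mu D (fun u => x u - \sum_(i < p) ip x (g i) * g i u).
rewrite (nrm2_sub_ortho01 (fun i => ip x (g i)))// => H.
rewrite -subr_ge0; apply: le_trans H _.
rewrite -sumrN lerD2l; apply: ler_sum => i _.
rewrite [conjc _ * _]mulrC mulc_conjc ReC.
have s0 := sqmod_ge0 (ip x (g i)).
by case: (g01 i) => ->; lra.
Qed.

Lemma gram_schmidt p (v : nat -> T -> R[i]) : (forall m, inL2 (v m)) ->
  exists g, ortho01 p g /\ forall c : nat -> R[i], exists c' : nat -> R[i],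
    nrm2 (fun x => \sum_(m < p) c m * v m x - \sum_(i < p) c' i * g i x) = 0.
Proof.
move=> Hv; elim: p => [|p [g [og gc]]].
  exists (fun=> fun=> 0); split.
    by split=> [i|i j //|i]; [exact: inL2_0|left; exact: nrm2_0].
  move=> c; exists c; rewrite (_ : (fun x => _) = (fun=> 0)) ?nrm2_0//.
  by apply/funext => x; rewrite !big_ord0 subrr.
have [Hg oo g01] := og.
pose q x := \sum_(i < p) ip (v p) (g i) * g i x.
have Hq : inL2 q by apply: (comb_inL2 (fun i => ip (v p) (g i))).
pose r x := v p x - q x.
have Hr : inL2 r by exact: (inL2B mD).
have rg i : (i < p)%N -> ip r (g i) = 0.
  move=> ip'; rewrite (ipBl mD)// (ip_ortho01 (fun i => ip (v p) (g i)) og)//.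
  case: (g01 i) => gi; rewrite gi; last by rewrite mulr1 subrr.
  by rewrite (ipC mD (Hg i) (Hv p)) (ip_nrm2_0 mD (Hg i) (Hv p) gi) conjc0 mul0r subrr.
pose nr := Num.sqrt (nrm2 r).
have nr2 : nr ^+ 2 = nrm2 r by rewrite sqr_sqrtr// nrm2_ge0.
pose new x := (nr^-1)%:C * r x.
have Hnew : inL2 new by exact: (inL2Z mD).
have nnew : nrm2 new = 0 \/ nrm2 new = 1.
  rewrite (nrm2Z mD)// sqmodC -nr2; have [->|n0] := eqVneq nr 0.
    by left; rewrite expr0n mulr0.
  by right; rewrite -exprMn mulVf// expr1n.
have rnew : nrm2 (fun x => r x - nr%:C * new x) = 0.
  have [n0|n0] := eqVneq nr 0.
    rewrite n0; under eq_fun do rewrite mul0r subr0.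
    by rewrite -[LHS]/(nrm2 r) -nr2 n0 expr0n.
  rewrite (_ : (fun x => _) = (fun=> 0)) ?nrm2_0//; apply/funext => x.
  by rewrite /new mulrA -rmorphM /= divff// mul1r subrr.
pose g' i := if (i < p)%N then g i else new.
have g'lt i : (i < p)%N -> g' i = g i by rewrite /g' => ->.
have g'p : g' p = new by rewrite /g' ltnn.
exists g'; split.
  split.
  - by move=> i; rewrite /g'; case: ifP.
  - have rn i : (i < p)%N -> ip new (g i) = 0 by move=> ip'; rewrite (ipZl mD)// rg// mulr0.
    move=> i j; rewrite !ltnS (leq_eqVlt i) (leq_eqVlt j) => /predU1P[->|ip'] /predU1P[->|jp'] ij.
    + by rewrite eqxx in ij.
    + by rewrite g'p g'lt// rn.
    + by rewrite g'p g'lt// (ipC mD Hnew (Hg i)) rn// conjc0.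
    + by rewrite !g'lt// oo.
  - by move=> i; rewrite /g'; case: ifP.
move=> c; have [c1 c1P] := gc c.
exists (fun i => if (i < p)%N then c1 i + c p * ip (v p) (g i) else c p * nr%:C).
rewrite (_ : (fun x => _) = (fun x =>
  (\sum_(m < p) c m * v m x - \sum_(i < p) c1 i * g i x) +
  c p * (r x - nr%:C * new x))); last first.
  apply/funext => x; rewrite !big_ord_recr /= ltnn g'p.
  have -> : \sum_(i < p) (if (i < p)%N then c1 i + c p * ip (v p) (g i)
      else c p * nr%:C) * g' i x = \sum_(i < p) c1 i * g i x + c p * q x.
    rewrite /q mulr_sumr -big_split; apply: eq_bigr => i _ /=.
    by rewrite ltn_ord g'lt//; ring.
  by rewrite /r; ring.
set f1 := (fun x => \sum_(m < p) _ - _) in c1P *.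
have Hf1 : inL2 f1 by apply: (inL2B mD); exact: comb_inL2.
have Hf2 : inL2 (fun x => r x - nr%:C * new x) by apply: (inL2B mD) => //; exact: (inL2Z mD).
have := nrm2_ge0 mu D (fun x => f1 x + c p * (r x - nr%:C * new x)).
have := nrm2D_le2 mD Hf1 (inL2Z mD (c p) Hf2).
rewrite (nrm2Z mD _ Hf2) rnew c1P !mulr0 addr0 => le0 ge0.
by apply/eqP; rewrite eq_le le0 ge0.
Qed.

Variables (f : nat -> T -> R[i]) (lam : nat -> R).
Hypotheses (Hf : forall n, inL2 (f n))
  (ff : forall i j, ip (f i) (f j) = (i == j)%:R)
  (lam0 : forall n, 0 <= lam n) (lamS : forall m n, (m <= n)%N -> lam n <= lam m).

Let nf n : nrm2 (f n) = 1.
Proof. by have := ff n n; rewrite eqxx ipxx// => /(congr1 (@complex.Re R)). Qed.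

(** The weights [w n], the squared norms of the projections of the orthonormal
    [f n] on the [p]-dimensional span of the [v m], lie between 0 and 1 and sum
    up to at most [p]; against a nonincreasing sequence it is best to put them
    on the first [p] indices. *)
Lemma low_rank_finite p N (v : nat -> T -> R[i]) (c : nat -> nat -> R[i]) :
  (p <= N)%N -> (forall m, inL2 (v m)) ->
  \sum_(p <= n < N) lam n <=
  \sum_(0 <= n < N) lam n * nrm2 (fun u => f n u - \sum_(m < p) c n m * v m u).
Proof.
move=> pN Hv; have [g [og gc]] := gram_schmidt p Hv; have [Hg _ g01] := og.
pose w n := \sum_(i < p) sqmod (ip (f n) (g i)).
have w0 n : 0 <= w n by apply: sumr_ge0 => i _; exact: sqmod_ge0.
have w1 n : w n <= 1 by rewrite -(nf n); exact: ortho01_bessel.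
have sw : \sum_(0 <= n < N) w n <= p%:R.
  rewrite /w exchange_big /= -[p in leRHS]card_ord -sumr_const; apply: ler_sum => i _.
  rewrite big_mkord; have := bessel mD (fun j : 'I_N => Hf j) (r := index_enum 'I_N) _
    (index_enum_uniq _) (Hg i).
  have H (j k : 'I_N) : ip (f j) (f k) = (j == k)%:R by rewrite ff.
  move=> /(_ H); rewrite (eq_bigr (fun j : 'I_N => sqmod (ip (f j) (g i)))).
    by move=> /le_trans; apply; case: (g01 i) => ->; rewrite ?ler01.
  by move=> j _; rewrite (ipC mD (Hf j) (Hg i)) sqmodJ.
have dist n : 1 - w n <= nrm2 (fun u => f n u - \sum_(m < p) c n m * v m u).
  have [c' c'P] := gc (c n).
  set y := fun u => _ - _.
  have Hcv : inL2 (fun u => \sum_(m < p) c n m * v m u) by exact: (comb_inL2 (c n)).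
  have Hcg : inL2 (fun u => \sum_(i < p) c' i * g i u) by exact: comb_inL2.
  have Hy : inL2 y by exact: (inL2B mD).
  have Hz : inL2 (fun x => \sum_(m < p) c n m * v m x - \sum_(i < p) c' i * g i x).
    exact: (inL2B mD).
  have -> : nrm2 y = nrm2 (fun u => f n u - \sum_(i < p) c' i * g i u).
    have -> : (fun u => f n u - \sum_(i < p) c' i * g i u) = (fun u =>
      y u + (\sum_(m < p) c n m * v m u - \sum_(i < p) c' i * g i u)).
      by apply/funext => u; rewrite /y; ring.
    rewrite (nrm2D mD Hy Hz) c'P (ipC mD Hz Hy) (ip_nrm2_0 mD Hz Hy c'P).
    by rewrite conjc0 Re0 mulr0 !addr0.
  by rewrite -(nf n); exact: ortho01_dist_ge.
apply: (@le_trans _ _ (\sum_(0 <= n < N) lam n * (1 - w n))); last first.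
  by apply: ler_sum => n _; rewrite ler_wpM2l.
rewrite (sum_tailE _ pN).
rewrite -subr_ge0 -sumrB.
apply: (@le_trans _ _ (\sum_(0 <= n < N) lam p * ((n < p)%:R - w n))).
  rewrite -mulr_sumr mulr_ge0// sumrB subr_ge0; apply: le_trans sw _.
  have z : \sum_(0 <= n < p) (n < p)%:R = p%:R :> R.
    rewrite big_mkord (eq_bigr (fun=> 1)) ?sumr_const ?card_ord// => n _.
    by rewrite ltn_ord.
  rewrite (big_cat_nat (leq0n p) pN) /= z lerDl.
  by apply: sumr_ge0 => n _; exact: ler0n.
apply: ler_sum => n _; have := w0 n; have := w1 n; have l0 := lam0 n.
rewrite -mulrBr.
have [np|pn] := ltnP n p.
  have := lamS (ltnW np); rewrite /= subr0 => h1 h2 h3.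
  by rewrite ler_wpM2r// subr_ge0.
have := lamS pn; rewrite /= => h1 h2 h3.
have -> : 1 - w n - 1 = - w n by lra.
by rewrite sub0r !mulrN lerN2 ler_wpM2r.
Qed.

Lemma low_rank_bound p (v : nat -> T -> R[i]) (c : nat -> nat -> R[i]) :
  (forall m, inL2 (v m)) ->
  (\sum_(p <= n <oo) (lam n)%:E <=
   \sum_(0 <= n <oo) (lam n * nrm2 (fun u => (f n u - \sum_(m < p) c n m * v m u)%R))%:E)%E.
Proof.
move=> Hv; apply: lime_le.
  by apply: is_cvg_ereal_nneg_natsum => n _; rewrite lee_fin.
exists p => // N /= pN; rewrite sumEFin.
apply: (@le_trans _ _ (\sum_(0 <= n < N)
    lam n * nrm2 (fun u => f n u - \sum_(m < p) c n m * v m u))%:E).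
  by rewrite lee_fin; exact: low_rank_finite.
rewrite -sumEFin; apply: nneseries_lim_ge => n _ _.
by rewrite lee_fin mulr_ge0// nrm2_ge0.
Qed.

End low_rank.

(** * Filters with finitely many coefficients *)

Section finite_fourier_series.
Context {R : realType}.
Local Notation leb := (@lebesgue_measure R).
Local Notation ipH := (ip leb unitI).
Local Notation nrmH := (nrm2 leb unitI).
Local Notation mI := (@measurable_unitI R).
Local Notation mF := (@measurable_freqI R).

Definition fpoly (psi : int -> R -> R[i]) (r : seq int) th u : R[i] :=
  \sum_(l <- r) psi l u * expi (l%:~R * th).

Lemma fourier_sumE psi N th : fourier_sum psi N th = fpoly psi (irange N) th.
Proof. by apply/funext => u; rewrite /fourier_sum symsumE. Qed.

Lemma fpolyE psi r th u : fpoly psi r th u = \sum_(l <- r) expi (l%:~R * th) * psi l u.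
Proof. by apply: eq_bigr => l _; rewrite mulrC. Qed.

Variable psi : int -> R -> R[i].
Hypothesis Hpsi : forall l, inH (psi l).

Lemma fpoly_inH r th : inH (fpoly psi r th).
Proof.
rewrite (_ : fpoly psi r th = fun u => \sum_(l <- r) expi (l%:~R * th) * psi l u).
  by apply: (inL2_sum mI) => l; exact: (inL2Z mI _ (Hpsi l)).
by apply/funext => u; rewrite fpolyE.
Qed.

Lemma ip_fpoly r th x : inH x ->
  ipH x (fpoly psi r th) = \sum_(l <- r) expi (- (l%:~R * th)) * ipH x (psi l).
Proof.
move=> Hx; have Hi l : inH (fun u => expi (l%:~R * th) * psi l u) by exact: (inL2Z mI _ (Hpsi l)).
rewrite (_ : fpoly psi r th = fun u => \sum_(l <- r) expi (l%:~R * th) * psi l u).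
  rewrite (ip_sumr mI r Hi Hx); apply: eq_bigr => l _.
  by rewrite (ipZr mI _ (Hpsi l) Hx) conjc_expi.
by apply/funext => u; rewrite fpolyE.
Qed.

Lemma nrm_fpoly_le r th : nrmH (fpoly psi r th) <= (size r)%:R * \sum_(l <- r) nrmH (psi l).
Proof.
have Hi l : inH (fun u => expi (l%:~R * th) * psi l u) by exact: (inL2Z mI _ (Hpsi l)).
rewrite (_ : fpoly psi r th = fun u => \sum_(l <- r) expi (l%:~R * th) * psi l u).
  apply: le_trans (nrm2_sum_le mI r Hi) _; rewrite ler_wpM2l// ler_sum// => l _.
  by rewrite (nrm2Z mI _ (Hpsi l)) sqmod_expi mul1r.
by apply/funext => u; rewrite fpolyE.
Qed.

Lemma jointly_measurable_fpoly r : jointly_measurable (fpoly psi r).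
Proof.
apply: cmeasurable_sum => l; apply: cmeasurableM.
  by apply: (cmeasurable_fst freqI mI (g := psi l)); case: (Hpsi l).
apply: (cmeasurable_snd unitI mF (g := fun th => expi (l%:~R * th))).
exact: cmeasurable_expi.
Qed.

End finite_fourier_series.

Section frequency_products.
Context {R : realType}.
Local Notation leb := (@lebesgue_measure R).
Local Notation ipH := (ip leb unitI).
Local Notation nrmH := (nrm2 leb unitI).
Local Notation mI := (@measurable_unitI R).
Local Notation mF := (@measurable_freqI R).
Implicit Types (f g : R -> R -> R[i]).

(** Families of elements of [H] indexed by frequencies, as functions on the
    rectangle. *)
Definition uncurried f : measurableTypeR R * measurableTypeR R -> R[i] :=
  fun z => f z.2 z.1.

Local Notation sqnormF f := (sqnorm (leb \x leb)%E (unitI `*` freqI) (uncurried f)).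

Lemma measurable_UF : measurable (@unitI R `*` @freqI R).
Proof. exact: (measurableX mI mF). Qed.

Lemma sqnorm_uncurried f : jointly_measurable f ->
  (\int[leb]_(th in freqI) normH2 (f th) = sqnormF f)%E.
Proof.
move=> mf; pose q (z : measurableTypeR R * measurableTypeR R) := (sqmod (f z.2 z.1))%:E.
have mq : measurable_fun (unitI `*` freqI) q by exact: measurable_sqmodE.
have q0 z : (unitI `*` freqI) z -> (0 <= q z)%E by move=> _; rewrite lee_fin sqmod_ge0.
transitivity (\int[(leb \x leb)%E]_(z in unitI `*` freqI) q z)%E; last by [].
by rewrite (tonelli leb leb mI mF mq q0) (tonelli_swap leb leb mI mF mq q0).
Qed.

Lemma measurable_normH2 f : jointly_measurable f ->
  measurable_fun freqI (fun th => normH2 (f th)).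
Proof.
move=> mf; pose q (z : measurableTypeR R * measurableTypeR R) := (sqmod (f z.2 z.1))%:E.
apply: (@measurable_tonelli2 _ _ _ _ _ leb _ _ mI mF q).
  exact: measurable_sqmodE.
by move=> z _; rewrite lee_fin sqmod_ge0.
Qed.

Lemma measurable_nrmH f : jointly_measurable f ->
  (forall th, freqI th -> inH (f th)) ->
  measurable_fun freqI (fun th => (nrmH (f th))%:E).
Proof.
move=> mf Hf; apply: (eq_measurable_fun (fun th => normH2 (f th))).
  by move=> th; rewrite inE => Fth; rewrite nrm2E//; exact: Hf.
exact: measurable_normH2.
Qed.

Lemma inL2_fpoly psi r : (forall l, inH (psi l)) ->
  inL2 (leb \x leb)%E (unitI `*` freqI) (uncurried (fpoly psi r)).
Proof.
move=> Hpsi; split; first exact: jointly_measurable_fpoly.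
rewrite -sqnorm_uncurried; last exact: jointly_measurable_fpoly.
set M := (size r)%:R * \sum_(l <- r) nrmH (psi l).
apply: (@le_lt_trans _ _ (\int[leb]_(th in freqI) (cst M%:E th))%E).
  apply: ge0_le_integral.
  - exact: mF.
  - by move=> th _; exact: sqnorm_ge0.
  - by apply: measurable_normH2; exact: jointly_measurable_fpoly.
  - exact: measurable_cst.
  - move=> th _; rewrite /= /normH2 -(nrm2E (fpoly_inH Hpsi r th)) lee_fin.
    exact: nrm_fpoly_le.
rewrite integral_cst; last exact: mF.
by rewrite [X in (_ * X)%E]leb_freqI -EFinM ltry.
Qed.

Section classC.
Variables (psi : int -> R -> R[i]) (psistar : R -> R -> R[i]).
Hypotheses (Hpsi : forall l, inH (psi l))
  (Hstar : inL2 (leb \x leb)%E (unitI `*` freqI) (uncurried psistar)).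

Lemma classC_L2_cvg :
  (fun N => \int[leb]_(theta in freqI)
     normH2 (fun u => (fourier_sum psi N theta u - psistar theta u)%R))%E
    @ \oo --> 0%E ->
  L2_cvg (leb \x leb)%E (unitI `*` freqI)
    (fun N => uncurried (fpoly psi (irange N))) (uncurried psistar).
Proof.
move=> H; split => //.
have E N : sqnormF (fun th u => fpoly psi (irange N) th u - psistar th u) =
    (\int[leb]_(theta in freqI)
     normH2 (fun u => (fourier_sum psi N theta u - psistar theta u)%R))%E.
  rewrite -sqnorm_uncurried.
    by apply: eq_integral => th _; rewrite fourier_sumE.
  by apply: cmeasurableB; [exact: jointly_measurable_fpoly|case: Hstar].
by under eq_fun do rewrite E.
Qed.

End classC.

End frequency_products.

Lemma L2_cvg_cauchy {R : realType} {d : measure_display} {T : measurableType d}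
    (mu : {measure set T -> \bar R}) (D : set T) (mD : measurable D)
    (s : nat -> T -> R[i]) (l : T -> R[i]) :
  (forall n, inL2 mu D (s n)) -> L2_cvg mu D s l ->
  forall e : R, 0 < e -> exists N, forall m n, (N <= m)%N -> (N <= n)%N ->
    nrm2 mu D (fun x => s m x - s n x) <= e.
Proof.
move=> Hs sl e e0; have [Hl _] := sl; move/(L2_cvgP mD Hs Hl) : sl => sl.
have e4 : 0 < e / 4 by rewrite divr_gt0.
have /cvgr0Pnorm_le /(_ _ e4) [N _ NP] := sl; exists N => m n Nm Nn.
have := NP m Nm; have := NP n Nn; rewrite /= !ger0_norm ?nrm2_ge0// => h1 h2.
rewrite (_ : (fun x => _) = (fun x => (s m x - l x) + (l x - s n x))); last first.
  by apply/funext => x; ring.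
have Hml := inL2B mD (Hs m) Hl; have Hln := inL2B mD Hl (Hs n).
apply: le_trans (nrm2D_le2 mD Hml Hln) _.
rewrite [X in _ + 2 * X]nrm2BC.
by lra.
Qed.

Section double_filters.
Context {R : realType} {d : measure_display} {Om : measurableType d}
  (P : probability Om R).
Local Notation leb := (@lebesgue_measure R).
Local Notation ipH := (ip leb unitI).
Local Notation nrmH := (nrm2 leb unitI).
Local Notation mI := (@measurable_unitI R).

Variable X : int -> Om -> R -> R[i].
Hypothesis sX : weakly_stationary P X.
Variable e : nat -> R -> R[i].
Hypothesis eB : orthonormal_basis e.
Hypothesis eS : (\esum_(h in [set: int]) HSnorm e (autocov_op P X h) < +oo)%E.
Variables (lam : nat -> R -> R) (phi : nat -> R -> R -> R[i]).
Hypothesis srep : spectral_representation P X lam phi.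

Variables psi ups : nat -> int -> R -> R[i].
Hypotheses (Hpsi : forall m l, inH (psi m l)) (Hups : forall m l, inH (ups m l)).

(** The error of the two filters with scores truncated to the lags in [ks] and
    reconstruction truncated to the lags in [ls]; with [dl] equal to 0 only the
    reconstruction remains, up to sign. *)
Definition two_step (dl : R[i]) t (ms : seq nat) (ls ks : seq int) w u : R[i] :=
  dl * tame X t w u - \sum_(m <- ms) \sum_(l <- ls)
    (\sum_(k <- ks) sc X (t + l - k) (psi m k) w) * ups m l u.

(** The scores are delayed and the reconstruction is advanced, so that the
    exponentials of the two filters recombine into their two frequency
    responses. *)
Lemma two_step_error dl t ms ls ks :
  E_normH2 P (two_step dl t ms ls ks) =
  (\int[leb]_(th in freqI) \sum_(0 <= n <oo) (lam n th *
     nrmH (fun u => (dl * phi n th u - \sum_(m <- ms)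
       ipH (phi n th) (fpoly (psi m) ks th) * fpoly (ups m) ls th u)%R))%:E)%E.
Proof.
pose r := [seq (ml, k) | ml <- [seq (m, l) | m <- ms, l <- ls], k <- ks].
pose kk (i : (nat * int) * int) : int := i.2 - i.1.2.
pose a (i : (nat * int) * int) := psi i.1.1 i.2.
pose b (i : (nat * int) * int) := ups i.1.1 i.1.2.
have Ha i : inH (a i) by exact: Hpsi.
have Hb i : inH (b i) by exact: Hups.
transitivity (E_normH2 P (fun w u =>
    dl * tame X t w u - \sum_(i <- r) sc X (t - kk i) (a i) w * b i u)).
  apply: eq_integral => w _; apply: eq_sqnorm => u _; rewrite /two_step; congr (_ - _).
  rewrite /r !big_allpairs; apply: eq_bigr => m _; apply: eq_bigr => l _.
  rewrite mulr_suml; apply: eq_bigr => k _ /=.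
  by rewrite /kk /= opprB addrA.
rewrite (filter_error sX eB eS srep r kk dl Ha Hb t).
apply: eq_integral => th; rewrite inE => Fth.
apply: eq_eseriesr => n _; congr (_ * _)%:E; congr nrm2; apply/funext => u.
have Hp : inH (phi n th) by have [_ _ [H _] _] := srep Fth; exact: H.
rewrite /residual; congr (_ - _); rewrite /r !big_allpairs; apply: eq_bigr => m _.
rewrite (ip_fpoly (Hpsi m))// fpolyE mulr_sumr; apply: eq_bigr => l _.
rewrite mulr_suml; apply: eq_bigr => k _ /=.
rewrite /kk /a /b /= rmorphB /=.
rewrite (_ : - ((k%:~R - l%:~R) * th) = - (k%:~R * th) + l%:~R * th); last by ring.
by rewrite expiD; ring.
Qed.

Hypothesis mphi : forall m, jointly_measurable (phi m).

Lemma measurable_two_step_residuals dl ms ls ks :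
  measurable_fun freqI (fun th => \sum_(0 <= n <oo) (lam n th *
     nrmH (fun u => (dl * phi n th u - \sum_(m <- ms)
       ipH (phi n th) (fpoly (psi m) ks th) * fpoly (ups m) ls th u)%R))%:E)%E.
Proof.
have mF := @measurable_freqI R; have mU := @measurable_unitI R.
have Hphi n th : freqI th -> inH (phi n th) by move=> /srep[_ _ [H _] _]; exact: H.
pose res n th u : R[i] := dl * phi n th u - \sum_(m <- ms)
   ipH (phi n th) (fpoly (psi m) ks th) * fpoly (ups m) ls th u.
have Hres n th : freqI th -> inH (res n th).
  move=> Fth; apply: (inL2B mI); first exact: (inL2Z mI _ (Hphi n th Fth)).
  by apply: (inL2_sum mI) => m; apply: (inL2Z mI); exact: fpoly_inH.
have mres n : jointly_measurable (res n).
  apply: cmeasurableB; first exact: (cmeasurableZ dl (mphi n)).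
  apply: cmeasurable_sum => m; apply: cmeasurableM; last exact: (jointly_measurable_fpoly (Hups m)).
  apply: (cmeasurable_snd unitI mF (g := fun th => ipH (phi n th) (fpoly (psi m) ks th))).
  exact: (cmeasurable_ip_joint2 (mphi n) (jointly_measurable_fpoly (Hpsi m) ks)).
apply: ge0_emeasurable_sum => [n th Fth _|n _].
  by rewrite lee_fin mulr_ge0 ?nrm2_ge0// (lam_ge0 srep).
apply: (eq_measurable_fun (fun th => ((lam n th)%:E * (nrmH (res n th))%:E)%E)).
  by move=> th _; rewrite EFinM.
apply: (emeasurable_funM _ (measurable_nrmH (mres n) (Hres n))).
by apply/measurable_EFinP; exact: (measurable_lam sX eB eS srep mphi).
Qed.

Lemma inL2_two_step dl t ms ls ks :
  inL2 (P \x leb)%E (setT `*` unitI)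
    (fun z : Om * measurableTypeR R => two_step dl t ms ls ks z.1 z.2).
Proof.
have X2 s : L2_random_element P (X s) by case: sX.
have mm : measurable ([set: Om] `*` @unitI R : set (Om * measurableTypeR R)).
  by apply: (measurableX _ mI); exact: measurableT.
apply: (inL2B mm); first exact: (inL2Z mm _ (tame_inL2 X2 t)).
apply: (inL2_sum mm) => m; apply: (inL2_sum mm) => l.
have Hs : inL2 P setT (fun w => \sum_(k <- ks) sc X (t + l - k) (psi m k) w).
  by apply: (inL2_sum (@measurableT _ Om)) => k; exact: (inL2_sc X2).
exact: (inL2_tensor Hs (Hups m l)).
Qed.

End double_filters.

(** * Mean square limits of the filters *)

Section filter_limits.
Context {R : realType} {d : measure_display} {Om : measurableType d}
  (P : probability Om R).
Local Notation leb := (@lebesgue_measure R).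
Local Notation ipH := (ip leb unitI).
Local Notation nrmH := (nrm2 leb unitI).
Local Notation nrmP := (nrm2 P setT).
Local Notation mI := (@measurable_unitI R).
Local Notation mF := (@measurable_freqI R).
Local Notation mT := (@measurableT d Om).
Local Notation inL2Z' := (inL2 (P \x leb)%E (setT `*` unitI)).
Local Notation nrm2Z' := (nrm2 (P \x leb)%E (setT `*` unitI)).
Local Notation cvgZ' := (L2_cvg (P \x leb)%E (setT `*` unitI)).
Local Notation nrmF f := (nrm2 (leb \x leb)%E (unitI `*` freqI) (uncurried f)).
Local Notation mUF := (@measurable_UF R).

Variable X : int -> Om -> R -> R[i].
Hypothesis sX : weakly_stationary P X.
Variable e : nat -> R -> R[i].
Hypothesis eB : orthonormal_basis e.
Hypothesis eS : (\esum_(h in [set: int]) HSnorm e (autocov_op P X h) < +oo)%E.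
Variables (lam : nat -> R -> R) (phi : nat -> R -> R -> R[i]).
Hypothesis srep : spectral_representation P X lam phi.

Local Notation sdens := (sdens lam phi).

Let X2 t : L2_random_element P (X t). Proof. by case: sX. Qed.
Let Hphi th m : freqI th -> inH (phi m th).
Proof. by move=> /srep[_ _ [H _] _]; exact: H. Qed.

Let mm : measurable ([set: Om] `*` @unitI R : set (Om * measurableTypeR R)).
Proof. exact: (measurableX mT mI). Qed.

(** A bound, uniform in the frequency, for the spectral density operator. *)
Definition sbound : R := hs_total P X e / (2 * pi).
Lemma sbound_ge0 : 0 <= sbound.
Proof. by rewrite divr_ge0 ?hs_total_ge0// ltW// twopi_gt0. Qed.

Lemma ae_tame_all : {ae P, forall w, forall s, tame X s w = X s w}.
Proof.
have H1 := ae_foralln (fun n : nat => ae_tame X2 (Posz n)).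
have H2 := ae_foralln (fun n : nat => ae_tame X2 (Negz n)).
by apply: filterS2 H1 H2 => w h1 h2 [].
Qed.

Lemma score_sum_bound (psi : int -> R -> R[i]) r t : (forall l, inH (psi l)) ->
  nrmP (fun w => \sum_(l <- r) sc X (t - l) (psi l) w) <=
  sbound * nrmF (fpoly psi r).
Proof.
move=> Hpsi; have mp := jointly_measurable_fpoly Hpsi r.
have Hs : inL2 P setT (fun w => \sum_(l <- r) sc X (t - l) (psi l) w).
  by apply: (inL2_sum mT) => l; exact: (inL2_sc X2).
rewrite -lee_fin EFinM (nrm2E Hs) (nrm2E (inL2_fpoly r Hpsi)) -sqnorm_uncurried//.
rewrite (spectral_isometry sX eB eS srep r id Hpsi t).
rewrite -ge0_integralZl//; last 4 first.
- exact: mF.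
- exact: measurable_normH2.
- by move=> th _; exact: sqnorm_ge0.
- by rewrite lee_fin sbound_ge0.
apply: ge0_le_integral.
- exact: mF.
- by move=> th Fth; exact: (sdens_ge0 srep).
- exact: (measurable_sdens_trigpoly sX eB eS srep r id Hpsi).
- by apply: measurable_funeM; exact: measurable_normH2.
- move=> th Fth; have Ht := trigpoly_inH r id Hpsi th.
  have -> : fpoly psi r th = trigpoly r id psi th by apply/funext => u; rewrite fpolyE.
  apply: le_trans (sdens_le sX eB eS srep Fth Ht) _.
  by rewrite EFinM (nrm2E Ht).
Qed.

Section scores.
Variables (psi : int -> R -> R[i]) (psistar : R -> R -> R[i]).
Hypothesis Hpsi : forall l, inH (psi l).
Hypothesis cpsi : L2_cvg (leb \x leb)%E (unitI `*` freqI)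
    (fun N => uncurried (fpoly psi (irange N))) (uncurried psistar).

Let part t K w : R[i] := \sum_(l <- irange K) sc X (t - l) (psi l) w.

Let part_inL2 t K : inL2 P setT (part t K).
Proof. by apply: (inL2_sum mT) => l; exact: (inL2_sc X2). Qed.

Let fpoly_sub n m : (n <= m)%N ->
  (fun z => uncurried (fpoly psi (irange m)) z - uncurried (fpoly psi (irange n)) z) =
  uncurried (fpoly psi [seq l <- irange m | (n < absz l)%N]).
Proof. by move=> nm; apply/funext => z; rewrite /uncurried /fpoly irange_split. Qed.

(** By the isometry the partial sums inherit the Cauchy property from those of
    the frequency response. *)
Lemma score_L2_cvg t : L2_cvg P setT (part t) (score P X psi t).
Proof.
pose raw N w := symsum (fun l => inner (X (t - l) w) (psi l)) N.
have rawE : {ae P, forall w, setT w -> forall N, raw N w = part t N w}.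
  apply: filterS ae_tame_all => w tw _ N; rewrite /raw symsumE; apply: eq_bigr => l _.
  by rewrite innerE /sc tw.
have mraw N : cmeasurable setT (raw N).
  rewrite (_ : raw N = fun w => \sum_(l <- irange N) inner (X (t - l) w) (psi l)).
  2: by apply/funext => w; rewrite /raw symsumE.
  apply: cmeasurable_sum => l.
  apply: (cmeasurable_cintegral leb mT mI (f := fun w u => X (t - l) w u * conjc (psi l u))).
  apply: cmeasurableM; first by case: (X2 (t - l)).
  by apply: cmeasurableJ; exact: cmeasurable_prod_snd.
have eqn N y : inL2 P setT y ->
    sqnorm P setT (fun w => raw N w - y w) = sqnorm P setT (fun w => part t N w - y w).
  move=> Hy; apply: ae_eq_sqnorm => //.
  - by apply: cmeasurableB => //; case: Hy.
  - by apply: cmeasurableB; [case: (part_inL2 t N)|case: Hy].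
  - by apply: filterS rawE => w rw _; rewrite rw.
have swap y : L2_cvg P setT raw y <-> L2_cvg P setT (part t) y.
  split=> -[Hy H]; split => //; have E := funext (fun n => eqn n y Hy); move: H.
    by rewrite E.
  by rewrite -E.
apply/swap; apply: (@xgetPex _ _ [set y | L2_cvg P setT raw y]).
have [y /swap H] : exists y, L2_cvg P setT (part t) y; last by exists y.
apply: (L2_complete mT) => [n|ep e0]; first exact: part_inL2.
have b0 := sbound_ge0; have q0 : 0 < sbound + 1 by rewrite ltr_wpDl.
have [|N NP] := L2_cvg_cauchy mUF _ cpsi (e := ep / (sbound + 1)) (divr_gt0 e0 q0).
  by move=> n; exact: inL2_fpoly.
exists N.
have key m n : (N <= n)%N -> (n <= m)%N ->
    nrmP (fun w => part t m w - part t n w) <= ep.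
  move=> Nn nm.
  rewrite (_ : (fun w => _) = (fun w => \sum_(l <- [seq l <- irange m | (n < absz l)%N])
    sc X (t - l) (psi l) w)); last by apply/funext => w; rewrite /part irange_split.
  apply: le_trans (score_sum_bound _ _ Hpsi) _.
  have := NP m n (leq_trans Nn nm) Nn; rewrite fpoly_sub// => H.
  apply: (@le_trans _ _ (sbound * (ep / (sbound + 1)))); first by rewrite ler_wpM2l.
  by rewrite mulrCA ler_piMr ?(ltW e0)// ler_pdivrMr// mul1r lerDl.
move=> m n Nm Nn; case: (leqP n m) => [nm|/ltnW mn]; first exact: key.
by rewrite nrm2BC; exact: key.
Qed.

End scores.

Lemma L2_cvg_tensor (s : nat -> Om -> R[i]) a (x : R -> R[i]) :
  (forall n, inL2 P setT (s n)) -> L2_cvg P setT s a -> inH x ->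
  cvgZ' (fun n z => s n z.1 * x z.2) (fun z => a z.1 * x z.2).
Proof.
move=> Hs sa Hx; have [Ha _] := sa; split; first exact: inL2_tensor.
have E n : sqnorm (P \x leb)%E (setT `*` unitI)
    (fun z : Om * measurableTypeR R => s n z.1 * x z.2 - a z.1 * x z.2) =
    (nrmP (fun w => s n w - a w) * nrmH x)%:E.
  rewrite -(sqnorm_tensor (inL2B mT (Hs n) Ha) Hx).
  by apply: eq_sqnorm => z _; rewrite mulrBl.
under eq_fun do rewrite E.
apply: cvg_EFin; first exact: nearW.
move/(L2_cvgP mT Hs Ha) : sa => sa.
by have := cvgM sa (cvg_cst (nrmH x)); rewrite mul0r; apply.
Qed.

Section pairs.
Variables psi ups : nat -> int -> R -> R[i].
Variable psistar : nat -> R -> R -> R[i].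
Hypotheses (Hpsi : forall m l, inH (psi m l)) (Hups : forall m l, inH (ups m l)).
Hypothesis cpsi : forall m, L2_cvg (leb \x leb)%E (unitI `*` freqI)
    (fun N => uncurried (fpoly (psi m) (irange N))) (uncurried (psistar m)).

(** The limit of [two_step] when only the truncation of the scores is removed. *)
Definition half_step (dl : R[i]) t (ms : seq nat) (ls : seq int) w u : R[i] :=
  dl * tame X t w u - \sum_(m <- ms) \sum_(l <- ls) score P X (psi m) (t + l) w * ups m l u.

Lemma two_step_cvg dl t ms ls :
  cvgZ' (fun K z => two_step X psi ups dl t ms ls (irange K) z.1 z.2)
    (fun z => half_step dl t ms ls z.1 z.2).
Proof.
pose part m t K w : R[i] := \sum_(l <- irange K) sc X (t - l) (psi m l) w.
have Hpart m s K : inL2 P setT (part m s K).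
  by apply: (inL2_sum mT) => l; exact: (inL2_sc X2).
have Ht m l K : inL2Z' (fun z : Om * measurableTypeR R => part m (t + l) K z.1 * ups m l z.2).
  exact: inL2_tensor.
have Hl m K : inL2Z' (fun z : Om * measurableTypeR R =>
    \sum_(l <- ls) part m (t + l) K z.1 * ups m l z.2) by exact: (inL2_sum mm).
have Hm K : inL2Z' (fun z : Om * measurableTypeR R =>
    \sum_(m <- ms) \sum_(l <- ls) part m (t + l) K z.1 * ups m l z.2) by exact: (inL2_sum mm).
have H0 : inL2Z' (fun z : Om * measurableTypeR R => dl * tame X t z.1 z.2).
  exact: (inL2Z mm _ (tame_inL2 X2 t)).
apply: (@L2_cvgD _ _ _ _ _ mm (fun _ z => dl * tame X t z.1 z.2)
  (fun K z => - \sum_(m <- ms) \sum_(l <- ls) part m (t + l) K z.1 * ups m l z.2)) => //.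
- by move=> K; exact: (inL2N (Hm K)).
- exact: L2_cvg_cst.
- apply: (L2_cvgN mm) => //; apply: (L2_cvg_sum mm) => // m; apply: (L2_cvg_sum mm) => // l.
  apply: L2_cvg_tensor => //.
  exact: (score_L2_cvg (Hpsi m) (cpsi m) (t + l)).
Qed.

Lemma half_step_inL2 dl t ms ls :
  inL2Z' (fun z : Om * measurableTypeR R => half_step dl t ms ls z.1 z.2).
Proof. by case: (two_step_cvg dl t ms ls). Qed.

Lemma two_step_error_cvg dl t ms ls :
  E_normH2 P (two_step X psi ups dl t ms ls (irange K)) @[K --> \oo] -->
  sqnorm (P \x leb)%E (setT `*` unitI)
    (fun z : Om * measurableTypeR R => half_step dl t ms ls z.1 z.2).
Proof.
have H2 K := inL2_two_step sX Hpsi Hups dl t ms ls (irange K).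
have := L2_cvg_sqnorm mm H2 (two_step_cvg dl t ms ls).
rewrite (_ : (fun K => sqnorm _ _ _) = (fun K => E_normH2 P (two_step X psi ups dl t ms ls (irange K))))//.
by apply/funext => K; rewrite E_normH2E//; case: (H2 K).
Qed.

Variable B : nat -> R.
Hypothesis psiB : forall m th, freqI th -> inH (psistar m th) /\ nrmH (psistar m th) <= B m.

(** Convergence of the outer sum: the bound on the inner frequency response,
    uniform over frequencies, is what makes the outer coefficients act
    continuously. *)
Lemma half_step_bound t m ls :
  nrm2Z' (fun z => half_step 0 t [:: m] ls z.1 z.2) <=
  2 * sbound * B m * nrmF (fpoly (ups m) ls).
Proof.
have B0 : 0 <= B m.
  have F0 : freqI (0 : R) by rewrite /freqI /= in_itv /= oppr_le0 (ltW (pi_gt0 R)).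
  by have [_] := psiB m F0; apply: le_trans; exact: nrm2_ge0.
set tau := nrmF _; set T := fpoly (ups m) ls.
pose CT := (size ls)%:R * \sum_(l <- ls) nrmH (ups m l).
have CT0 : 0 <= CT by rewrite mulr_ge0// sumr_ge0// => l _; exact: nrm2_ge0.
have HT th : inH (T th) by exact: fpoly_inH.
have TC th : nrmH (T th) <= CT by exact: nrm_fpoly_le.
have [Hstar _] := cpsi m.
pose dK K := nrmF (fun th u => fpoly (psi m) (irange K) th u - psistar m th u).
have b0 := sbound_ge0.
have key K : nrm2Z' (fun z => two_step X psi ups 0 t [:: m] ls (irange K) z.1 z.2) <=
    2 * sbound * CT * dK K + 2 * sbound * B m * tau.
  have H2 := inL2_two_step sX Hpsi Hups 0 t [:: m] ls (irange K).
  set S := fpoly (psi m) (irange K).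
  have HS th : inH (S th) by exact: fpoly_inH.
  have mS : jointly_measurable S by exact: jointly_measurable_fpoly.
  have mT' : jointly_measurable T by exact: jointly_measurable_fpoly.
  have mD' : jointly_measurable (fun th u => S th u - psistar m th u).
    by apply: cmeasurableB => //; case: Hstar.
  have HD : inL2 (leb \x leb)%E (unitI `*` freqI)
      (uncurried (fun th u => S th u - psistar m th u)).
    by apply: (inL2B mUF) => //; exact: inL2_fpoly.
  rewrite -lee_fin (nrm2E H2) -(E_normH2E P (proj1 H2)).
  rewrite (two_step_error sX eB eS srep Hpsi Hups).
  apply: (@le_trans _ _ (\int[leb]_(th in freqI)
     (((2 * sbound * CT)%:E * normH2 (fun u => S th u - psistar m th u)%R) +
      ((2 * sbound * B m)%:E * normH2 (T th))))%E); last first.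
    have p1 : (0 <= (2 * sbound * CT)%:E)%E.
      by rewrite lee_fin mulr_ge0// mulr_ge0.
    have p2 : (0 <= (2 * sbound * B m)%:E)%E.
      by rewrite lee_fin mulr_ge0// mulr_ge0.
    rewrite ge0_integralD//; last 5 first.
    - exact: mF.
    - by move=> th _; rewrite mule_ge0// sqnorm_ge0.
    - by apply: measurable_funeM; exact: measurable_normH2.
    - by move=> th _; rewrite mule_ge0// sqnorm_ge0.
    - by apply: measurable_funeM; exact: measurable_normH2.
    rewrite !ge0_integralZl//; last 6 first.
    - exact: mF.
    - exact: measurable_normH2.
    - by move=> th _; exact: sqnorm_ge0.
    - exact: mF.
    - exact: measurable_normH2.
    - by move=> th _; exact: sqnorm_ge0.
    rewrite !sqnorm_uncurried// -(nrm2E HD) -(nrm2E (inL2_fpoly ls (Hups m))).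
    by rewrite -!EFinM -EFinD.
  apply: (@le_trans _ _ (\int[leb]_(th in freqI)
      (sdens th (S th) * (nrmH (T th))%:E))%E).
    rewrite le_eqVlt; apply/orP; left; apply/eqP; apply: eq_integral => th.
    rewrite inE => Fth; rewrite muleC sdens_seriesE -nneseriesZl; last first.
      by move=> n _; rewrite lee_fin mulr_ge0 ?sqmod_ge0// (lam_ge0 srep).
    apply: eq_eseriesr => n _; rewrite -EFinM; congr EFin.
    rewrite [RHS]mulrCA; congr (_ * _).
    rewrite (_ : (fun u => _) = (fun u => (- ipH (phi n th) (S th)) * T th u)).
      rewrite (nrm2Z mI _ (HT th)) sqmodN (ipC mI (HS th) (Hphi n Fth)) sqmodJ.
      by rewrite mulrC.
    by apply/funext => u; rewrite mul0r sub0r big_seq1 mulNr.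
  apply: ge0_le_integral.
  - exact: mF.
  - by move=> th Fth; rewrite mule_ge0 ?(sdens_ge0 srep)// lee_fin nrm2_ge0.
  - apply: emeasurable_funM; last exact: measurable_nrmH.
    apply: (eq_measurable_fun (fun th => sdens th (trigpoly (irange K) id (psi m) th))).
      move=> th _; congr (sdens th _); apply/funext => u.
      by rewrite /S fpolyE.
    exact: (measurable_sdens_trigpoly sX eB eS srep (irange K) id (Hpsi m)).
  - by apply: emeasurable_funD; apply: measurable_funeM; exact: measurable_normH2.
  - move=> th Fth; have [Hst stB] := psiB m Fth.
    have Hd := inL2B mI (HS th) Hst.
    rewrite /normH2 -(nrm2E Hd) -(nrm2E (HT th)) -!EFinM -EFinD.
    apply: (@le_trans _ _ ((sbound * nrmH (S th))%:E * (nrmH (T th))%:E)%E).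
      by apply: lee_wpmul2r; [rewrite lee_fin nrm2_ge0|exact: (sdens_le sX eB eS srep)].
    rewrite -EFinM lee_fin.
    have := nrm2D_le2 mI Hd Hst.
    rewrite (_ : (fun u => S th u - psistar m th u + psistar m th u) = S th); last first.
      by apply/funext => u; rewrite subrK.
    pose q := nrmH (fun u => S th u - psistar m th u); rewrite -/q => Sq.
    have q0 : 0 <= q by exact: nrm2_ge0.
    have n0 := nrm2_ge0 leb unitI (T th).
    apply: (@le_trans _ _ (sbound * (2 * q + 2 * B m) * nrmH (T th))).
      by rewrite ler_wpM2r// ler_wpM2l//; lra.
    have -> : sbound * (2 * q + 2 * B m) * nrmH (T th) =
      2 * sbound * nrmH (T th) * q + 2 * sbound * B m * nrmH (T th) by ring.
    have Hq : 2 * sbound * nrmH (T th) * q <= 2 * sbound * CT * q.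
      by rewrite ler_wpM2r//; apply: ler_wpM2l; [exact: mulr_ge0|exact: TC].
    by rewrite lerD2r; exact: Hq.
have d0 : dK K @[K --> \oo] --> (0 : R).
  exact: (L2_cvgP mUF (fun n => inL2_fpoly (irange n) (Hpsi m)) Hstar).1 (cpsi m).
have H2 K := inL2_two_step sX Hpsi Hups 0 t [:: m] ls (irange K).
have c1 := L2_cvg_nrm2 mm H2 (two_step_cvg 0 t [:: m] ls).
have c2 : 2 * sbound * CT * dK K + 2 * sbound * B m * tau @[K --> \oo] -->
    2 * sbound * CT * 0 + 2 * sbound * B m * tau.
  by apply: cvgD; [apply: cvgM => //; exact: cvg_cst|exact: cvg_cst].
rewrite mulr0 add0r in c2.
by apply: (ler_cvg_to c1 c2); apply: nearW => K; exact: key.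
Qed.

End pairs.
End filter_limits.

(** * The error of the reconstruction is a limit of errors of finite filters *)

Section classC_unpacked.
Context {R : realType}.
Local Notation leb := (@lebesgue_measure R).
Local Notation nrmH := (nrm2 leb unitI).
Local Notation mI := (@measurable_unitI R).
Local Notation mF := (@measurable_freqI R).

Lemma classC_response (psi : int -> R -> R[i]) : classC psi ->
  (forall l, inH (psi l)) /\ exists star B,
  L2_cvg (leb \x leb)%E (unitI `*` freqI)
    (fun N => uncurried (fpoly psi (irange N))) (uncurried star) /\
  forall th, freqI th -> inH (star th) /\ nrmH (star th) <= B.
Proof.
move=> [Hpsi [star [Hstar cstar bstar]]]; split => //.
set S := ereal_sup _ in bstar.
exists star, (fine S); split; first exact: classC_L2_cvg.
move=> th Fth.
have leS : (normH2 (star th) <= S)%E by apply: ereal_sup_ubound; exists th.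
have Hth : inH (star th).
  split; last exact: le_lt_trans leS bstar.
  by apply: (cmeasurable_section2 mI mF Fth (f := fun u th => star th u)); case: Hstar.
split => //; rewrite -lee_fin (nrm2E Hth) fineK// ge0_fin_numE//.
by apply: le_trans leS; exact: sqnorm_ge0.
Qed.

End classC_unpacked.

Section reconstructions.
Context {R : realType} {d : measure_display} {Om : measurableType d}
  (P : probability Om R).
Local Notation leb := (@lebesgue_measure R).
Local Notation ipH := (ip leb unitI).
Local Notation nrmH := (nrm2 leb unitI).
Local Notation mI := (@measurable_unitI R).
Local Notation mF := (@measurable_freqI R).
Local Notation mT := (@measurableT d Om).
Local Notation inL2Z' := (inL2 (P \x leb)%E (setT `*` unitI)).
Local Notation sqnormZ' := (sqnorm (P \x leb)%E (setT `*` unitI)).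
Local Notation nrm2Z' := (nrm2 (P \x leb)%E (setT `*` unitI)).
Local Notation cvgZ' := (L2_cvg (P \x leb)%E (setT `*` unitI)).
Local Notation mUF := (@measurable_UF R).

Variable X : int -> Om -> R -> R[i].
Hypothesis sX : weakly_stationary P X.
Variable e : nat -> R -> R[i].
Hypothesis eB : orthonormal_basis e.
Hypothesis eS : (\esum_(h in [set: int]) HSnorm e (autocov_op P X h) < +oo)%E.
Variables (lam : nat -> R -> R) (phi : nat -> R -> R -> R[i]).
Hypothesis srep : spectral_representation P X lam phi.
Hypothesis mphi : forall m, jointly_measurable (phi m).

Let X2 t : L2_random_element P (X t). Proof. by case: sX. Qed.
Let Hphi th m : freqI th -> inH (phi m th).
Proof. by move=> /srep[_ _ [H _] _]; exact: H. Qed.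

Let mm : measurable ([set: Om] `*` @unitI R : set (Om * measurableTypeR R)).
Proof. exact: (measurableX mT mI). Qed.

Lemma ms_cvgHP (s : nat -> Om -> R -> R[i]) Z :
  (forall n, inL2Z' (fun z => s n z.1 z.2)) ->
  ms_cvgH P s Z <-> cvgZ' (fun n z => s n z.1 z.2) (fun z => Z z.1 z.2).
Proof.
move=> Hs; have E (HZ : inL2Z' (fun z => Z z.1 z.2)) :
    (fun n => E_normH2 P (fun w u => s n w u - Z w u)) =
    (fun n => sqnormZ' (fun z => s n z.1 z.2 - Z z.1 z.2)).
  apply/funext => n; rewrite E_normH2E//.
  by apply: cmeasurableB; [case: (Hs n)|case: HZ].
split=> -[HZ H].
  have HZ' := (L2_random_elementE P Z).1 HZ.
  by split => //; move: H; rewrite (E HZ').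
by split; [exact/L2_random_elementE|rewrite (E HZ)].
Qed.

Variables psi ups : nat -> int -> R -> R[i].
Hypotheses (Cpsi : forall m, classC (psi m)) (Cups : forall m, classC (ups m)).

Let Hpsi m l : inH (psi m l). Proof. by have [H _] := Cpsi m. Qed.
Let Hups m l : inH (ups m l). Proof. by have [H _] := Cups m. Qed.

Let outer t m N w u : R[i] := \sum_(l <- irange N) score P X (psi m) (t + l) w * ups m l u.

Let half0 t m ls : half_step P X psi ups 0 t [:: m] ls =
  fun w u => - \sum_(l <- ls) score P X (psi m) (t + l) w * ups m l u.
Proof. by apply/funext => w; apply/funext => u; rewrite /half_step mul0r sub0r big_seq1. Qed.

Lemma reconstruction_cvg t m : (forall N, inL2Z' (fun z => outer t m N z.1 z.2)) /\
  cvgZ' (fun N z => outer t m N z.1 z.2)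
    (fun z => reconstruction P X (psi m) (ups m) t z.1 z.2).
Proof.
have sP n := (classC_response (Cpsi n)).2.
have [star /choice[B starP]] := choice sP.
have cpsi n := (starP n).1; have psiB n := (starP n).2.
have [ustar [UB [cups _]]] := (classC_response (Cups m)).2.
have Ho N : inL2Z' (fun z => outer t m N z.1 z.2).
  have := half_step_inL2 sX eB eS srep Hpsi Hups cpsi 0 t [:: m] (irange N).
  move/(inL2N); congr inL2; apply/funext => z.
  by rewrite half0 opprK.
split => //.
pose raw N w u := symsum (fun l => score P X (psi m) (t + l) w * ups m l u) N.
have rawE : raw = outer t m.
  by apply/funext => N; apply/funext => w; apply/funext => u; rewrite /raw symsumE.
apply/(ms_cvgHP _ Ho); rewrite -rawE.
apply: (@xgetPex _ _ [set Z | ms_cvgH P raw Z]); rewrite rawE.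
have [y Hy] : exists y, cvgZ' (fun N z => outer t m N z.1 z.2) y.
  apply: (L2_complete mm) => [//|ep e0].
  set c := 2 * sbound P X e * B m.
  have B0 : 0 <= B m.
    have F0 : freqI (0 : R) by rewrite /freqI /= in_itv /= oppr_le0 (ltW (pi_gt0 R)).
    by have [_] := psiB m 0 F0; apply: le_trans; exact: nrm2_ge0.
  have c0 : 0 <= c by rewrite mulr_ge0// mulr_ge0// sbound_ge0.
  have q0 : 0 < c + 1 by rewrite ltr_wpDl.
  have [|N NP] := L2_cvg_cauchy mUF _ cups (e := ep / (c + 1)) (divr_gt0 e0 q0).
    by move=> n; apply: inL2_fpoly; exact: Hups.
  exists N.
  have key a b : (N <= b)%N -> (b <= a)%N ->
      nrm2Z' (fun z => outer t m a z.1 z.2 - outer t m b z.1 z.2) <= ep.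
    move=> Nb ba.
    have := half_step_bound sX eB eS srep Hpsi Hups cpsi psiB t m
      [seq l <- irange a | (b < absz l)%N].
    rewrite half0 nrm2N => H.
    have -> : (fun z : Om * measurableTypeR R => outer t m a z.1 z.2 - outer t m b z.1 z.2) =
       (fun z => \sum_(l <- [seq l <- irange a | (b < absz l)%N])
         score P X (psi m) (t + l) z.1 * ups m l z.2).
      by apply/funext => z; rewrite /outer irange_split.
    apply: le_trans H _; rewrite -/c.
    have := NP a b (leq_trans Nb ba) Nb.
    have -> : (fun z => uncurried (fpoly (ups m) (irange a)) z -
        uncurried (fpoly (ups m) (irange b)) z) =
        uncurried (fpoly (ups m) [seq l <- irange a | (b < absz l)%N]).
      by apply/funext => z; rewrite /uncurried /fpoly irange_split.
    move=> H; apply: (@le_trans _ _ (c * (ep / (c + 1)))); first by rewrite ler_wpM2l.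
    by rewrite mulrCA ler_piMr ?(ltW e0)// ler_pdivrMr// mul1r lerDl.
  move=> a b Na Nb; case: (leqP b a) => [ba|/ltnW ab]; first exact: key.
  by rewrite nrm2BC; exact: key.
exists (fun w u => y (w, u)) => /=.
apply/(ms_cvgHP _ Ho); move: Hy; congr L2_cvg.
by apply/funext => -[].
Qed.

Let target t p w u : R[i] :=
  X t w u - \sum_(m < p) reconstruction P X (psi m) (ups m) t w u.

(** The truncation of the scores is removed before that of the reconstruction,
    in the order in which the limits are nested in [reconstruction]. *)
Lemma filter_limit t p : exists q : nat -> \bar R,
  (forall N, E_normH2 P (two_step X psi ups 1 t (index_iota 0 p) (irange N) (irange K))
     @[K --> \oo] --> q N) /\
  q N @[N --> \oo] --> E_normH2 P (target t p).
Proof.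
have sP n := (classC_response (Cpsi n)).2.
have [star /choice[B starP]] := choice sP.
have cpsi n := (starP n).1.
exists (fun N => sqnormZ' (fun z => half_step P X psi ups 1 t (index_iota 0 p) (irange N) z.1 z.2)).
split; first by move=> N; exact: (two_step_error_cvg sX eB eS srep Hpsi Hups cpsi).
have Hrec m : inL2Z' (fun z => reconstruction P X (psi m) (ups m) t z.1 z.2).
  by have [_ []] := reconstruction_cvg t m.
have Htame := tame_inL2 X2 t.
pose tgt (z : Om * measurableTypeR R) := 1 * tame X t z.1 z.2 -
  \sum_(m <- index_iota 0 p) reconstruction P X (psi m) (ups m) t z.1 z.2.
have Hh N := half_step_inL2 sX eB eS srep Hpsi Hups cpsi 1 t (index_iota 0 p) (irange N).
have cv : cvgZ' (fun N z => half_step P X psi ups 1 t (index_iota 0 p) (irange N) z.1 z.2) tgt.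
  have H1 : inL2Z' (fun z : Om * measurableTypeR R => 1 * tame X t z.1 z.2).
    exact: (inL2Z mm _ Htame).
  have Hs N : inL2Z' (fun z : Om * measurableTypeR R =>
      \sum_(m <- index_iota 0 p) outer t m N z.1 z.2).
    by apply: (inL2_sum mm) => m; have [] := reconstruction_cvg t m.
  apply: (@L2_cvgD _ _ _ _ _ mm (fun _ z => 1 * tame X t z.1 z.2)
    (fun N z => - \sum_(m <- index_iota 0 p) outer t m N z.1 z.2)).
  - by [].
  - by move=> N; exact: (inL2N (Hs N)).
  - exact: L2_cvg_cst.
  - apply: (L2_cvgN mm Hs); apply: (L2_cvg_sum mm) => [m N|m].
      by have [] := reconstruction_cvg t m.
    by have [] := reconstruction_cvg t m.
have -> : E_normH2 P (target t p) = sqnormZ' tgt; last exact: (L2_cvg_sqnorm mm Hh cv).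
have [mtgt _] : inL2Z' tgt by case: cv.
have mtarget : cmeasurable (setT `*` unitI) (fun z : Om * measurableTypeR R => target t p z.1 z.2).
  apply: cmeasurableB; first by case: (X2 t).
  by apply: cmeasurable_sum => m; case: (Hrec m).
pose tgt' w u := tgt (w, u).
have mtgt' : cmeasurable (setT `*` unitI) (fun z : Om * measurableTypeR R => tgt' z.1 z.2).
  by move: mtgt; congr cmeasurable; apply/funext => -[].
transitivity (E_normH2 P tgt').
  apply: ae_eq_integral => //.
  - exact: (measurable_sqnorm leb mT mI mtarget).
  - exact: (measurable_sqnorm leb mT mI mtgt').
  - apply: filterS (ae_tame X2 t) => w tw _; congr sqnorm; apply/funext => u.
    by rewrite /target /tgt' /tgt /= mul1r tw big_mkord.
by rewrite E_normH2E//; apply: eq_sqnorm => -[].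
Qed.

(** The error operator of the filter differs from the identity by an operator
    of rank at most [p], at every frequency. *)
Lemma two_step_lower_bound t p ls ks :
  (\sum_(p <= n <oo) \int[leb]_(th in freqI) (lam n th)%:E <=
   E_normH2 P (two_step X psi ups 1%R t (index_iota 0 p) ls ks))%E.
Proof.
have mlam n : measurable_fun freqI (fun th => (lam n th)%:E).
  by apply/measurable_EFinP; exact: (measurable_lam sX eB eS srep mphi).
have lam0 n th : freqI th -> (0 <= (lam n th)%:E)%E.
  by move=> Fth; rewrite lee_fin (lam_ge0 srep).
rewrite (two_step_error sX eB eS srep Hpsi Hups).
rewrite -nneseries_addn => [|n]; last by apply: integral_ge0 => th Fth; exact: lam0.
rewrite -integral_nneseries//; last 2 first.
- exact: mF.
- by move=> n th Fth; exact: lam0.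
apply: ge0_le_integral.
- exact: mF.
- by move=> th Fth; apply: nneseries_ge0 => n _ _; exact: lam0.
- by apply: ge0_emeasurable_sum => // n th Fth _; exact: lam0.
- exact: (measurable_two_step_residuals sX eB eS srep Hpsi Hups mphi).
- move=> th Fth; rewrite (@nneseries_addn _ (fun n => (lam n th)%:E))//; last first.
    by move=> n; exact: lam0.
  have := low_rank_bound mI (fun n => Hphi n Fth)
    (fun i j => phi_orthonormal srep i j Fth) (fun n => lam_ge0 srep n Fth)
    (fun m n mn => lam_anti srep Fth mn) p
    (fun n m => ipH (phi n th) (fpoly (psi m) ks th))
    (fun m => fpoly_inH (Hups m) ls th).
  move/le_trans; apply; rewrite le_eqVlt; apply/orP; left; apply/eqP.
  apply: eq_eseriesr => n _; congr (_ * _)%:E; congr nrm2; apply/funext => u.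
  by rewrite mul1r big_mkord.
Qed.

Lemma reconstruction_lower_bound t p :
  (\sum_(p <= n <oo) \int[leb]_(th in freqI) (lam n th)%:E <=
   E_normH2 P (fun w u =>
     (X t w u - \sum_(m < p) reconstruction P X (psi m) (ups m) t w u)%R))%E.
Proof.
have [q [q1 q2]] := filter_limit t p.
have L N : (\sum_(p <= n <oo) \int[leb]_(th in freqI) (lam n th)%:E <= q N)%E.
  apply: (lee_cvg_to (cvg_cst _) (q1 N)); apply: nearW => K.
  exact: two_step_lower_bound.
by apply: (lee_cvg_to (cvg_cst _) q2); apply: nearW => N; exact: L.
Qed.

End reconstructions.

(** * Completeness of the exponentials *)

Section complex_dominated_convergence.
Context {R : realType} {d : measure_display} {T : measurableType d}.
Variables (mu : {measure set T -> \bar R}) (D : set T).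
Hypothesis mD : measurable D.

Lemma cabs_le_ReIm (z : R[i]) : cabs z <= `|complex.Re z| + `|complex.Im z|.
Proof.
rewrite -ler_sqr ?nnegrE ?cabs_ge0 ?addr_ge0// cabs_sqr /sqmod.
rewrite sqrrD !real_normK ?num_real// lerD2r lerDl.
by rewrite mulrn_wge0// mulr_ge0.
Qed.

Lemma cintegrable_cabs (f : T -> R[i]) : cintegrable mu D f ->
  mu.-integrable D (EFin \o (fun x => `|complex.Re (f x)| + `|complex.Im (f x)|)).
Proof.
move=> [f1 f2]; have := integrableD mD (integrable_norm f1) (integrable_norm f2).
exact: eq_integrable_in.
Qed.

Lemma cintegrableM_bounded (f g : T -> R[i]) : cintegrable mu D f ->
  cmeasurable D g -> (forall x, D x -> sqmod (g x) <= 1) ->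
  cintegrable mu D (fun x => f x * g x).
Proof.
move=> Hf mg g1.
have key x : D x -> cabs (f x * g x) <= `|complex.Re (f x)| + `|complex.Im (f x)|.
  move=> Dx; rewrite cabsM; apply: le_trans (cabs_le_ReIm _).
  rewrite ler_piMr ?cabs_ge0//.
  by have := ler_wsqrtr (g1 x Dx); rewrite sqrtr1.
apply: (cintegrable_le mD _ (cintegrable_cabs Hf)).
- by apply: cmeasurableM => //; exact: cintegrable_measurable Hf.
- by move=> x Dx; apply: le_trans (Re_le_cabs _) (key x Dx).
- by move=> x Dx; apply: le_trans (Im_le_cabs _) (key x Dx).
Qed.

Lemma cdominated_convergence (F : nat -> T -> R[i]) (f : T -> R[i]) (g : T -> R) :
  (forall n, cmeasurable D (F n)) -> (forall x, D x -> ccvg (fun n => F n x) (f x)) ->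
  mu.-integrable D (EFin \o g) ->
  (forall n x, D x -> cabs (F n x) <= g x) ->
  cintegrable mu D f /\ ccvg (fun n => cintegral mu D (F n)) (cintegral mu D f).
Proof.
move=> mF Ff ig Fg; have mf : cmeasurable D f by exact: cmeasurable_ccvg Ff.
have aux (rF : nat -> T -> R) (rf : T -> R) :
    (forall n, measurable_fun D (rF n)) -> measurable_fun D rf ->
    (forall x, D x -> rF n x @[n --> \oo] --> rf x) ->
    (forall n x, D x -> `|rF n x| <= g x) ->
    mu.-integrable D (EFin \o rf) /\
    (\int[mu]_(x in D) rF n x) @[n --> \oo] --> \int[mu]_(x in D) rf x.
  move=> mrF mrf cv le.
  have [] := @dominated_convergence _ _ _ mu D mD (fun n => EFin \o rF n) (EFin \o rf) (EFin \o g).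
  - by move=> n; exact/measurable_EFinP.
  - exact/measurable_EFinP.
  - by apply: aeW => x Dx /=; apply: cvg_EFin; [exact: nearW|exact: cv].
  - exact: ig.
  - by apply: aeW => x n Dx /=; rewrite lee_fin le.
  move=> irf _ H; split => //; move: H; rewrite /Rintegral => H.
  by apply: fine_cvg; rewrite fineK//; exact: integrable_fin_num.
have [] := aux (fun n x => complex.Re (F n x)) (fun x => complex.Re (f x)).
- by move=> n; case: (mF n).
- by case: mf.
- by move=> x /Ff[].
- by move=> n x Dx; apply: le_trans (Re_le_cabs _) (Fg n x Dx).
move=> i1 c1.
have [] := aux (fun n x => complex.Im (F n x)) (fun x => complex.Im (f x)).
- by move=> n; case: (mF n).
- by case: mf.
- by move=> x /Ff[].
- by move=> n x Dx; apply: le_trans (Im_le_cabs _) (Fg n x Dx).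
by move=> i2 c2; split.
Qed.

End complex_dominated_convergence.

Section sign_iteration.
Context {R : realType}.

(** Its iterates are polynomials that map the interval from -1 to 1 into itself
    and converge there to the sign: 0, 1 and -1 are the fixed points, the first
    one repelling. *)
Definition sgstep (x : R) : R := (3 * x - x ^+ 3) / 2.

Lemma sgstep_bounds x : 0 <= x <= 1 -> x <= sgstep x <= 1.
Proof.
move=> /andP[x0 x1]; rewrite /sgstep.
have h1 : 0 <= x * (1 - x) * (1 + x) by rewrite !mulr_ge0 ?subr_ge0// addr_ge0.
have h2 : 0 <= (1 - x) ^+ 2 * (2 + x) by rewrite mulr_ge0 ?sqr_ge0// addr_ge0.
by apply/andP; split; nra.
Qed.

Lemma sgstepN x : sgstep (- x) = - sgstep x.
Proof. by rewrite /sgstep; ring. Qed.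

Lemma iter_sgstepN n x : iter n sgstep (- x) = - iter n sgstep x.
Proof. by elim: n => //= n ->; rewrite sgstepN. Qed.

Lemma iter_sgstep_bounds n x : 0 <= x <= 1 -> x <= iter n sgstep x <= 1.
Proof.
move=> /andP[x0 x1]; elim: n => [|n /andP[h1 h2]] /=; first by rewrite lexx.
have /andP[h3 h4] := @sgstep_bounds (iter n sgstep x) (introT andP (conj (le_trans x0 h1) h2)).
by rewrite h4 (le_trans h1 h3).
Qed.

Lemma iter_sgstep_le1 n x : `|x| <= 1 -> `|iter n sgstep x| <= 1.
Proof.
move=> x1; case: (leP 0 x) => x0.
  rewrite ger0_norm// in x1.
  have /andP[h1 h2] := @iter_sgstep_bounds n x (introT andP (conj x0 x1)).
  by rewrite ger0_norm// (le_trans x0).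
rewrite ltr0_norm// in x1; rewrite -normrN -iter_sgstepN.
have nx0 : 0 <= - x by rewrite oppr_ge0 ltW.
have /andP[h1 h2] := @iter_sgstep_bounds n (- x) (introT andP (conj nx0 x1)).
by rewrite ger0_norm// (le_trans nx0).
Qed.

Lemma iter_sgstep_cvg x : `|x| <= 1 -> iter n sgstep x @[n --> \oo] --> Num.sg x.
Proof.
have pos y : 0 < y -> y <= 1 -> iter n sgstep y @[n --> \oo] --> (1 : R).
  move=> y0 y1; pose u n := iter n sgstep y.
  have ub n : y <= u n <= 1 by apply: iter_sgstep_bounds; rewrite ltW.
  have ndu : {homo u : n m / (n <= m)%N >-> n <= m}.
    apply: homo_leq => [//|a b c|n]; first exact: le_trans.
    have /andP[h1 h2] := ub n.
    by have /andP[] := @sgstep_bounds (u n) (introT andP (conj (le_trans (ltW y0) h1) h2)).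
  have /cvg_ex[l ul] : cvgn u.
    by apply: nondecreasing_is_cvgn => //; exists 1 => _ [n _ <-]; case/andP: (ub n).
  have yl : y <= l by apply: (cvgr_to_ge ul); apply: nearW => n; case/andP: (ub n).
  have l1 : l <= 1 by apply: (cvgr_to_le ul); apply: nearW => n; case/andP: (ub n).
  have ul' : u n.+1 @[n --> \oo] --> sgstep l.
    rewrite /sgstep; apply: cvgM; last exact: cvg_cst.
    apply: cvgB; first by apply: cvgM => //; exact: cvg_cst.
    by apply: cvgM => //; apply: cvgM.
  have ul'' : u n.+1 @[n --> \oo] --> l.
    by move: ul; rewrite -(cvg_shiftS u).
  have E := @cvg_unique _ (@Rhausdorff R) _ _ _ _ ul' ul''.
  have l0 : 0 < l by exact: lt_le_trans yl.
  have {}E : sgstep l = l by exact: E.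
  have : l * ((1 - l) * (1 + l)) = 0.
    have -> : l * ((1 - l) * (1 + l)) = 2 * (sgstep l - l) by rewrite /sgstep; field.
    by rewrite E subrr mulr0.
  move/eqP; rewrite mulf_eq0 (gt_eqF l0) /= mulf_eq0 subr_eq0.
  rewrite (gt_eqF (addr_gt0 ltr01 l0)) orbF => /eqP L1.
  by move: ul; rewrite -L1.
move=> x1; case: (ltgtP x 0) => x0.
- rewrite ltr0_norm// in x1; rewrite ltr0_sg//.
  have -> : (fun n => iter n sgstep x) = (fun n => - iter n sgstep (- x)).
    by apply/funext => n; rewrite iter_sgstepN opprK.
  by apply: cvgN; apply: pos; rewrite ?oppr_gt0.
- by rewrite gtr0_sg//; apply: pos => //; rewrite gtr0_norm in x1.
- rewrite x0 sgr0; have -> : (fun n => iter n sgstep 0) = (fun=> 0).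
    by apply/funext => n; elim: n => //= n ->; rewrite /sgstep; ring.
  exact: cvg_cst.
Qed.

End sign_iteration.

Section fourier_uniqueness.
Context {R : realType}.
Local Notation leb := (@lebesgue_measure R).
Local Notation mF := (@measurable_freqI R).
Implicit Types (f g h : R -> R[i]).

Definition no_fourier f : Prop := cintegrable leb freqI f /\
  forall l : int, cintegral leb freqI (fun th => f th * expi (l%:~R * th)) = 0.

(** The space of functions with vanishing Fourier coefficients is a module over
    its multipliers, and the multipliers are easier to enlarge than the space
    of trigonometric polynomials: they are closed under dominated limits. *)
Definition multiplier g : Prop := cmeasurable freqI g /\
  forall f, no_fourier f -> no_fourier (fun th => f th * g th).

Lemma cintegrableM_expi f (l : int) : cintegrable leb freqI f ->
  cintegrable leb freqI (fun th => f th * expi (l%:~R * th)).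
Proof.
move=> Hf; apply: (cintegrableM_bounded mF Hf); first exact: cmeasurable_expi.
by move=> th _; rewrite sqmod_expi.
Qed.

Lemma multiplier_expi (k : int) : multiplier (fun th => expi (k%:~R * th)).
Proof.
split=> [|f [f1 f2]]; first exact: cmeasurable_expi.
split=> [|l]; first exact: cintegrableM_expi.
rewrite -[RHS](f2 (k + l)); apply: eq_cintegral => th _.
by rewrite -mulrA -expiD intrD mulrDl.
Qed.

Lemma multiplierM g h : multiplier g -> multiplier h ->
  multiplier (fun th => g th * h th).
Proof.
move=> [g1 g2] [h1 h2]; split=> [|f /g2/h2]; first exact: cmeasurableM.
by congr no_fourier; apply/funext => th; rewrite mulrA.
Qed.

Lemma multiplierD g h : multiplier g -> multiplier h ->
  multiplier (fun th => g th + h th).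
Proof.
move=> [g1 g2] [h1 h2]; split=> [|f nf]; first exact: cmeasurableD.
have [[i1 c1] [i2 c2]] := (g2 f nf, h2 f nf).
have -> : (fun th => f th * (g th + h th)) = (fun th => f th * g th + f th * h th).
  by apply/funext => th; rewrite mulrDr.
split=> [|l]; first exact: (cintegrableD mF i1 i2).
rewrite -[RHS](addr0 0) -{1}(c1 l) -(c2 l).
rewrite -(cintegralD mF (cintegrableM_expi l i1) (cintegrableM_expi l i2)).
by apply: eq_cintegral => th _; rewrite mulrDl.
Qed.

Lemma multiplierZ (c : R[i]) g : multiplier g -> multiplier (fun th => c * g th).
Proof.
move=> [g1 g2]; split=> [|f nf]; first exact: cmeasurableZ.
have [i1 c1] := g2 f nf.
have -> : (fun th => f th * (c * g th)) = (fun th => c * (f th * g th)).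
  by apply/funext => th; rewrite mulrCA.
split=> [|l]; first exact: (cintegrableZ mF c i1).
rewrite -[RHS](mulr0 c) -(c1 l).
rewrite -(cintegralZ mF c (cintegrableM_expi l i1)).
by apply: eq_cintegral => th _; rewrite -mulrA.
Qed.

Lemma multiplier1 : multiplier (fun=> 1).
Proof.
have := multiplier_expi 0; congr multiplier; apply/funext => th.
by rewrite mul0r expi0.
Qed.

Lemma multiplier_cst (c : R[i]) : multiplier (fun=> c).
Proof.
have := multiplierZ c multiplier1; congr multiplier; apply/funext => th.
exact: mulr1.
Qed.

Lemma multiplier_ccvg (G : nat -> R -> R[i]) g : (forall n, multiplier (G n)) ->
  (forall n th, freqI th -> sqmod (G n th) <= 1) ->
  (forall th, freqI th -> ccvg (fun n => G n th) (g th)) -> multiplier g.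
Proof.
move=> HG G1 Gg.
have mg : cmeasurable freqI g by apply: cmeasurable_ccvg Gg => n; case: (HG n).
split=> // f nf; have if_ := nf.1.
have key (l : int) : cintegrable leb freqI (fun th => f th * g th * expi (l%:~R * th)) /\
    ccvg (fun n => cintegral leb freqI (fun th => f th * G n th * expi (l%:~R * th)))
      (cintegral leb freqI (fun th => f th * g th * expi (l%:~R * th))).
  apply: (cdominated_convergence mF _ _ (cintegrable_cabs mF if_)).
  - move=> n; apply: cmeasurableM; last exact: cmeasurable_expi.
    by apply: cmeasurableM; [exact: cintegrable_measurable if_|case: (HG n)].
  - move=> th Fth; apply: ccvgM; last exact: ccvg_cst.
    by apply: ccvgM; [exact: ccvg_cst|exact: Gg].
  - move=> n th Fth; rewrite !cabsM cabs_expi mulr1.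
    apply: le_trans (cabs_le_ReIm _); rewrite ler_piMr ?cabs_ge0//.
    by have := ler_wsqrtr (G1 n th Fth); rewrite sqrtr1.
split=> [|l].
  have := (key 0).1; congr cintegrable; apply/funext => th.
  by rewrite mul0r expi0 mulr1.
apply: ccvg_unique (key l).2 _.
rewrite (_ : (fun n => _) = (fun=> 0)); first exact: ccvg_cst.
by apply/funext => n; have [_ ->] := (HG n).2 f nf.
Qed.

(** Lets the sign of [half_angle], which vanishes at the end points of the
    period and at [a], represent the indicator of a ray. *)
Lemma multiplier_ae g h : multiplier g -> cmeasurable freqI h ->
  (forall th, freqI th -> sqmod (h th) <= 1) ->
  {ae leb, forall th, freqI th -> g th = h th} -> multiplier h.
Proof.
move=> [mg Hg] mh h1 gh; split=> // f nf.
have ih := cintegrableM_bounded mF nf.1 mh h1.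
split=> // l; have [ig c] := Hg f nf; rewrite -[RHS](c l); apply: (ae_eq_cintegral mF).
- exact: cintegrable_measurable (cintegrableM_expi l ih).
- exact: cintegrable_measurable (cintegrableM_expi l ig).
- by apply: filterS gh => th H Fth; rewrite H.
Qed.

(** On the open period this has the sign of [th - a]; the second factor makes
    it a trigonometric polynomial of integral frequencies. *)
Definition half_angle (a th : R) : R := sin ((th - a) / 2) * cos (th / 2).

Lemma half_angleE a th :
  half_angle a th = (sin (th - a / 2) - sin (a / 2)) / 2.
Proof.
have -> : th - a / 2 = (th - a) / 2 + th / 2 by field.
have -> : a / 2 = - ((th - a) / 2 - th / 2) by field.
by rewrite sinN sinB sinD /half_angle; field.
Qed.

Lemma multiplier_half_angle a : multiplier (fun th => (half_angle a th)%:C).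
Proof.
pose b := a / 2.
have := multiplierD (multiplierD
  (multiplierZ ((0 +i* (- (1 / 4))) * expi (- b)) (multiplier_expi 1))
  (multiplierZ ((0 +i* (1 / 4)) * expi b) (multiplier_expi (-1))))
  (multiplier_cst (- (sin b / 2))%:C).
congr multiplier; apply/funext => th.
rewrite half_angleE -/b -!mulrA -!expiD rmorphN1 mulN1r.
have -> : b - th = - (th - b) by rewrite opprB.
have -> : - b + 1%:~R * th = th - b by rewrite mul1r addrC.
by apply: eq_ReIm; rewrite !cE /= ?sinN ?cosN ?mul0r; field.
Qed.

Lemma half_angle_le1 a th : `|half_angle a th| <= 1.
Proof.
rewrite /half_angle normrM mulr_ile1//.
- by rewrite ler_norml sin_geN1 sin_le1.
- by rewrite ler_norml cos_geN1 cos_le1.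
Qed.

Lemma multiplier_sg_half_angle a : multiplier (fun th => (Num.sg (half_angle a th))%:C).
Proof.
apply: (@multiplier_ccvg (fun n th => (iter n sgstep (half_angle a th))%:C)).
- elim=> [|n IH] /=; first exact: multiplier_half_angle.
  have := multiplierD (multiplierZ (3 / 2)%:C IH)
    (multiplierZ (- (1 / 2))%:C (multiplierM IH (multiplierM IH IH))).
  congr multiplier; apply/funext => th.
  by rewrite -!rmorphM -rmorphD /=; congr (_%:C); rewrite /sgstep; field.
- move=> n th _; rewrite /sqmod /= expr0n addr0.
  rewrite -(real_normK (num_real _)) expr_le1//.
  exact/iter_sgstep_le1/half_angle_le1.
- move=> th _; split => /=; last exact: cvg_cst.
  exact/iter_sgstep_cvg/half_angle_le1.
Qed.

Definition indC (A : set R) (th : R) : R[i] := (\1_A th)%:C.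

Lemma sqmod_indC A th : sqmod (indC A th) <= 1.
Proof.
by rewrite /sqmod /= expr0n addr0 indicE; case: (_ \in _); rewrite ?expr1n ?expr0n.
Qed.

Lemma cmeasurable_indC (A : set (measurableTypeR R)) : measurable A ->
  cmeasurable freqI (indC A).
Proof. by move=> mA; apply: cmeasurableC; exact: measurable_indic. Qed.

Lemma ae_freqI_neq (b : R) : {ae leb, forall th, freqI th -> th != b}.
Proof.
exists [set b]; split; first exact: measurable_set1.
  exact: lebesgue_measure_set1.
by move=> th /= /not_implyP[_ /negP]; rewrite negbK => /eqP.
Qed.

Lemma multiplier_ray (a : R) : multiplier (indC `]a, +oo[).
Proof.
have indE th : indC `]a, +oo[ th = (a < th)%R%:R.
  by rewrite /indC indicE mem_setE /= in_itv /= andbT; case: (a < th).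
have mA : measurable (`]a, +oo[ : set (measurableTypeR R)) by exact: measurable_itv.
case: (leP pi a) => api.
  apply: (multiplier_ae (multiplier_cst 0)).
  - exact: cmeasurable_indC.
  - by move=> th _; exact: sqmod_indC.
  apply: aeW => th; rewrite /freqI /= in_itv /= indE => /andP[_ h].
  by rewrite ltNge (le_trans h api).
case: (leP a (- pi)) => apiN.
  apply: (multiplier_ae (multiplier_cst 1)).
  - exact: cmeasurable_indC.
  - by move=> th _; exact: sqmod_indC.
  apply: filterS (ae_freqI_neq (- pi)) => th H Fth; have := H Fth.
  move: Fth; rewrite /freqI /= in_itv /= indE => /andP[h _ thN].
  by rewrite (le_lt_trans apiN)// lt_neqAle eq_sym thN.
apply: (multiplier_ae (multiplierD (multiplier_cst (1 / 2)%:C)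
  (multiplierZ (1 / 2)%:C (multiplier_sg_half_angle a)))).
- exact: cmeasurable_indC.
- by move=> th _; exact: sqmod_indC.
apply: filterS (filterI (ae_freqI_neq a) (filterI (ae_freqI_neq pi)
  (ae_freqI_neq (- pi)))) => th [Ha [H1 H2]] Fth; move: (Ha Fth) (H1 Fth) (H2 Fth).
move: Fth; rewrite /freqI /= in_itv /= indE => /andP[h1 h2] tha th1 th2.
have {}h1 : - pi < th by rewrite lt_neqAle eq_sym th2.
have {}h2 : th < pi by rewrite lt_neqAle th1.
have c0 : 0 < cos (th / 2) by apply: cos_gt0_pihalf; apply/andP; split; lra.
rewrite /half_angle sgrM (gtr0_sg c0) mulr1.
case: (ltgtP a th) => [ath|tha'|E]; last by rewrite E eqxx in tha.
- rewrite gtr0_sg; first by rewrite -rmorphM -rmorphD /= mulr1; congr (_%:C); field.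
  by apply: sin_gt0_pi; apply/andP; split; lra.
- rewrite ltr0_sg; first by rewrite -rmorphM -rmorphD /= mulrN1 subrr.
  rewrite -oppr_gt0 -sinN; apply: sin_gt0_pi; apply/andP; split; lra.
Qed.

(** A monotone class argument: the indicators among the multipliers form a
    sigma-algebra, and it contains the rays. *)
Lemma multiplier_measurable (A : set (measurableTypeR R)) : measurable A ->
  multiplier (indC A).
Proof.
pose G : set (set R) := [set A | measurable (A : set (measurableTypeR R)) /\ multiplier (indC A)].
suff H : measurable `<=` G by move=> /H[].
have -> : measurable = <<s (RGenOInfty.G (R := R)) >> by exact: RGenOInfty.measurableE.
have GC B : G B -> G (~` B).
  move=> [mB HB]; split; first exact: measurableC.
  have := multiplierD multiplier1 (multiplierZ (-1) HB); congr multiplier.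
  apply/funext => th; rewrite /indC !indicE in_setC.
  by case: (_ \in _); apply: eq_ReIm; rewrite !cE /=; ring.
have GI B C : G B -> G C -> G (B `&` C).
  move=> [mB HB] [mC HC]; split; first exact: measurableI.
  have := multiplierM HB HC; congr multiplier; apply/funext => th.
  rewrite /indC !indicE in_setI.
  by case: (_ \in B); case: (_ \in C); apply: eq_ReIm; rewrite !cE /=; ring.
apply: smallest_sub; last first.
  move=> _ [a ->]; split; [exact: measurable_itv|exact: multiplier_ray].
split.
- split; first exact: measurable0.
  have := multiplier_cst 0; congr multiplier; apply/funext => th.
  by rewrite /indC indicE in_set0.
- by move=> B GB; rewrite setTD; exact: GC.
- move=> B GB; split; first by apply: bigcup_measurable => n _; case: (GB n).
  have GU n : G (\big[setU/set0]_(i < n) B i).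
    elim: n => [|n IH].
      rewrite big_ord0; split; first exact: measurable0.
      have := multiplier_cst 0; congr multiplier; apply/funext => th.
      by rewrite /indC indicE in_set0.
    rewrite big_ord_recr /= -[X in G X]setCK setCU; apply: (GC).
    by apply: GI; apply: (GC).
  apply: (@multiplier_ccvg (fun n => indC (\big[setU/set0]_(i < n) B i))).
  + by move=> n; case: (GU n).
  + by move=> n th _; exact: sqmod_indC.
  + move=> th _; case: (pselect ((\bigcup_n B n) th)) => [[k _ Bk]|nB].
      apply: (@ccvg_near_eq _ _ _ k.+1) => n kn.
      rewrite /indC !indicE mem_set; first by rewrite mem_set//; exists k.
      by rewrite -bigcup_mkord; exists k.
    apply: (@ccvg_near_eq _ _ _ 0) => n _.
    rewrite /indC !indicE memNset; first by rewrite memNset.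
    by rewrite -bigcup_mkord => -[k _ Bk]; apply: nB; exists k.
Qed.

Lemma no_fourier_ae0 f : no_fourier f -> {ae leb, forall th, freqI th -> f th = 0}.
Proof.
move=> nf; have [[if1 if2] _] := nf.
have key (A : set (measurableTypeR R)) : measurable A -> A `<=` freqI ->
    cintegral leb A f = 0.
  move=> mA AF; have [_ Hm] := multiplier_measurable mA.
  rewrite -[RHS]((Hm f nf).2 0).
  have E : (fun th => f th * indC A th * expi (0%:~R * th)) = (fun th => f th * indC A th).
    by apply/funext => th; rewrite mul0r expi0 mulr1.
  rewrite E /cintegral; congr (_ +i* _); rewrite /Rintegral; congr fine.
  - rewrite -{1}(setIidr AF) integral_mkcondr; apply: eq_integral => th _.
    by rewrite patchE /indC indicE; case: (_ \in A); rewrite !cE /= ?mulr1 ?mulr0 ?subr0.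
  - rewrite -{1}(setIidr AF) integral_mkcondr; apply: eq_integral => th _.
    rewrite patchE /indC indicE; case: (_ \in A); rewrite !cE /= ?mulr1 ?mulr0 ?add0r ?addr0//.
have aux (g : R -> R) : leb.-integrable freqI (EFin \o g) ->
    (forall A : set (measurableTypeR R), measurable A -> A `<=` freqI ->
      (\int[leb]_(x in A) g x = 0)%R) ->
    {ae leb, forall th, freqI th -> g th = 0}.
  move=> ig g0.
  have H := @integral_ae_eq _ _ _ leb _ mF (cst 0%E) (EFin \o g) ig (measurable_cst _) _.
  have : ae_eq leb freqI (EFin \o g) (cst 0%E).
    apply: H => A AF mA; rewrite integral_cst// mul0e.
    have igA := integrableS mF mA AF ig.
    have := congr1 EFin (g0 A mA AF); rewrite /Rintegral fineK//.
    exact: integrable_fin_num.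
  by apply: filterS => th /= E Fth; case: (E Fth).
have h1 := aux _ if1 (fun A mA AF => congr1 (@complex.Re R) (key A mA AF)).
have h2 := aux _ if2 (fun A mA AF => congr1 (@complex.Im R) (key A mA AF)).
by apply: filterS2 h1 h2 => th H1 H2 Fth; apply: eq_ReIm; [exact: H1|exact: H2].
Qed.

End fourier_uniqueness.

Section fourier_series.
Context {R : realType}.
Local Notation leb := (@lebesgue_measure R).
Local Notation mF := (@measurable_freqI R).
Local Notation nrmF := (nrm2 leb freqI).
Local Notation ipF := (ip leb freqI).
Implicit Types (f : R -> R[i]).

Definition fcoef f (l : int) : R[i] :=
  ((2 * pi)^-1)%:C * cintegral leb freqI (fun s => f s * expi (- (l%:~R * s))).

Definition fourier_partial f N (th : R) : R[i] :=
  \sum_(l <- irange N) fcoef f l * expi (l%:~R * th).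

(* The exponentials normalised in mean square over a period. *)
Let ex (l : int) (th : R) : R[i] := ((Num.sqrt (2 * pi))^-1)%:C * expi (l%:~R * th).

Let ex_inL2 l : inL2 leb freqI (ex l).
Proof. exact: (inL2Z mF _ (inL2_expi l)). Qed.

Let sq2pi : (Num.sqrt (2 * pi))^-1 * (Num.sqrt (2 * pi))^-1 = (2 * pi)^-1 :> R.
Proof. by rewrite -invfM -expr2 sqr_sqrtr// ltW// twopi_gt0. Qed.

Let ex_ortho (j k : int) : ipF (ex j) (ex k) = (j == k)%:R.
Proof.
rewrite (ipZl mF _ (inL2_expi j) (ex_inL2 k)) (ipZr mF _ (inL2_expi k) (inL2_expi j)).
rewrite ip_expi; case: (j == k); last by rewrite !mulr0.
rewrite conjc_real mulrA -!rmorphM /= sq2pi mulVf//.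
by rewrite gt_eqF// twopi_gt0.
Qed.

Let fcoef_ex f l th : inL2 leb freqI f ->
  fcoef f l * expi (l%:~R * th) = ipF f (ex l) * ex l th.
Proof.
move=> Hf; rewrite (ipZr mF _ (inL2_expi l) Hf) conjc_real /ex mulrACA.
rewrite -rmorphM /= sq2pi mulrA /fcoef ipE; congr (_ * _ * _).
apply: eq_cintegral => s _; by rewrite conjc_expi.
Qed.

Let partialE f N : inL2 leb freqI f -> fourier_partial f N =
  fun th => \sum_(l <- irange N) ipF f (ex l) * ex l th.
Proof.
move=> Hf; apply/funext => th; apply: eq_bigr => l _; exact: fcoef_ex.
Qed.

Lemma inL2_fourier_partial f N : inL2 leb freqI f -> inL2 leb freqI (fourier_partial f N).
Proof.
by move=> Hf; apply: (inL2_sum mF) => l; exact: (inL2Z mF _ (inL2_expi l)).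
Qed.

Lemma nrm2_fourier_partial_le f N : inL2 leb freqI f ->
  nrmF (fun th => fourier_partial f N th - f th) <= nrmF f.
Proof.
move=> Hf; rewrite nrm2BC partialE//.
rewrite (nrm2_projection mF ex_inL2 ex_ortho (irange_uniq N) Hf).
by rewrite gerBl; apply: sumr_ge0 => l _; exact: sqmod_ge0.
Qed.

Lemma fcoef_bessel f l : inL2 leb freqI f -> 2 * pi * sqmod (fcoef f l) <= nrmF f.
Proof.
move=> Hf; have := bessel mF ex_inL2 ex_ortho (isT : uniq [:: l]) Hf.
rewrite big_seq1; apply: le_trans.
rewrite -[X in 2 * pi * X]mulr1 -(sqmod_expi (l%:~R * 0)) -sqmodM fcoef_ex// sqmodM.
rewrite mulrCA -[leRHS]mulr1 ler_wpM2l ?sqmod_ge0//.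
rewrite /ex sqmodM sqmod_expi mulr1 /sqmod /= expr0n addr0 expr2 sq2pi divff//.
by rewrite gt_eqF// twopi_gt0.
Qed.

(** The partial sums are Cauchy by Bessel's inequality; the difference between
    [f] and their limit has vanishing Fourier coefficients. *)
Theorem fourier_partial_cvg f : inL2 leb freqI f -> L2_cvg leb freqI (fourier_partial f) f.
Proof.
move=> Hf; pose a N := \sum_(l <- irange N) sqmod (ipF f (ex l)).
have HS N := inL2_fourier_partial N Hf.
have [l Hl] : exists l, L2_cvg leb freqI (fourier_partial f) l.
  apply: (L2_complete mF) => [//|ep e0].
  have nda : {homo a : n m / (n <= m)%N >-> n <= m}.
    move=> n m nm; rewrite -subr_ge0 irange_split//.
    by apply: sumr_ge0 => h _; exact: sqmod_ge0.
  have : cvgn a.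
    apply: nondecreasing_is_cvgn => //; exists (nrmF f) => _ [n _ <-].
    exact: (bessel mF ex_inL2 ex_ortho (irange_uniq n) Hf).
  move=> /cvg_ex[a_ al]; have ep2 : 0 < ep / 2 by rewrite divr_gt0.
  have /cvgrPdist_le /(_ _ ep2) [N _ NP] := al.
  have key m n : (N <= n)%N -> (n <= m)%N ->
      nrmF (fun th => fourier_partial f m th - fourier_partial f n th) <= ep.
    move=> Nn nm.
    rewrite (_ : (fun th => _) = (fun th => \sum_(l <- [seq l <- irange m | (n < absz l)%N])
        ipF f (ex l) * ex l th)); last first.
      by apply/funext => th; rewrite !partialE// irange_split.
    rewrite (nrm2_orthonormal_sum mF ex_inL2 ex_ortho); last first.
      by rewrite filter_uniq ?irange_uniq.
    rewrite -irange_split//; have := NP n Nn; have := NP m (leq_trans Nn nm).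
    by rewrite -/(a m) -/(a n) /= !ler_distl; lra.
  exists N => m n Nm Nn; case: (leqP n m) => nm; first exact: key.
  by rewrite nrm2BC; apply: key => //; exact: ltnW.
have [HL _] := Hl; pose g th := f th - l th.
have Hg : inL2 leb freqI g by exact: (inL2B mF).
have coef k : ipF g (ex k) = 0.
  rewrite (ipBl mF Hf HL (ex_inL2 k)).
  have -> : ipF l (ex k) = ipF f (ex k); last by rewrite subrr.
  apply: ccvg_unique (L2_cvg_ip mF HS Hl (ex_inL2 k)) _.
  apply: (@ccvg_near_eq _ _ _ (absz k)) => N kN; rewrite partialE//.
  by rewrite (ip_orthonormal_sum mF ex_inL2 ex_ortho (irange_uniq N))// mem_irange.
have g0 : {ae leb, forall th, freqI th -> g th = 0}.
  apply: no_fourier_ae0; split; first exact: inL2_cintegrable_freqI.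
  move=> k; have := coef (- k); rewrite (ipZr mF _ (inL2_expi _) Hg) conjc_real.
  move/eqP; rewrite mulf_eq0 => /orP[/eqP/(congr1 (@complex.Re R))/= /eqP|/eqP].
    by rewrite invr_eq0 gt_eqF// sqrtr_gt0 twopi_gt0.
  move=> <-; rewrite ipE; apply: eq_cintegral => th _.
  by rewrite conjc_expi rmorphN mulNr opprK.
split => //; have [_ Hl2] := Hl.
suff E N : sqnorm leb freqI (fun th => fourier_partial f N th - f th) =
    sqnorm leb freqI (fun th => fourier_partial f N th - l th) by under eq_fun do rewrite E.
apply: (ae_eq_sqnorm mF).
- exact: (inL2_meas (inL2B mF (HS N) Hf)).
- exact: (inL2_meas (inL2B mF (HS N) HL)).
by apply: filterS g0 => th + Fth => /(_ Fth)/eqP; rewrite subr_eq0 => /eqP ->.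
Qed.

End fourier_series.

(** * Fourier coefficients in frequency of a family of elements of [H] *)

Section fourier_coefficients.
Context {R : realType}.
Local Notation leb := (@lebesgue_measure R).
Local Notation nrmH := (nrm2 leb unitI).
Local Notation mI := (@measurable_unitI R).
Local Notation mF := (@measurable_freqI R).
Local Notation mUF := (@measurable_UF R).
Local Notation sqnormF f := (sqnorm (leb \x leb)%E (unitI `*` freqI) (uncurried f)).

Variable f : R -> R -> R[i].
Hypothesis Hf : inL2 (leb \x leb)%E (unitI `*` freqI) (uncurried f).

Let mf : jointly_measurable f. Proof. by case: Hf. Qed.

Let sq u : \bar R := sqnorm leb freqI (f ^~ u).

Let sq0 u : (0 <= sq u)%E. Proof. exact: sqnorm_ge0. Qed.

Let msq : measurable_fun unitI sq.
Proof. exact: (measurable_sqnorm leb mI mF (f := fun u th => f th u) mf). Qed.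

Let int_sq : (\int[leb]_(u in unitI) sq u = sqnormF f)%E.
Proof. by rewrite -(sqnorm_prod leb leb mI mF (f := fun u th => f th u) mf). Qed.

Let isq : leb.-integrable unitI sq.
Proof.
apply/integrableP; split; first exact: msq.
have -> : (\int[leb]_(u in unitI) `|sq u| = \int[leb]_(u in unitI) sq u)%E.
  by apply: eq_integral => u _; rewrite gee0_abs.
by rewrite int_sq; case: Hf.
Qed.

Let section_inL2 u : unitI u -> inL2 leb freqI (f ^~ u) <-> (sq u < +oo)%E.
Proof.
move=> Iu; split=> [[]//|H]; split => //.
exact: (cmeasurable_section mI mF Iu (f := fun u th => f th u) mf).
Qed.

Lemma fourier_coefE l u : inL2 leb freqI (f ^~ u) ->
  fourier_coef f l u = fcoef (f ^~ u) l.
Proof. by move=> H; rewrite /fourier_coef asboolT. Qed.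

Lemma sqmod_fourier_coef_le l u : unitI u ->
  ((sqmod (fourier_coef f l u))%:E <= ((2 * pi)^-1)%:E * sq u)%E.
Proof.
move=> Iu; have tp := @twopi_gt0 R.
have ip0 : (0 <= ((2 * pi)^-1)%:E :> \bar R)%E by rewrite lee_fin invr_ge0 ltW.
case: (pselect (inL2 leb freqI (f ^~ u))) => [H|nH].
  rewrite fourier_coefE// /sq -(nrm2E H) -EFinM lee_fin.
  by rewrite ler_pdivlMl//; exact: fcoef_bessel.
by rewrite /fourier_coef asboolF// sqmod0; exact: mule_ge0.
Qed.

(** Bessel's inequality for each section bounds the norm of the coefficient by
    that of the family. *)
Lemma fourier_coef_inH l : inH (fourier_coef f l).
Proof.
pose A : set (measurableTypeR R) := unitI `&` [set u | (sq u < +oo)%E].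
have mA : measurable A by exact: (emeasurable_fun_infty_o mI msq).
have mc : cmeasurable unitI (fun u => fcoef (f ^~ u) l).
  apply: cmeasurableZ.
  apply: (cmeasurable_cintegral leb mI mF
    (f := fun u s => f s u * expi (- (l%:~R * s)))).
  apply: cmeasurableM; first exact: mf.
  apply: (cmeasurable_snd unitI mF (g := fun s => expi (- (l%:~R * s)))).
  have := @cmeasurable_expi R freqI (- l%:~R); congr cmeasurable.
  by apply/funext => s; rewrite mulNr.
have mfc : cmeasurable unitI (fourier_coef f l).
  have Hi : cmeasurable unitI (fun u => fcoef (f ^~ u) l * (\1_A u)%:C).
    by apply: cmeasurableM => //; apply: cmeasurableC; exact: measurable_indic.
  have E u : unitI u -> fcoef (f ^~ u) l * (\1_A u)%:C = fourier_coef f l u.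
    move=> Iu; rewrite indicE; case: (pselect (inL2 leb freqI (f ^~ u))) => [H|nH].
      rewrite fourier_coefE// mem_set ?mulr1//.
      by split => //; apply/section_inL2.
    rewrite /fourier_coef asboolF// memNset ?mulr0//.
    by move=> [_ /section_inL2 H]; apply: nH; exact: H.
  case: Hi => H1 H2; split.
  - by apply: eq_measurable_fun H1 => u; rewrite inE => Iu; rewrite E.
  - by apply: eq_measurable_fun H2 => u; rewrite inE => Iu; rewrite E.
split => //.
apply: (@le_lt_trans _ _ (\int[leb]_(u in unitI) (((2 * pi)^-1)%:E * sq u))%E).
  apply: ge0_le_integral.
  - exact: mI.
  - by move=> u _; rewrite lee_fin sqmod_ge0.
  - exact: measurable_sqmodE.
  - exact: measurable_funeM.
  - by move=> u Iu; exact: sqmod_fourier_coef_le.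
have [_ fin] := Hf.
rewrite ge0_integralZl//; last 2 first.
- exact: mI.
- by rewrite lee_fin invr_ge0 ltW// twopi_gt0.
by rewrite int_sq -(nrm2E Hf) -EFinM ltry.
Qed.

Let fp N := fpoly (fourier_coef f) (irange N).

Let jm_fp N : jointly_measurable (fp N).
Proof. by apply: jointly_measurable_fpoly => l; exact: fourier_coef_inH. Qed.

Let fpE u N : inL2 leb freqI (f ^~ u) -> (fp N)^~ u = fourier_partial (f ^~ u) N.
Proof.
move=> H; apply/funext => th; apply: eq_bigr => l _.
by rewrite fourier_coefE.
Qed.

(** Tonelli reduces the claim to the Fourier series of the sections, where the
    error is dominated by the squared norm of the section. *)
Lemma fourier_coef_cvg :
  L2_cvg (leb \x leb)%E (unitI `*` freqI)
    (fun N => uncurried (fpoly (fourier_coef f) (irange N))) (uncurried f).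
Proof.
split => //.
pose G N u := sqnorm leb freqI (fun th => fp N th u - f th u).
have mD N : jointly_measurable (fun th u => fp N th u - f th u) by exact: (cmeasurableB (jm_fp N) mf).
have mG N : measurable_fun unitI (G N).
  exact: (measurable_sqnorm leb mI mF (f := fun u th => fp N th u - f th u) (mD N)).
have E N : sqnormF (fun th u => fp N th u - f th u) = (\int[leb]_(u in unitI) G N u)%E.
  by rewrite -(sqnorm_prod leb leb mI mF (f := fun u th => fp N th u - f th u) (mD N)).
have -> : (fun N => sqnorm (leb \x leb)%E (unitI `*` freqI)
    (fun z => uncurried (fpoly (fourier_coef f) (irange N)) z - uncurried f z)) =
    (fun N => \int[leb]_(u in unitI) G N u)%E.
  by apply/funext => N; rewrite -E.
have aeA : {ae leb, forall u, unitI u -> inL2 leb freqI (f ^~ u)}.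
  apply: filterS (integrable_ae mI isq) => u H Iu; apply/section_inL2 => //.
  by have := H Iu; rewrite ge0_fin_numE.
have := @dominated_convergence _ _ _ leb unitI mI G (fun=> 0%E) sq mG (measurable_cst _).
case.
- apply: filterS aeA => u H Iu; have Hu := H Iu.
  have [_ c] := fourier_partial_cvg Hu.
  rewrite (_ : G ^~ u = (fun N => sqnorm leb freqI
    (fun th => fourier_partial (f ^~ u) N th - f th u)))//.
  by apply/funext => N; rewrite /G -fpE.
- exact: isq.
- apply: filterS aeA => u H N Iu; have Hu := H Iu.
  rewrite gee0_abs; last exact: sqnorm_ge0.
  have HP := inL2_fourier_partial N Hu.
  have -> : G N u = sqnorm leb freqI (fun th => fourier_partial (f ^~ u) N th - f th u).
    by rewrite /G -fpE.
  rewrite /sq -(nrm2E (inL2B mF HP Hu)) -(nrm2E Hu) lee_fin.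
  exact: nrm2_fourier_partial_le.
- by move=> _ _; rewrite integral0.
Qed.

Lemma fourier_coef_classC (M : R) :
  (forall th, freqI th -> inH (f th) /\ nrmH (f th) <= M) -> classC (fourier_coef f).
Proof.
move=> fM; split; first exact: fourier_coef_inH.
exists f; split; first exact: Hf.
- have [_ H] := fourier_coef_cvg; move: H.
  rewrite (_ : (fun N => sqnorm _ _ _) = (fun N => \int[leb]_(theta in freqI)
     normH2 (fun u => (fourier_sum (fourier_coef f) N theta u - f theta u)%R))%E)//.
  apply/funext => N.
  rewrite -[LHS](@sqnorm_uncurried _ (fun th u => fp N th u - f th u)).
    by apply: eq_integral => th _; rewrite fourier_sumE.
  exact: (cmeasurableB (jm_fp N) mf).
- apply: (@le_lt_trans _ _ M%:E); last exact: ltry.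
  apply: ge_ereal_sup => _ [th Fth <-]; have [Hth le] := fM th Fth.
  by rewrite /normH2 -(nrm2E Hth) lee_fin.
Qed.

End fourier_coefficients.

(** * Perturbed projections *)

Section perturbed_projections.
Context {R : realType} {d : measure_display} {T : measurableType d}.
Variables (mu : {measure set T -> \bar R}) (D : set T).
Hypothesis mD : measurable D.
Local Notation inL2 := (inL2 mu D).
Local Notation nrm2 := (nrm2 mu D).
Local Notation ip := (ip mu D).

(* In [ip (f n) (h m) * g m] the [g m] and [h m] stand for two different
   approximations of the same orthonormal [f m]. *)
Variables (f g h : nat -> T -> R[i]) (lam : nat -> R) (L : R).
Hypotheses (Hf : forall n, inL2 (f n)) (Hg : forall n, inL2 (g n))
  (Hh : forall n, inL2 (h n)) (ff : forall i j, ip (f i) (f j) = (i == j)%:R)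
  (lam0 : forall n, 0 <= lam n) (lamL : forall n, lam n <= L).

Let nf n : nrm2 (f n) = 1.
Proof. by have := ff n n; rewrite eqxx ipxx// => /(congr1 (@complex.Re R)). Qed.

Let L0 : 0 <= L. Proof. exact: le_trans (lam0 0) (lamL 0). Qed.

Lemma weighted_bessel N x : inL2 x ->
  \sum_(0 <= n < N) lam n * sqmod (ip (f n) x) <= L * nrm2 x.
Proof.
move=> Hx; apply: (@le_trans _ _ (L * \sum_(0 <= n < N) sqmod (ip (f n) x))).
  by rewrite mulr_sumr; apply: ler_sum => n _; rewrite ler_wpM2r ?sqmod_ge0.
rewrite ler_wpM2l//; have := bessel mD Hf ff (iota_uniq 0 (N - 0)) Hx.
apply: le_trans; rewrite le_eqVlt; apply/orP; left; apply/eqP.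
by apply: eq_bigr => n _; rewrite (ipC mD (Hf n) Hx) sqmodJ.
Qed.

Variables (p : nat) (ep : R).
Hypothesis ep0 : 0 < ep.

Let res n x : R[i] := 1 * f n x - \sum_(m <- index_iota 0 p) ip (f n) (h m) * g m x.

Let part n m x : R[i] :=
  (n == m)%:R * (f m x - g m x) + ip (f n) (fun y => f m y - h m y) * g m x.

Let part_inL2 n m : inL2 (part n m).
Proof.
apply: (inL2D mD); first exact: (inL2Z mD _ (inL2B mD (Hf m) (Hg m))).
exact: (inL2Z mD _ (Hg m)).
Qed.

Let resE n : res n = fun x =>
  (p <= n)%:R * f n x + \sum_(m <- index_iota 0 p) part n m x.
Proof.
apply/funext => x; rewrite /res mul1r.
have E m : part n m x = (n == m)%:R * f m x - ip (f n) (h m) * g m x.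
  by rewrite /part (ipBr mD (Hf m) (Hh m) (Hf n)) ff; ring.
rewrite (eq_bigr _ (fun m _ => E m)) sumrB addrA; congr (_ - _).
case: (leqP p n) => pn.
  rewrite mul1r big_nat_cond big1 ?addr0// => m /andP[/andP[_ mp] _].
  by rewrite gtn_eqF ?mul0r// (leq_trans mp).
rewrite mul0r add0r (bigD1_seq n) ?mem_index_iota ?iota_uniq//= eqxx mul1r.
by rewrite big1 ?addr0// => m /negbTE; rewrite eq_sym => ->; rewrite mul0r.
Qed.

(** The residual of [f n] is [f n] itself for [n >= p], plus the errors of
    replacing the [f m] by the [g m], which concern only [n = m], plus those of
    replacing them by the [h m]. The last ones are spread over all [n], and
    Bessel's inequality sums them. *)
Lemma near_projection N :
  \sum_(0 <= n < N) lam n * nrm2 (res n) <=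
  (1 + ep) * (\sum_(0 <= n < N) lam n * (p <= n)%:R) +
  (1 + ep^-1) * (p%:R * (2 * \sum_(m <- index_iota 0 p) (L * nrm2 (fun x => f m x - g m x) +
     L * nrm2 (fun x => f m x - h m x) * nrm2 (g m)))).
Proof.
have e1 : 0 <= 1 + ep^-1 by rewrite addr_ge0// invr_ge0 ltW.
have Hfg m := inL2B mD (Hf m) (Hg m); have Hfh m := inL2B mD (Hf m) (Hh m).
have b n : nrm2 (res n) <= (1 + ep) * (p <= n)%:R + (1 + ep^-1) * (p%:R *
    (2 * \sum_(m <- index_iota 0 p) ((n == m)%:R * nrm2 (fun x => f m x - g m x) +
     sqmod (ip (f n) (fun x => f m x - h m x)) * nrm2 (g m)))).
  have Hp : inL2 (fun x => (p <= n)%:R * f n x) by exact: (inL2Z mD _ (Hf n)).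
  have Hs : inL2 (fun x => \sum_(m <- index_iota 0 p) part n m x) by exact: (inL2_sum mD).
  rewrite resE; apply: le_trans (nrm2D_le mD ep0 Hp Hs) _.
  apply: lerD.
    rewrite (nrm2Z mD _ (Hf n)) nf mulr1 le_eqVlt; apply/orP; left; apply/eqP.
    by case: (p <= n)%N; rewrite ?sqmod1 ?sqmod0.
  rewrite ler_wpM2l//; apply: le_trans (nrm2_sum_le mD _ (part_inL2 n)) _.
  rewrite size_iota subn0 ler_wpM2l// mulr_sumr; apply: ler_sum => m _.
  apply: le_trans (nrm2D_le2 mD (inL2Z mD _ (Hfg m)) (inL2Z mD _ (Hg m))) _.
  rewrite (nrm2Z mD _ (Hfg m)) (nrm2Z mD _ (Hg m)) -mulrDr ler_wpM2l// lerD2r.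
  by case: (n == m); rewrite ?sqmod1 ?sqmod0.
have S := fun n => ler_wpM2l (lam0 n) (b n).
apply: le_trans (ler_sum _ (fun n _ => S n)) _.
rewrite (eq_bigr _ (fun n _ => mulrDr _ _ _)) big_split /=; apply: lerD.
  by rewrite le_eqVlt mulr_sumr; apply/orP; left; apply/eqP; apply: eq_bigr => n _; rewrite mulrCA.
rewrite (eq_bigr (fun n => (1 + ep^-1) * (p%:R * (2 * (lam n * \sum_(m <- index_iota 0 p)
    ((n == m)%:R * nrm2 (fun x => f m x - g m x) +
     sqmod (ip (f n) (fun x => f m x - h m x)) * nrm2 (g m))))))); last first.
  by move=> n _; ring.
rewrite -!mulr_sumr ler_wpM2l// ler_wpM2l// ler_wpM2l//.
rewrite (eq_bigr _ (fun n _ => mulr_sumr _ _ _ _)) exchange_big /=; apply: ler_sum => m _.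
rewrite (eq_bigr _ (fun n _ => mulrDr _ _ _)) big_split /=; apply: lerD.
  rewrite (eq_bigr (fun n => (lam n * (n == m)%:R) * nrm2 (fun x => f m x - g m x))); last first.
    by move=> n _; rewrite mulrA.
  rewrite -mulr_suml ler_wpM2r ?nrm2_ge0//.
  have [mN|mN] := boolP (m \in index_iota 0 N).
    rewrite (bigD1_seq m) ?iota_uniq//= eqxx mulr1 big1 ?addr0// => n /negbTE ->.
    by rewrite mulr0.
  rewrite big_seq big1// => n nN; case: eqP => [E|_]; last by rewrite mulr0.
  by move: mN; rewrite -E nN.
rewrite (eq_bigr (fun n => (lam n * sqmod (ip (f n) (fun x => f m x - h m x))) * nrm2 (g m))).
  by rewrite -mulr_suml ler_wpM2r ?nrm2_ge0//; exact: weighted_bessel.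
by move=> n _; rewrite mulrA.
Qed.

End perturbed_projections.

(** * The error of the dynamic principal components *)

Section dynamic_principal_components.
Context {R : realType} {d : measure_display} {Om : measurableType d}
  (P : probability Om R).
Local Notation leb := (@lebesgue_measure R).
Local Notation ipH := (ip leb unitI).
Local Notation nrmH := (nrm2 leb unitI).
Local Notation nrmF f := (nrm2 (leb \x leb)%E (unitI `*` freqI) (uncurried f)).
Local Notation mI := (@measurable_unitI R).
Local Notation mF := (@measurable_freqI R).
Local Notation mUF := (@measurable_UF R).

Variable X : int -> Om -> R -> R[i].
Hypothesis sX : weakly_stationary P X.
Variable e : nat -> R -> R[i].
Hypothesis eB : orthonormal_basis e.
Hypothesis eS : (\esum_(h in [set: int]) HSnorm e (autocov_op P X h) < +oo)%E.
Variables (lam : nat -> R -> R) (phi : nat -> R -> R -> R[i]).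
Hypothesis srep : spectral_representation P X lam phi.
Hypothesis mphi : forall m, jointly_measurable (phi m).

Local Notation coef m := (fourier_coef (phi m)).
Local Notation sbound := (sbound P X e).

Let Hphi th m : freqI th -> inH (phi m th).
Proof. by move=> /srep[_ _ [H _] _]; exact: H. Qed.

Let phi_inL2 m : inL2 (leb \x leb)%E (unitI `*` freqI) (uncurried (phi m)).
Proof.
split; first exact: mphi.
rewrite -sqnorm_uncurried; last exact: mphi.
rewrite (eq_integral (cst 1%E)).
  rewrite integral_cst; last exact: mF.
  by rewrite [X in (_ * X)%E]leb_freqI -EFinM ltry.
move=> th; rewrite inE => Fth.
by rewrite /normH2 -(nrm2E (Hphi m Fth)) (nrm_phi srep).
Qed.

Lemma dfpc_classC m : classC (coef m).
Proof.
apply: (fourier_coef_classC (phi_inL2 m) (M := 1)) => th Fth.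
by split; [exact: Hphi|rewrite (nrm_phi srep)].
Qed.

Let Hc m l : inH (coef m l). Proof. by have [H _] := dfpc_classC m. Qed.

Let trunc m N := fpoly (coef m) (irange N).
Let rest m N th u := phi m th u - trunc m N th u.

Let trunc_inH m N th : inH (trunc m N th). Proof. exact: fpoly_inH. Qed.

Let rest_inH m N th : freqI th -> inH (rest m N th).
Proof. by move=> Fth; exact: (inL2B mI (Hphi m Fth) (trunc_inH m N th)). Qed.

Let rest_inL2 m N : inL2 (leb \x leb)%E (unitI `*` freqI) (uncurried (rest m N)).
Proof. exact: (inL2B mUF (phi_inL2 m) (inL2_fpoly (irange N) (Hc m))). Qed.

Let mrest m N : jointly_measurable (rest m N).
Proof. by case: (rest_inL2 m N). Qed.

Let rest_cvg m : nrmF (rest m N) @[N --> \oo] --> (0 : R).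
Proof.
have := (L2_cvgP mUF (fun N => inL2_fpoly (irange N) (Hc m)) (phi_inL2 m)).1
  (fourier_coef_cvg (phi_inL2 m)).
rewrite (_ : (fun n => _) = (fun N => nrmF (rest m N)))//.
by apply/funext => N; rewrite nrm2BC.
Qed.

(* A bound for the truncated response that is uniform in the frequency but not in
   [N]: the inner truncation has to be removed first. *)
Let cap m N : R := (size (irange N))%:R * \sum_(l <- irange N) nrmH (coef m l).

Let cap0 m N : 0 <= cap m N.
Proof. by rewrite mulr_ge0// sumr_ge0// => l _; exact: nrm2_ge0. Qed.

Let trunc_cap m N th : nrmH (trunc m N th) <= cap m N.
Proof. exact: nrm_fpoly_le. Qed.

Variables (t : int) (p : nat).

Let tail := (\sum_(p <= n <oo) \int[leb]_(th in freqI) (lam n th)%:E)%E.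

Let mlam n : measurable_fun freqI (fun th => (lam n th)%:E).
Proof. by apply/measurable_EFinP; exact: (measurable_lam sX eB eS srep mphi). Qed.

Let lam0 n th : freqI th -> (0 <= (lam n th)%:E)%E.
Proof. by move=> Fth; rewrite lee_fin (lam_ge0 srep). Qed.

Let weight ep : R := (1 + ep^-1) * (p%:R * 2) * sbound.

Let weight0 ep : 0 < ep -> 0 <= weight ep.
Proof.
move=> ep0; rewrite mulr_ge0 ?sbound_ge0// mulr_ge0 ?mulr_ge0//.
by rewrite addr_ge0// invr_ge0 ltW.
Qed.

Let pointwise ep N K th : 0 < ep -> freqI th ->
  (\sum_(0 <= n <oo) (lam n th * nrmH (fun u => (1 * phi n th u -
       \sum_(m <- index_iota 0 p) ipH (phi n th) (trunc m K th) * trunc m N th u)%R))%:E <=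
   (1 + ep)%:E * (\sum_(p <= n <oo) (lam n th)%:E) +
   \sum_(m <- index_iota 0 p) ((weight ep)%:E * normH2 (rest m N th) +
     (weight ep * cap m N)%:E * normH2 (rest m K th)))%E.
Proof.
move=> ep0 Fth; have e1 : 0 <= 1 + ep by rewrite addr_ge0// ltW.
apply: lime_le.
  apply: is_cvg_ereal_nneg_natsum => n _.
  by rewrite lee_fin mulr_ge0 ?nrm2_ge0// (lam_ge0 srep).
exists p => // T /= pT; rewrite sumEFin.
have := near_projection (L := sbound) mI (fun n => Hphi n Fth) (fun m => trunc_inH m N th)
  (fun m => trunc_inH m K th) (fun i j => phi_orthonormal srep i j Fth)
  (fun n => lam_ge0 srep n Fth) (fun n => lam_le sX eB eS srep n Fth) p ep0 T.
rewrite -lee_fin => /le_trans; apply; rewrite EFinD; apply: leeD.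
  rewrite -(sum_tailE _ pT) EFinM; apply: lee_wpmul2l; first by rewrite lee_fin.
  rewrite -sumEFin; apply: nneseries_lim_ge => n _ _; exact: lam0.
have -> : (\sum_(m <- index_iota 0 p) ((weight ep)%:E * normH2 (rest m N th) +
     (weight ep * cap m N)%:E * normH2 (rest m K th)))%E =
   (\sum_(m <- index_iota 0 p) (weight ep * nrmH (rest m N th) +
     weight ep * cap m N * nrmH (rest m K th)))%:E.
  rewrite -sumEFin; apply: eq_bigr => m _.
  by rewrite /normH2 -!(nrm2E (rest_inH _ _ Fth)) EFinD !EFinM.
rewrite lee_fin !mulr_sumr; apply: ler_sum => m _.
set a := nrmH (rest m N th); set b := nrmH (rest m K th).
have a0 : 0 <= a by exact: nrm2_ge0.
have b0 : 0 <= b by exact: nrm2_ge0.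
have w0 := weight0 ep0.
have -> : (1 + ep^-1) * (p%:R * (2 * (sbound * a + sbound * b * nrmH (trunc m N th)))) =
   weight ep * a + weight ep * nrmH (trunc m N th) * b.
  by rewrite /weight; ring.
by rewrite lerD2l ler_wpM2r// ler_wpM2l.
Qed.

Let finite_bound ep N K : 0 < ep ->
  (E_normH2 P (two_step X (fun m => coef m) (fun m => coef m) 1%R t
     (index_iota 0 p) (irange N) (irange K)) <=
   (1 + ep)%:E * tail + (\sum_(m <- index_iota 0 p) (weight ep * nrmF (rest m N) +
     weight ep * cap m N * nrmF (rest m K)))%:E)%E.
Proof.
move=> ep0; have e1 : 0 <= 1 + ep by rewrite addr_ge0// ltW.
have w0 := weight0 ep0.
rewrite (two_step_error sX eB eS srep Hc Hc).
pose A th := ((1 + ep)%:E * \sum_(p <= n <oo) (lam n th)%:E)%E.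
pose B m th := ((weight ep)%:E * normH2 (rest m N th) +
     (weight ep * cap m N)%:E * normH2 (rest m K th))%E.
have mS : measurable_fun freqI (fun th => \sum_(p <= n <oo) (lam n th)%:E)%E.
  apply: (eq_measurable_fun (fun th => \sum_(0 <= n <oo) (lam (n + p)%N th)%:E)%E).
    move=> th; rewrite inE => Fth.
    by rewrite (@nneseries_addn _ (fun n => (lam n th)%:E))// => n; exact: lam0.
  by apply: ge0_emeasurable_sum => [n th Fth _|n _]; [exact: lam0|exact: mlam].
have S0 th : freqI th -> (0 <= \sum_(p <= n <oo) (lam n th)%:E)%E.
  by move=> Fth; apply: nneseries_ge0 => n _ _; exact: lam0.
have B1 m th : (0 <= (weight ep)%:E * normH2 (rest m N th))%E.
  by apply: mule_ge0; [rewrite lee_fin|exact: sqnorm_ge0].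
have B2 m th : (0 <= (weight ep * cap m N)%:E * normH2 (rest m K th))%E.
  by apply: mule_ge0; [rewrite lee_fin mulr_ge0|exact: sqnorm_ge0].
have m1 m : measurable_fun freqI (fun th => (weight ep)%:E * normH2 (rest m N th))%E.
  by apply: measurable_funeM; exact: measurable_normH2.
have m2 m : measurable_fun freqI (fun th => (weight ep * cap m N)%:E * normH2 (rest m K th))%E.
  by apply: measurable_funeM; exact: measurable_normH2.
have mB m : measurable_fun freqI (B m) by exact: emeasurable_funD.
have iB m : (\int[leb]_(th in freqI) B m th = (weight ep * nrmF (rest m N) +
     weight ep * cap m N * nrmF (rest m K))%:E)%E.
  rewrite ge0_integralD//; last exact: mF.
  have p1 : (0 <= (weight ep)%:E)%E by rewrite lee_fin.
  have p2 : (0 <= (weight ep * cap m N)%:E)%E by rewrite lee_fin mulr_ge0.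
  rewrite !ge0_integralZl//; last 6 first.
  - exact: mF.
  - exact: measurable_normH2.
  - by move=> th _; exact: sqnorm_ge0.
  - exact: mF.
  - exact: measurable_normH2.
  - by move=> th _; exact: sqnorm_ge0.
  by rewrite !sqnorm_uncurried// -!(nrm2E (rest_inL2 _ _)) -!EFinM -EFinD.
have iA : (\int[leb]_(th in freqI) A th = (1 + ep)%:E * tail)%E.
  rewrite /A ge0_integralZl//; last exact: mF.
  congr (_ * _)%E; rewrite /tail.
  rewrite -nneseries_addn => [|n]; last by apply: integral_ge0 => th Fth; exact: lam0.
  rewrite -integral_nneseries//; last 2 first.
  - exact: mF.
  - by move=> n th Fth; exact: lam0.
  apply: eq_integral => th; rewrite inE => Fth.
  by rewrite (@nneseries_addn _ (fun n => (lam n th)%:E))// => n; exact: lam0.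
apply: (@le_trans _ _ (\int[leb]_(th in freqI) (A th + \sum_(m <- index_iota 0 p) B m th))%E).
  apply: ge0_le_integral.
  - exact: mF.
  - move=> th Fth; apply: nneseries_ge0 => n _ _.
    by rewrite lee_fin mulr_ge0 ?nrm2_ge0// (lam_ge0 srep).
  - exact: (measurable_two_step_residuals sX eB eS srep Hc Hc mphi).
  - by apply: emeasurable_funD; [exact: measurable_funeM|exact: emeasurable_sum].
  - by move=> th Fth; exact: pointwise.
rewrite ge0_integralD//; last 5 first.
- exact: mF.
- by move=> th Fth; apply: mule_ge0; [rewrite lee_fin|exact: S0].
- exact: measurable_funeM.
- by move=> th Fth; apply: sume_ge0 => m _; apply: adde_ge0.
- exact: emeasurable_sum.
rewrite iA leeD2l// ge0_integral_sum//; last 2 first.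
- exact: mF.
- by move=> m th Fth; apply: adde_ge0.
by rewrite -sumEFin (eq_bigr _ (fun m _ => iB m)).
Qed.

(** The truncations are removed one after the other; what remains of the weighted
    triangle inequality is an arbitrarily small multiple of the tail. *)
Lemma dfpc_upper_bound :
  (E_normH2 P (fun w u => (X t w u - \sum_(m < p)
      reconstruction P X (fourier_coef (phi m)) (fourier_coef (phi m)) t w u)%R)
   <= \sum_(p <= n <oo) \int[leb]_(th in freqI) (lam n th)%:E)%E.
Proof.
have tail0 : (0 <= tail)%E.
  by apply: nneseries_ge0 => n _ _; apply: integral_ge0 => th Fth; exact: lam0.
rewrite -/tail; have [tinf|tfin] := eqVneq tail +oo%E; first by rewrite tinf leey.
have tE : tail = (fine tail)%:E by rewrite fineK// ge0_fin_numE// ltey.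
set s := fine tail in tE; have s0 : 0 <= s by rewrite fine_ge0.
have [q [q1 q2]] := filter_limit sX eB eS srep dfpc_classC dfpc_classC t p.
rewrite tE; apply/lee_addgt0Pr => eta eta0.
pose ep := eta / (s + 1); have s1 : 0 < s + 1 by rewrite ltr_wpDl.
have ep0 : 0 < ep by rewrite divr_gt0.
have Lq N : (q N <= ((1 + ep) * s + \sum_(m <- index_iota 0 p) weight ep * nrmF (rest m N))%:E)%E.
  apply: (lee_cvg_to (q1 N) _ (g := fun K => ((1 + ep) * s + \sum_(m <- index_iota 0 p)
     (weight ep * nrmF (rest m N) + weight ep * cap m N * nrmF (rest m K)))%:E)).
    apply: cvg_EFin; first exact: nearW.
    apply: cvgD; first exact: cvg_cst.
    apply: cvg_big => [|m _]; first exact: add_continuous.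
     rewrite -[X in _ --> X]addr0; apply: cvgD; first exact: cvg_cst.
    by rewrite -(mulr0 (weight ep * cap m N)); apply: cvgM; [exact: cvg_cst|exact: rest_cvg].
  by apply: nearW => K; have := finite_bound N K ep0; rewrite tE -EFinM -EFinD.
have LE : (E_normH2 P (fun w u => (X t w u - \sum_(m < p)
    reconstruction P X (coef m) (coef m) t w u)%R) <= ((1 + ep) * s)%:E)%E.
  apply: (lee_cvg_to q2 _ (g := fun N => ((1 + ep) * s +
    \sum_(m <- index_iota 0 p) weight ep * nrmF (rest m N))%:E)).
    apply: cvg_EFin; first exact: nearW.
    rewrite -[X in _ --> X]addr0; apply: cvgD; first exact: cvg_cst.
    have : \sum_(m <- index_iota 0 p) weight ep * nrmF (rest m N) @[N --> \oo] -->
        \sum_(m <- index_iota 0 p) weight ep * 0.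
      apply: cvg_big => [|m _]; first exact: add_continuous.
      by apply: cvgM; [exact: cvg_cst|exact: rest_cvg].
    by rewrite big1// => m _; rewrite mulr0.
  by apply: nearW => N; exact: Lq.
apply: le_trans LE _; rewrite -EFinD lee_fin mulrDl mul1r lerD2l /ep.
by rewrite mulrAC ler_pdivrMr// ler_wpM2l ?(ltW eta0)// lerDl.
Qed.

End dynamic_principal_components.

Theorem theorem2 (R : realType) (d : measure_display) (Om : measurableType d)
    (P : probability Om R) (X : int -> Om -> R -> R[i])
    (e : nat -> R -> R[i])
    (lam : nat -> R -> R) (phi : nat -> R -> R -> R[i])
    (psi ups : nat -> int -> R -> R[i]) :
  weakly_stationary P X ->
  orthonormal_basis e ->
  (\esum_(h in [set: int]) HSnorm e (autocov_op P X h) < +oo)%E ->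
  spectral_representation P X lam phi ->
  (forall m, jointly_measurable (phi m)) ->
  (forall m, classC (psi m)) ->
  (forall m, classC (ups m)) ->
  forall (p : nat) (t : int), (0 < p)%N ->
  E_normH2 P (fun w u => X t w u - \sum_(m < p)
      reconstruction P X (fourier_coef (phi m)) (fourier_coef (phi m)) t w u)
    = (\sum_(p <= m <oo) \int[lebesgue_measure]_(theta in freqI) (lam m theta)%:E)%E
  /\
  ((\sum_(p <= m <oo) \int[lebesgue_measure]_(theta in freqI) (lam m theta)%:E)
    <= E_normH2 P (fun w u => (X t w u - \sum_(m < p)
         reconstruction P X (psi m) (ups m) t w u)%R))%E.
Proof.
move=> sX eB eS srep mphi Cpsi Cups p t _.
have Cphi m := dfpc_classC srep mphi m.
split; last exact: (reconstruction_lower_bound sX eB eS srep mphi Cpsi Cups).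
apply/eqP; rewrite eq_le (dfpc_upper_bound sX eB eS srep mphi).
exact: (reconstruction_lower_bound sX eB eS srep mphi Cphi Cphi).
Qed.
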